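(* Let $M^{2}$ be a $2$-dimensional, oriented Riemannian manifold. (i) If $h:M^{2}\rightarrow Q^{3}$ is a minimal isometric immersion without totally geodesic points, where $Q^{3}$ is an umbilical hypersurface of $\mathbb{H}^{4}$, then its associate $\widehat{h}:M^{2}\rightarrow \mathbb{S}_{1}^{4}$ is a spacelike stationary immersion with normal curvature identically zero and without totally geodesic points. (ii) Conversely, assume that $g:M^{2}\rightarrow \mathbb{S}_{1}^{4}$ is a stationary isometric immersion with normal curvature identically zero and without totally geodesic points. Then there exist a nonzero vector $w\in\mathbb{R}^5_1$ and a totally geodesic point free minimal immersion $h:M^{2}\rightarrow Q^{3}$, where $Q^{3}$ is an umbilical hypersurface of $\mathbb{H}^{4}$ with sectional curvature $K_{Q^{3}}=-\langle w,w\rangle$, such that $\langle g(x),w\rangle =0$ for each $x\in M^{2}$ and $g=\widehat{h}$.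
   Context: All manifolds are connected. $\mathbb{R}_{1}^{5}$ is $\mathbb{R}^{5}$ with the Lorentzian metric $\langle x,y\rangle =-x_{0}y_{0}+\sum_{i=1}^{4}x_{i}y_{i}$. The hyperbolic space is $\mathbb{H}^{4}=\{x\in \mathbb{R}_{1}^{5}:\langle x,x\rangle =-1,\ x_{0}>0\}$ and the de Sitter space is $\mathbb{S}_{1}^{4}=\{x\in \mathbb{R}_{1}^{5}:\langle x,x\rangle =1\}$. An immersion $g:M^2\to\mathbb{S}^4_1$ is spacelike if the induced metric is Riemannian; it is stationary if it is spacelike and its mean curvature vector field vanishes identically. A point is totally geodesic for an immersion if its second fundamental form vanishes there (for $h$, the second fundamental form as a surface in $Q^3$). With respect to an orthonormal adapted frame $\{e_1,e_2;e_3,e_4\}$ along $g$ ($e_1,e_2$ tangent, $e_3,e_4$ normal, $e_4$ timelike), with shape operators $A_3,A_4$ in the directions $e_3,e_4$, the normal curvature of $g$ is $K^{\perp}=\langle [A_3,A_4]e_1,e_2\rangle$. An umbilical hypersurface $Q^3$ of $\mathbb{H}^{4}$ is an intersection of $\mathbb{H}^{4}$ with an affine hyperplane of $\mathbb{R}_{1}^{5}$ (of dimension 3); it has constant sectional curvature $K_{Q^3}$. Associate: if $h:M^{2}\rightarrow Q^{3}$ is an immersion of an oriented surface into an umbilical hypersurface of $\mathbb{H}^4$, with unit normal vector field $N$ (the orientation of $h$, tangent to $Q^3$), then $N$, viewed as a vector of $\mathbb{R}^5_1$, defines a map $\widehat{h}:=N:M^{2}\rightarrow \mathbb{S}_{1}^{4}$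 called the associate of $h$. In (ii) the metric on $M^2$ induced by $h$ is in general different from that induced by $g$, and $g=\widehat{h}$ means that $g$ is a unit normal vector field of $h$ in $Q^3$. *)

(* Defs.v *)
From HB Require Import structures.
From mathcomp Require Import all_boot all_order all_algebra.
From mathcomp Require Import all_classical all_reals all_analysis.

Set Implicit Arguments.
Unset Strict Implicit.
Unset Printing Implicit Defensive.

Import Order.TTheory GRing.Theory Num.Theory.
Import numFieldNormedType.Exports.

Local Open Scope classical_set_scope.
Local Open Scope ring_scope.

(* Smoothness on an open set U: all iterated directional derivatives exist
   (as Frechet differentiable maps) and are continuous. *)
Section Smooth.
Variables (R : realType) (V W : normedModType R).

Fixpoint Ck (k : nat) (U : set V) (f : V -> W) : Prop :=
  if k is k'.+1 then
    (forall x, U x -> differentiable f x) /\ (forall v, Ck k' U ('D_v f))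
  else forall x, U x -> {for x, continuous f}.

Definition smooth_on (U : set V) (f : V -> W) : Prop := forall k, Ck k U f.

End Smooth.

(* Vectors are row vectors and a bilinear form with matrix G is
   (v, w) |-> v G w^T; 'J f x is the matrix whose a-th row is the a-th partial
   derivative of f, so that 'd f x v = v *m 'J f x. *)
Section Linear.
Variable R : realType.

Definition form n (G : 'M[R]_n) (v w : 'rV[R]_n) : R := (v *m G *m w^T) 0 0.

Definition posdef n (G : 'M[R]_n) : Prop :=
  forall v : 'rV[R]_n, v != 0 -> 0 < form G v v.

Definition e_ n (i : 'I_n) : 'rV[R]_n := delta_mx 0 i.

Definition lor (x y : 'rV[R]_5) : R :=
  - (x 0 0 * y 0 0) + \sum_(i < 4) x 0 (lift 0 i) * y 0 (lift 0 i).

Definition gram m n (A : 'M[R]_(m, 5)) (B : 'M[R]_(n, 5)) : 'M[R]_(m, n) :=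
  \matrix_(i, j) lor (row i A) (row j B).

(* Component of v that is [lor]-orthogonal to the rows of B; it is meaningful
   when these rows are independent and span a nondegenerate subspace, i.e. when
   their Gram matrix is invertible. *)
Definition normal_part k (B : 'M[R]_(k, 5)) (v : 'rV[R]_5) : 'rV[R]_5 :=
  v - gram v B *m invmx (gram B B) *m B.

Definition H4 : set 'rV[R]_5 := [set x | lor x x = -1 /\ 0 < x 0 0].

Definition S41 : set 'rV[R]_5 := [set x | lor x x = 1].

End Linear.

Arguments e_ {R n} i.
Arguments H4 {R}.
Arguments S41 {R}.

Section Surfaces.
Variable R : realType.

(* Connected oriented smooth surfaces, given by an oriented smooth atlas;
   [param i] is the inverse of the chart [coord i : dom i -> 'rV_2] and is
   irrelevant outside the image of that chart. *)
Record orientedSurface := OrientedSurface {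
  surface_space :> topologicalType ;
  surface_hausdorff : hausdorff_space surface_space ;
  surface_second_countable : @second_countable surface_space ;
  surface_connected : connected [set: surface_space] ;
  chart : Type ;
  dom : chart -> set surface_space ;
  coord : chart -> surface_space -> 'rV[R]_2 ;
  param : chart -> 'rV[R]_2 -> surface_space ;
  dom_open : forall i, open (dom i) ;
  dom_cover : forall p, exists i, dom i p ;
  image_open : forall i, open (coord i @` dom i) ;
  coordK : forall i p, dom i p -> param i (coord i p) = p ;
  coord_continuous : forall i p, dom i p -> {for p, continuous (coord i)} ;
  param_continuous : forall i x, (coord i @` dom i) x ->
    {for x, continuous (param i)} ;
  transition_smooth : forall i j,
    smooth_on (coord i @` (dom i `&` dom j)) (coord j \o param i) ;
  transition_oriented : forall i j x, (coord i @` (dom i `&` dom j)) x ->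
    0 < \det ('J (coord j \o param i) x)
}.

Definition chart_image (M : orientedSurface) (i : chart M) : set 'rV[R]_2 :=
  coord i @` dom i.

Record riemannianMetric (M : orientedSurface) := RiemannianMetric {
  met : chart M -> 'rV[R]_2 -> 'M[R]_2 ;
  met_smooth : forall i, smooth_on (chart_image i) (met i) ;
  met_sym : forall i x, chart_image i x -> (met i x)^T = met i x ;
  met_posdef : forall i x, chart_image i x -> posdef (met i x) ;
  met_compat : forall i j x, (coord i @` (dom i `&` dom j)) x ->
    let t := coord j \o param i in
    met i x = 'J t x *m met j (t x) *m ('J t x)^T
}.

(* Local geometry of a map f from an open subset of the coordinate plane to a
   submanifold of R^5_1 whose normal space at p (in R^5_1) is spanned by the
   rows of [nu p]. The Levi-Civita connection of the submanifold being the
   tangential part of the flat one, the normal component of the covariant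
   derivative of f_*w along v is the component of the second derivative
   orthogonal both to [nu (f x)] and to the tangent plane of f. *)
Section Local.
Variables (k : nat) (nu : 'rV[R]_5 -> 'M[R]_(k, 5)) (f : 'rV[R]_2 -> 'rV[R]_5).

Definition induced (x : 'rV[R]_2) : 'M[R]_2 := gram ('J f x) ('J f x).

Definition sff (x v w : 'rV[R]_2) : 'rV[R]_5 :=
  normal_part (col_mx (nu (f x)) ('J f x)) ('D_v ('D_w f) x).

Definition mean_curvature (x : 'rV[R]_2) : 'rV[R]_5 :=
  2^-1 *: \sum_(a < 2) \sum_(b < 2) (invmx (induced x)) a b *: sff x (e_ a) (e_ b).

(* v *m shape x xi is A_xi v, where <A_xi v, w> = <sff v w, xi>. *)
Definition shape (x : 'rV[R]_2) (xi : 'rV[R]_5) : 'M[R]_2 :=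
  (\matrix_(a, b) lor (sff x (e_ a) (e_ b)) xi) *m invmx (induced x).

Definition normal_vector (x : 'rV[R]_2) (xi : 'rV[R]_5) : Prop :=
  gram xi (col_mx (nu (f x)) ('J f x)) = 0.

Definition adapted_frame (x e1 e2 : 'rV[R]_2) (e3 e4 : 'rV[R]_5) : Prop :=
  [/\ form (induced x) e1 e1 = 1, form (induced x) e2 e2 = 1
    & form (induced x) e1 e2 = 0] /\
  [/\ normal_vector x e3, normal_vector x e4,
      lor e3 e3 = 1, lor e4 e4 = -1 & lor e3 e4 = 0].

(* <[A3, A4] e1, e2> *)
Definition normal_curvature (x e1 e2 : 'rV[R]_2) (e3 e4 : 'rV[R]_5) : R :=
  let A3 := shape x e3 in let A4 := shape x e4 in
  form (induced x) (e1 *m A4 *m A3 - e1 *m A3 *m A4) e2.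

End Local.

Section Global.
Variable M : orientedSurface.
Implicit Type f : M -> 'rV[R]_5.

Definition in_charts (P : ('rV[R]_2 -> 'rV[R]_5) -> 'rV[R]_2 -> Prop) f : Prop :=
  forall (i : chart M) x, chart_image i x -> P (f \o param i) x.

Definition smooth_map f : Prop :=
  forall i : chart M, smooth_on (chart_image i) (f \o param i).

Definition immersion_into (S : set 'rV[R]_5) f : Prop :=
  [/\ forall p, S (f p), smooth_map f
    & in_charts (fun F x => row_free ('J F x)) f].

Definition isometric (m : riemannianMetric M) f : Prop :=
  forall (i : chart M) x, chart_image i x -> induced (f \o param i) x = met m i x.

Definition spacelike f : Prop := in_charts (fun F x => posdef (induced F x)) f.

Definition zero_mean_curvature k (nu : 'rV[R]_5 -> 'M[R]_(k, 5)) f : Prop :=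
  in_charts (fun F x => mean_curvature nu F x = 0) f.

Definition totally_geodesic_point k (nu : 'rV[R]_5 -> 'M[R]_(k, 5)) f (p : M) :
  Prop :=
  exists2 i : chart M, dom i p &
    forall v w, sff nu (f \o param i) (coord i p) v w = 0.

Definition no_totally_geodesic_point k (nu : 'rV[R]_5 -> 'M[R]_(k, 5)) f : Prop :=
  forall p, ~ totally_geodesic_point nu f p.

End Global.

(* The position vector spans the normal line of S41 in R^5_1. *)
Definition nuS (p : 'rV[R]_5) : 'M[R]_(1, 5) := p.

Section DeSitter.
Variable M : orientedSurface.
Implicit Type g : M -> 'rV[R]_5.

Definition stationary_immersion g : Prop :=
  [/\ immersion_into S41 g, spacelike g & zero_mean_curvature nuS g].

(* Different adapted frames change the normal curvature at most by a sign. *)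
Definition flat_normal_bundle g : Prop :=
  in_charts (fun F x => forall e1 e2 e3 e4, adapted_frame nuS F x e1 e2 e3 e4 ->
    normal_curvature nuS F x e1 e2 e3 e4 = 0) g.

End DeSitter.

(* Since [lor] is nondegenerate, every affine hyperplane of R^5_1 has the form
   <x, u> = c with u != 0. The intersection with H4 is 3-dimensional when it is
   nonempty and transversal, i.e. the normals x (of H4) and u (of the
   hyperplane) are independent along it; a nontransversal nonempty intersection
   is a single point. *)
Record umbilicalHypersurface := UmbilicalHypersurface {
  hyp_dir : 'rV[R]_5 ;
  hyp_level : R ;
  umb_set := H4 `&` [set x | lor x hyp_dir = hyp_level] ;
  hyp_dir_neq0 : hyp_dir != 0 ;
  umb_nonempty : umb_set !=set0 ;
  umb_transversal : forall x, umb_set x -> row_free (col_mx x hyp_dir)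
}.

Definition nuQ (Q : umbilicalHypersurface) (p : 'rV[R]_5) : 'M[R]_(1 + 1, 5) :=
  col_mx p (hyp_dir Q).

Section Associate.
Variables (M : orientedSurface) (Q : umbilicalHypersurface).
Implicit Types h N : M -> 'rV[R]_5.

Definition minimal_immersion h : Prop :=
  immersion_into (umb_set Q) h /\ zero_mean_curvature (nuQ Q) h.

(* N is a unit normal vector field of h in Q, i.e. the associate of h for one of
   its two orientations. *)
Definition associate h N : Prop :=
  [/\ smooth_map N, forall p, lor (N p) (N p) = 1
    & forall (i : chart M) x, chart_image i x ->
        normal_vector (nuQ Q) (h \o param i) x (N (param i x))].

End Associate.

(* Curvature of a Riemannian metric given by its coordinate matrix G. *)
Section Curvature.
Variables (n : nat) (G : 'rV[R]_n.+1 -> 'M[R]_n.+1).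
Implicit Types (x : 'rV[R]_n.+1) (i j k l : 'I_n.+1).

Definition dmet i j l x : R := 'D_(e_ i) (fun y => G y j l) x.

(* Gamma^k_ij *)
Definition christoffel i j k x : R :=
  2^-1 * \sum_(l < n.+1)
    (invmx (G x)) k l * (dmet i j l x + dmet j i l x - dmet l i j x).

(* R^l_ijk, where R(d_i, d_j) d_k = \sum_l R^l_ijk d_l and
   R(X, Y) = [nabla_X, nabla_Y] - nabla_[X, Y]. *)
Definition riemann i j k l x : R :=
  'D_(e_ i) (christoffel j k l) x - 'D_(e_ j) (christoffel i k l) x
  + \sum_(m < n.+1) (christoffel j k m x * christoffel i m l x
                     - christoffel i k m x * christoffel j m l x).


Definition riemannXYY x (X Y : 'rV[R]_n.+1) : 'rV[R]_n.+1 :=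
  \row_l \sum_(i < n.+1) \sum_(j < n.+1) \sum_(k < n.+1)
    X 0 i * Y 0 j * Y 0 k * riemann i j k l x.

Definition sectional x (X Y : 'rV[R]_n.+1) : R :=
  form (G x) (riemannXYY x X Y) X /
  (form (G x) X X * form (G x) Y Y - form (G x) X Y ^+ 2).

End Curvature.

Definition local_parametrization (Q : umbilicalHypersurface)
    (V : set 'rV[R]_3) (phi : 'rV[R]_3 -> 'rV[R]_5) : Prop :=
  [/\ open V, smooth_on V phi
    & forall x, V x -> umb_set Q (phi x) /\ row_free ('J phi x)].

Definition has_sectional_curvature (Q : umbilicalHypersurface) (K : R) : Prop :=
  forall V phi, local_parametrization Q V phi ->
  forall x, V x -> forall X Y : 'rV[R]_3, row_free (col_mx X Y) ->
    sectional (fun y => gram ('J phi y) ('J phi y)) x X Y = K.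

End Surfaces.

(* Main.v *)
Require Import Defs.
From mathcomp Require Import all_boot all_order all_algebra.
From mathcomp Require Import all_classical all_reals all_analysis.
From mathcomp Require Import ring lra.

(** The hyperplane <x,w> = c cuts H4 in curvature -<w,w>/(<w,w> + c^2), so the scaling <w,w> + c^2 =
    1 is what turns this into -<w,w>. It leaves three normal forms (<w,w>, c), one for each causal
    type of w: (-1, -sqrt 2), (1, 0) and (0, -1). For spacelike or null w, h is a combination of w
    and of the normal part of e_0, which is timelike and orients the normal bundle in time. For
    timelike w that part may be proportional to w; instead h = sqrt 2 w + z with z a unit normal
    orthogonal to w, and choosing the sign of z globally uses the orientation of M.

    Before xi can be differentiated it must be a smooth field. It is therefore defined as the
    solution of an invertible linear system, and the equation <xi,k> = 1 for a fixed vector k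
    removes the scaling freedom, so that a constant line becomes a constant vector. This gives w
    only near a point. Such a local w is unique up to scale because B does not vanish, and
    connectedness then makes one w serve the whole surface. *)

(* For a unit normal N of a minimal h in Q = H4 /\ {<x,u> = c}, the derivatives of N
   are tangent to h, and dN = - (B I^-1) dh where B is the second fundamental form
   and I the induced metric. As I^-1 B is traceless, (I^-1 B)^2 is a scalar, so N is
   conformal to h, and the second fundamental form of N is B times a fixed normal
   vector: N is stationary with flat normal bundle. The relation is symmetric in h
   and N.

   Conversely, for a stationary g with flat normal bundle the shape operators in two
   normal directions are commuting traceless symmetric 2x2 matrices, hence
   proportional: the second fundamental form is B_ab eta with det B <> 0. If xi is
   normal and orthogonal to eta then <d_c xi, g_ab> = - <xi, g_abc> = theta_c B_ab is
   symmetric in all indices, which forces theta = 0: the line of xi is constant, so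
   g is orthogonal to a fixed vector w. The map h is then found in the normal plane
   of g, with <h,h> = -1 and <h,w> = c, where c^2 + <w,w> = 1; the Gauss equation of
   H4 /\ {<x,w> = c} gives its curvature - <w,w>. *)

Set Implicit Arguments.
Unset Strict Implicit.
Unset Printing Implicit Defensive.
Import Order.TTheory GRing.Theory Num.Theory.
Import numFieldNormedType.Exports.
Local Open Scope classical_set_scope.
Local Open Scope ring_scope.

(* These names are also used by mathcomp libraries. *)
Local Notation form := Defs.form.
Local Notation induced := Defs.induced.
Local Notation shape := Defs.shape.
Local Notation coord := Defs.coord.

(** * Calculus of smooth maps *)

Section Calculus.
Variable R : realType.
Implicit Types V W : normedModType R.

(** The linear approximation of [f] also approximates [g], and [diff_unique] identifies it with the
    differential of [g]. *)
Lemma near_eq_differentiable V W (f g : V -> W) x :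
  (\forall y \near x, f y = g y) -> differentiable f x -> differentiable g x.
Proof.
move=> fg /diff_locallyP[cdf df].
have dg : g \o shift x = cst (g x) + 'd f x +o_ 0 id.
  apply/eqaddoP => e e0.
  move/eqaddoP : df => /(_ e e0); rewrite -(nbhs_singleton fg).
  have fg0 : \forall y \near (0 : V), f (y + x) = g (y + x).
    by move: fg; rewrite (near_shift 0) /= subr0.
  apply: filterS2 fg0 => y fgy.
  suff -> : (f \o shift x - (cst (f x) + 'd f x)) y =
            (g \o shift x - (cst (f x) + 'd f x)) y by [].
  by rewrite [LHS]/(f (y + x) - _) fgy.
by apply/diff_locallyP; rewrite (diff_unique cdf dg).
Qed.

Lemma open_near V (U : set V) x : open U -> U x -> \forall y \near x, U y.
Proof. by move=> oU Ux; exact: open_nbhs_nbhs. Qed.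

Lemma near_eq_continuous V W (f g : V -> W) x :
  (\forall y \near x, f y = g y) -> {for x, continuous f} -> {for x, continuous g}.
Proof.
move=> fg cf; rewrite /prop_for /continuous_at -(nbhs_singleton fg).
apply: cvg_trans cf; apply: near_eq_cvg; apply: filterS fg => y ->//.
Qed.

Lemma Ck_ext V W k (U : set V) (f g : V -> W) : open U ->
  (forall x, U x -> f x = g x) -> Ck k U f -> Ck k U g.
Proof.
move=> oU; elim: k f g => [|k IH] f g fg.
  move=> cf x Ux; apply: near_eq_continuous (cf x Ux).
  by apply: filterS (open_near oU Ux) => y /fg.
move=> [df Df]; split.
  move=> x Ux; apply: near_eq_differentiable (df x Ux).
  by apply: filterS (open_near oU Ux) => y /fg.
move=> v; apply: IH (Df v) => x Ux; apply: near_eq_derive.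
by apply: filterS (open_near oU Ux) => y /fg.
Qed.

Lemma CkS V W k (U : set V) (f : V -> W) : Ck k.+1 U f -> Ck k U f.
Proof.
elim: k f => [|k IH] f [df Df].
  by move=> x Ux; apply: differentiable_continuous; exact: df.
by split=> // v; apply: IH.
Qed.

Lemma Ck_cst V W k (U : set V) (c : W) : Ck k U (cst c : V -> W).
Proof.
elim: k c => [|k IH] c; first by move=> x _; exact: cst_continuous.
split=> [x _|v]; first exact: differentiable_cst.
suff -> : 'D_v (cst c : V -> W) = cst 0 by [].
by apply/funext => x; exact: derive_cst.
Qed.

Lemma Ck_subset V W k (U U' : set V) (f : V -> W) : U `<=` U' ->
  Ck k U' f -> Ck k U f.
Proof.
move=> UU'; elim: k f => [|k IH] f; first by move=> cf x /UU'; exact: cf.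
move=> [df Df]; split=> [x /UU'|v]; first exact: df.
exact/IH/Df.
Qed.

Lemma CkD V W k (U : set V) (f g : V -> W) : open U ->
  Ck k U f -> Ck k U g -> Ck k U (fun x => f x + g x).
Proof.
move=> oU; elim: k f g => [|k IH] f g.
  by move=> cf cg x Ux; apply: cvgD; [exact: cf|exact: cg].
move=> [df Df] [dg Dg]; split=> [x Ux|v].
  by apply: differentiableD; [exact: df|exact: dg].
apply: (Ck_ext oU) (IH _ _ (Df v) (Dg v)) => x Ux.
by rewrite -deriveD//; apply: diff_derivable; [exact: df|exact: dg].
Qed.

Lemma CkM V k (U : set V) (f g : V -> R) : open U ->
  Ck k U f -> Ck k U g -> Ck k U (fun x => f x * g x).
Proof.
move=> oU; elim: k f g => [|k IH] f g.
  by move=> cf cg x Ux; apply: cvgM; [exact: cf|exact: cg].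
move=> fk gk; have [df Df] := fk; have [dg Dg] := gk; split=> [x Ux|v].
  by apply: differentiableM; [exact: df|exact: dg].
have h := CkD oU (IH _ _ (CkS fk) (Dg v)) (IH _ _ (CkS gk) (Df v)).
apply: (Ck_ext oU) h => x Ux.
by rewrite deriveM//; apply: diff_derivable; [exact: df|exact: dg].
Qed.

(** Induction on [k] closes because the derivative - f^-2 f' contains f^-1 only at the order already
    known; [Ck_sqrt] uses f' / (2 sqrt f) in the same way. *)
Lemma CkV V k (U : set V) (f : V -> R) : open U ->
  (forall x, U x -> f x != 0) ->
  Ck k U f -> Ck k U (fun x => (f x)^-1).
Proof.
move=> oU f0; elim: k => [|k IH].
  by move=> cf x Ux; apply: cvgV; [exact: f0|exact: cf].
move=> fk; have [df Df] := fk; split=> [x Ux|v].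
  by apply: differentiableV; [exact: df|exact: f0].
have fV := IH (CkS fk).
have h := CkM oU (Ck_cst _ _ (-1 : R)) (CkM oU (CkM oU fV fV) (Df v)).
apply: (Ck_ext oU) h => x Ux.
rewrite deriveV ?f0//; last by apply: diff_derivable; exact: df.
by rewrite /= /GRing.scale/= mulN1r mulNr expr2 invfM.
Qed.

Lemma Ck_sqrt V k (U : set V) (f : V -> R) : open U ->
  (forall x, U x -> 0 < f x) ->
  Ck k U f -> Ck k U (fun x => Num.sqrt (f x)).
Proof.
move=> oU f0; elim: k => [|k IH].
  move=> cf x Ux; apply: (@continuous_comp _ _ _ f Num.sqrt x (cf x Ux)).
  exact: sqrt_continuous.
move=> fk; have [df Df] := fk.
have ds (x : V) : U x -> is_derive (f x) 1 Num.sqrt (2 * Num.sqrt (f x))^-1.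
  by move=> Ux; apply: is_derive1_sqrt; exact: f0.
have ds' (x : V) : U x -> differentiable (Num.sqrt : R -> R) (f x).
  by move=> /ds[? _]; apply/derivable1_diffP.
split=> [x Ux|v].
  by apply: differentiable_comp; [exact: df|exact: ds'].
have fV : Ck k U (fun x => (2 * Num.sqrt (f x))^-1).
  apply: CkV => //; last by apply: CkM => //; [exact: Ck_cst|exact: IH (CkS fk)].
  by move=> x Ux; rewrite mulf_neq0// sqrtr_eq0 -ltNge f0.
apply: (Ck_ext oU) (CkM oU fV (Df v)) => x Ux.
have dfx := df x Ux.
rewrite [RHS]deriveE; last exact: differentiable_comp dfx (ds' _ Ux).
rewrite (diff_comp dfx (ds' _ Ux)).
rewrite /= (diff1E (ds' _ Ux)) /= derive1E.
by have [_ ->] := ds x Ux; rewrite /GRing.scale/= mulrC deriveE.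
Qed.

Lemma Ck_sum V W k (U : set V) n (f : 'I_n -> V -> W) : open U ->
  (forall i, Ck k U (f i)) -> Ck k U (fun x => \sum_(i < n) f i x).
Proof.
move=> oU; elim: n f => [|n IH] f fk.
  by apply: (Ck_ext oU) (Ck_cst _ _ 0) => x _; rewrite big_ord0.
apply: (Ck_ext oU) (CkD oU (fk ord0) (IH (fun i => f (lift ord0 i)) _)) => [x _|i].
  by rewrite big_ord_recl.
exact: fk.
Qed.

Lemma differentiable_mx V m n (f : V -> 'M[R]_(m, n)) x :
  (forall i j, differentiable (fun y => f y i j) x) -> differentiable f x.
Proof.
move=> df.
have -> : f = \sum_(i < m) (\sum_(j < n) (fun y => f y i j *: delta_mx i j)).
  apply/funext => y; rewrite fct_sumE {1}[f y]matrix_sum_delta.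
  by apply: eq_bigr => i _; rewrite fct_sumE.
apply: differentiable_sum => i; apply: differentiable_sum => j.
exact: differentiableZl.
Qed.

Lemma differentiable_mxE V m n (f : V -> 'M[R]_(m, n)) x i j :
  differentiable f x -> differentiable (fun y => f y i j) x.
Proof.
move=> df; apply: (@differentiable_comp _ _ _ _ f (fun N : 'M[R]_(m, n) => N i j)) => //.
exact: differentiable_coord.
Qed.

Lemma derive_mxE V m n (f : V -> 'M[R]_(m, n)) x v i j :
  differentiable f x -> 'D_v f x i j = 'D_v (fun y => f y i j) x.
Proof. by move=> df; rewrite derive_mx ?mxE//; exact: diff_derivable. Qed.

Lemma Ck_mxP V m n k (U : set V) (f : V -> 'M[R]_(m, n)) : open U ->
  Ck k U f <-> forall i j, Ck k U (fun x => f x i j).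
Proof.
move=> oU; elim: k f => [|k IH] f.
  split=> cf.
    move=> i j x Ux.
    apply: (@continuous_comp _ _ _ f (fun N : 'M[R]_(m, n) => N i j)).
      exact: cf.
    exact: coord_continuous.
  have -> : f = (fun y => \sum_(i < m) \sum_(j < n) (f y i j *: delta_mx i j)).
    by apply/funext => y; exact: matrix_sum_delta.
  apply: (@Ck_sum _ _ 0) => // i; apply: (@Ck_sum _ _ 0) => // j x Ux.
  by apply: cvgZl; exact: cf.
split=> [[df Df] i j|cf].
  split=> [x Ux|v]; first by apply: differentiable_mxE; exact: df.
  apply: (Ck_ext oU) ((IH _).1 (Df v) i j) => x Ux.
  by rewrite derive_mxE//; exact: df.
have df x : U x -> differentiable f x.
  by move=> Ux; apply: differentiable_mx => i j; exact: (cf i j).1.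
split=> // v; apply/IH => i j.
apply: (Ck_ext oU) ((cf i j).2 v) => x Ux.
by rewrite derive_mxE//; exact: df.
Qed.


Lemma Ck_seq_prod V k (U : set V) (I : Type) (r : seq I) (f : I -> V -> R) :
  open U -> (forall i, Ck k U (f i)) -> Ck k U (fun x => \prod_(i <- r) f i x).
Proof.
move=> oU fk; elim: r => [|i r IH].
  by apply: (Ck_ext oU) (Ck_cst _ _ (1 : R)) => x _; rewrite big_nil.
by apply: (Ck_ext oU) (CkM oU (fk i) IH) => x _; rewrite big_cons.
Qed.

Lemma Ck_seq_sum V k (U : set V) (I : Type) (r : seq I) (f : I -> V -> R) :
  open U -> (forall i, Ck k U (f i)) -> Ck k U (fun x => \sum_(i <- r) f i x).
Proof.
move=> oU fk; elim: r => [|i r IH].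
  by apply: (Ck_ext oU) (Ck_cst _ _ (0 : R)) => x _; rewrite big_nil.
by apply: (Ck_ext oU) (CkD oU (fk i) IH) => x _; rewrite big_cons.
Qed.

Lemma Ck_det V k (U : set V) n (A : V -> 'M[R]_n) : open U ->
  Ck k U A -> Ck k U (fun x => \det (A x)).
Proof.
move=> oU /(Ck_mxP _ _ oU) Ak; rewrite /determinant.
apply: Ck_seq_sum => // s; apply: CkM => //; first exact: Ck_cst.
exact: Ck_seq_prod.
Qed.

Lemma Ck_mulmx V k (U : set V) m n p (A : V -> 'M[R]_(m, n))
    (B : V -> 'M[R]_(n, p)) : open U ->
  Ck k U A -> Ck k U B -> Ck k U (fun x => A x *m B x).
Proof.
move=> oU /(Ck_mxP _ _ oU) Ak /(Ck_mxP _ _ oU) Bk.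
apply/(Ck_mxP _ _ oU) => i j.
apply: (@Ck_ext _ _ _ _ (fun x => \sum_l A x i l * B x l j)) => //.
  by move=> x _; rewrite mxE.
by apply: Ck_seq_sum => // l; exact: CkM.
Qed.

Lemma Ck_trmx V k (U : set V) m n (A : V -> 'M[R]_(m, n)) : open U ->
  Ck k U A -> Ck k U (fun x => (A x)^T).
Proof.
move=> oU /(Ck_mxP _ _ oU) Ak; apply/(Ck_mxP _ _ oU) => i j.
by apply: (Ck_ext oU) (Ak j i) => x _; rewrite mxE.
Qed.

Lemma Ck_col_mx V k (U : set V) m1 m2 n (A : V -> 'M[R]_(m1, n))
    (B : V -> 'M[R]_(m2, n)) : open U ->
  Ck k U A -> Ck k U B -> Ck k U (fun x => col_mx (A x) (B x)).
Proof.
move=> oU /(Ck_mxP _ _ oU) Ak /(Ck_mxP _ _ oU) Bk.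
apply/(Ck_mxP _ _ oU) => i j; rewrite -(splitK i); case: (fintype.split i) => l /=.
  by apply: (Ck_ext oU) (Ak l j) => x _; rewrite col_mxEu.
by apply: (Ck_ext oU) (Bk l j) => x _; rewrite col_mxEd.
Qed.

Lemma Ck_invmx V k (U : set V) n (A : V -> 'M[R]_n) : open U ->
  (forall x, U x -> A x \in unitmx) -> Ck k U A -> Ck k U (fun x => invmx (A x)).
Proof.
move=> oU uA Ak.
have dA x : U x -> \det (A x) != 0 by move=> /uA; rewrite unitmxE unitfE.
apply: (@Ck_ext _ _ _ _ (fun x => (\det (A x))^-1 *: \adj (A x))) => //.
  by move=> x Ux; rewrite /invmx uA.
apply/(Ck_mxP _ _ oU) => i j.
apply: (@Ck_ext _ _ _ _ (fun x => (\det (A x))^-1 *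
    ((-1) ^+ (j + i) * \det (row' j (col' i (A x)))))) => //.
  by move=> x _; rewrite !mxE.
apply: CkM => //; first by apply: CkV => //; exact: Ck_det.
apply: CkM => //; first exact: Ck_cst.
apply: Ck_det => //; apply/(Ck_mxP _ _ oU) => a b.
apply: (Ck_ext oU) ((Ck_mxP _ _ oU).1 Ak (lift j a) (lift i b)) => x _.
by rewrite !mxE.
Qed.

(** * Mean value arguments along segments and symmetry of second derivatives *)

Lemma is_derive_line V W (f : V -> W) x v (t : R) :
  differentiable f (x + t *: v) ->
  is_derive t 1 (fun s => f (x + s *: v)) ('D_v f (x + t *: v)).
Proof.
move=> df.
have dl : is_diff t (fun s : R => x + s *: v) (fun s => s *: v).
  have h1 := is_diff_scalel t v.
  have h2 := is_diffD (is_diff_cst x t) h1.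
  apply: is_diff_eq h2 _; apply/funext => s; rewrite /= !fctE.
  by rewrite add0r.
have dl1 : differentiable (fun s : R => x + s *: v) t by case: dl.
have dc : differentiable (f \o (fun s : R => x + s *: v)) t.
  exact: differentiable_comp.
apply: DeriveDef; first by apply/derivable1_diffP.
rewrite (deriveE _ dc) (diff_comp dl1 df) /= (deriveE _ df); congr ('d f _ _).
by rewrite diff_val scale1r.
Qed.

Lemma ball_segment V (x y : V) (e : R) (t : R) : ball x e y ->
  0 <= t <= 1 -> ball x e (x + t *: (y - x)).
Proof.
rewrite -!ball_normE /= => xy /andP[t0 t1].
rewrite opprD addNKr normrN normrZ ger0_norm// distrC.
by apply: le_lt_trans xy; rewrite distrC -[leRHS]mul1r ler_wpM2r.
Qed.

(** The mean value theorem is scalar, so it is applied to each entry along the segment from [x] to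
    [y], which stays in the ball. *)
Lemma zero_derive_ball V m n (f : V -> 'M[R]_(m, n)) x (e : R) :
  (forall y, ball x e y -> differentiable f y) ->
  (forall y v, ball x e y -> 'D_v f y = 0) ->
  forall y, ball x e y -> f y = f x.
Proof.
move=> df Df y xy; apply/matrixP => i j.
pose g (t : R) : R := f (x + t *: (y - x)) i j.
have g0 (t : R) : 0 <= t <= 1 -> is_derive t 1 g 0.
  move=> t01; have b := ball_segment xy t01.
  have dfij := differentiable_mxE i j (df _ b).
  have := is_derive_line (f := fun z => f z i j) (v := y - x) dfij.
  by rewrite -derive_mxE ?Df ?mxE//; exact: df.
have cg : {within `[0, 1], continuous g}.
  apply: (@derivable_within_continuous _ _ g `[0, 1]) => t.
  by rewrite in_itv/= => /g0[].
have [t _ Et] := @MVT_segment _ g (fun=> 0) 0 1 ler01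
  (fun t t01 => g0 t (subset_itv_oo_cc t01)) cg.
by move: Et; rewrite mul0r /g scale1r scale0r addr0 [x + _]addrC subrK => /subr0_eq.
Qed.

(** The mean value theorem is used twice: in direction u on the difference [p] along two parallel
    segments, then in direction v on 'D_u f. The second difference is symmetric in u and v up to the
    order of its terms, hence it compares the two mixed derivatives. *)
Lemma second_difference V (f : V -> R) (x u v : V) (r s : R) :
  0 < s -> s * (`|u| + `|v|) < r ->
  (forall y, ball x r y -> differentiable f y) ->
  (forall y, ball x r y -> differentiable ('D_u f) y) ->
  exists2 z, ball x r z &
    f (x + s *: v + s *: u) - f (x + s *: u) - (f (x + s *: v) - f x) =
    s * (s * 'D_v ('D_u f) z).
Proof.
move=> s0 sr df dDf.
have inb (a b : R) : 0 <= a <= s -> 0 <= b <= s -> ball x r (x + b *: v + a *: u).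
  move=> /andP[a0 as_] /andP[b0 bs].
  rewrite -ball_normE /= -addrA opprD addNKr normrN.
  apply: le_lt_trans sr; apply: le_trans (ler_normD _ _) _.
  rewrite mulrDr addrC lerD// normrZ ger0_norm//; exact: ler_wpM2r.
have s00 : 0 <= s <= s by rewrite lexx ltW.
have z00 : 0 <= (0 : R) <= s by rewrite lexx ltW.
have itv (t : R) : t \in `[0, s] -> 0 <= t <= s by rewrite in_itv.
pose p (t : R) : R := f (x + s *: v + t *: u) - f (x + t *: u).
have dp (t : R) : t \in `[0, s] ->
    is_derive t 1 p ('D_u f (x + s *: v + t *: u) - 'D_u f (x + t *: u)).
  move=> /itv t0s; apply: is_deriveB.
    by apply: is_derive_line; apply/df/inb.
  apply: is_derive_line; apply: df.
  by have := inb _ _ t0s z00; rewrite scale0r addr0.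
have cp : {within `[0, s], continuous p}.
  apply: (@derivable_within_continuous _ _ p `[0, s]) => t /dp dpt.
  exact: ex_derive.
have [t t0s Et] := MVT_segment (ltW s0) (fun t t01 => dp t (subset_itv_oo_cc t01)) cp.
pose q (b : R) : R := 'D_u f (x + t *: u + b *: v).
have dq (b : R) : b \in `[0, s] ->
    is_derive b 1 q ('D_v ('D_u f) (x + t *: u + b *: v)).
  move=> /itv b0s; apply: is_derive_line; apply: dDf.
  by rewrite addrAC; apply: inb => //; exact: itv.
have cq : {within `[0, s], continuous q}.
  apply: (@derivable_within_continuous _ _ q `[0, s]) => b /dq dqb.
  exact: ex_derive.
have [b b0s Eb] := MVT_segment (ltW s0) (fun b b01 => dq b (subset_itv_oo_cc b01)) cq.
exists (x + t *: u + b *: v); first by rewrite addrAC; apply: inb; exact: itv.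
move: Et; rewrite /p scale0r !addr0 subr0 => ->.
move: Eb; rewrite /q scale0r addr0 subr0 addrAC => ->.
by rewrite [LHS]mulrC; congr (_ * _); rewrite mulrC.
Qed.

Lemma derive_comm_scalar V (U : set V) (f : V -> R) (u v x : V) :
  open U -> Ck 2 U f -> U x -> 'D_u ('D_v f) x = 'D_v ('D_u f) x.
Proof.
move=> oU [df D1] Ux; apply/eqP; rewrite -subr_eq0 -normr_le0 leNgt; apply/negP => d0.
set d := `| _ | in d0.
have c1 := (D1 v).2 u x Ux; have c2 := (D1 u).2 v x Ux.
have d20 : 0 < d / 2 by rewrite divr_gt0.
have n1 : \forall y \near x, `|'D_u ('D_v f) x - 'D_u ('D_v f) y| < d / 2.
  by move/cvgrPdist_lt : c1; apply.
have n2 : \forall y \near x, `|'D_v ('D_u f) x - 'D_v ('D_u f) y| < d / 2.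
  by move/cvgrPdist_lt : c2; apply.
have [r /= r0 br] := (nbhs_ballP _ _).1 (filterI (open_near oU Ux) (filterI n1 n2)).
(* Small enough to keep the parallelogram with sides [s *: u] and [s *: v] in the ball; the 1 covers
   u = v = 0. *)
pose s := r / (1 + (`|u| + `|v|)).
have k0 : 0 < 1 + (`|u| + `|v|) by rewrite ltr_pwDl// addr_ge0.
have s0 : 0 < s by rewrite divr_gt0.
have sr : s * (`|u| + `|v|) < r.
  by rewrite /s mulrAC ltr_pdivrMr// ltr_pM2l// ltrDr.
have sr' : s * (`|v| + `|u|) < r by rewrite [_ + `|u|]addrC.
have [z bz Ez] : exists2 z, ball x r z & _ := second_difference s0 sr
  (fun y by_ => df y (br y by_).1) (fun y by_ => (D1 u).1 y (br y by_).1).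
have [z' bz' Ez'] : exists2 z, ball x r z & _ := second_difference s0 sr'
  (fun y by_ => df y (br y by_).1) (fun y by_ => (D1 v).1 y (br y by_).1).
(* The mixed derivatives agree, but at two different points; continuity moves each of them to [x] at
   a cost below d/2, which contradicts the choice of [d]. *)
have E : 'D_v ('D_u f) z = 'D_u ('D_v f) z'.
  apply: (mulfI (lt0r_neq0 s0)); apply: (mulfI (lt0r_neq0 s0)).
  have swap (a b c e : R) : a - b - (c - e) = a - c - (b - e) by ring.
  apply: (etrans (esym Ez)); apply: etrans Ez'.
  by rewrite (addrAC x (s *: v) (s *: u)) swap.
have [_ [_ b2]] := br z bz; have [_ [b1 _]] := br z' bz'.
suff : d < d by rewrite ltxx.
rewrite {1}/d -(subrKA ('D_u ('D_v f) z')) [ltRHS](splitr d).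
apply: (le_lt_trans (ler_normD _ _)); apply: (ltrD b1).
by rewrite -E distrC; exact: b2.
Qed.

Lemma derive_comm V m n (U : set V) (f : V -> 'M[R]_(m, n)) (u v x : V) :
  open U -> Ck 2 U f -> U x -> 'D_u ('D_v f) x = 'D_v ('D_u f) x.
Proof.
move=> oU f2 Ux; have [df D1] := f2; apply/matrixP => i j.
have ext w z : U z -> 'D_w f z i j = 'D_w (fun y => f y i j) z.
  by move=> Uz; rewrite derive_mxE//; exact: df.
have ext2 w w' : 'D_w ('D_w' f) x i j = 'D_w ('D_w' (fun y => f y i j)) x.
  apply: (etrans (derive_mxE _ _ _ ((D1 w').1 _ Ux))); apply: near_eq_derive.
  by apply: filterS (open_near oU Ux) => y; exact: ext.
apply: (etrans (ext2 u v)); apply: etrans (esym (ext2 v u)).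
apply: (derive_comm_scalar _ _ oU) => //; exact: ((Ck_mxP _ _ oU).1 f2 i j).
Qed.

End Calculus.

(** * Linear algebra of the Lorentzian form *)

Section Lorentz.
Variable R : realType.
Implicit Types (x y z u v w : 'rV[R]_5).

Definition mink : 'M[R]_5 := diag_mx (\row_i (if i == 0 then -1 else 1)).

Lemma lor_sum x y : lor x y = \sum_i mink i i * (x 0 i * y 0 i).
Proof.
rewrite /lor [RHS]big_ord_recl /mink !mxE !eqxx mulN1r; congr (_ + _).
by apply: eq_bigr => i _; rewrite !mxE !eqxx /= mul1r.
Qed.

Lemma lorE x y : lor x y = (x *m mink *m y^T) 0 0.
Proof.
rewrite lor_sum mxE; apply: eq_bigr => i _; rewrite mul_mx_diag !mxE eqxx.
by rewrite mulrCA mulrA.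
Qed.

Lemma gramE m n (A : 'M[R]_(m, 5)) (B : 'M[R]_(n, 5)) :
  gram A B = A *m mink *m B^T.
Proof.
apply/matrixP => i j; rewrite !mxE lorE mxE; apply: eq_bigr => k _.
by rewrite !mxE; congr (_ * _); apply: eq_bigr => l _; rewrite !mxE.
Qed.

Lemma mink_sym : mink^T = mink. Proof. exact: tr_diag_mx. Qed.

Lemma minkK : mink *m mink = 1%:M.
Proof.
apply/matrixP => i j; rewrite mul_mx_diag !mxE.
by case: (i =P j) => [<-|]; case: (_ == 0);
  rewrite ?mulr1n ?mulr0n ?mulrNN ?mul1r ?mul0r.
Qed.

Lemma tr_gram m n (A : 'M[R]_(m, 5)) (B : 'M[R]_(n, 5)) : (gram A B)^T = gram B A.
Proof. by rewrite !gramE !trmx_mul mink_sym trmxK mulmxA. Qed.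

Lemma gram_mull m n p (P : 'M[R]_(p, m)) (A : 'M[R]_(m, 5)) (B : 'M[R]_(n, 5)) :
  gram (P *m A) B = P *m gram A B.
Proof. by rewrite !gramE !mulmxA. Qed.

Lemma gram_mulr m n p (P : 'M[R]_(p, n)) (A : 'M[R]_(m, 5)) (B : 'M[R]_(n, 5)) :
  gram A (P *m B) = gram A B *m P^T.
Proof. by rewrite !gramE trmx_mul !mulmxA. Qed.

Lemma gramDl m n (A A' : 'M[R]_(m, 5)) (B : 'M[R]_(n, 5)) :
  gram (A + A') B = gram A B + gram A' B.
Proof. by rewrite !gramE !mulmxDl. Qed.

Lemma gramBl m n (A A' : 'M[R]_(m, 5)) (B : 'M[R]_(n, 5)) :
  gram (A - A') B = gram A B - gram A' B.
Proof. by rewrite !gramE !mulmxBl. Qed.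

Lemma gramZl m n a (A : 'M[R]_(m, 5)) (B : 'M[R]_(n, 5)) :
  gram (a *: A) B = a *: gram A B.
Proof. by rewrite !gramE -!scalemxAl. Qed.

Lemma gram_col_mxl m1 m2 n (A : 'M[R]_(m1, 5)) (A' : 'M[R]_(m2, 5))
  (B : 'M[R]_(n, 5)) : gram (col_mx A A') B = col_mx (gram A B) (gram A' B).
Proof. by rewrite !gramE !mul_col_mx. Qed.

Lemma gram_col_mxr m n1 n2 (A : 'M[R]_(m, 5)) (B : 'M[R]_(n1, 5))
  (B' : 'M[R]_(n2, 5)) : gram A (col_mx B B') = row_mx (gram A B) (gram A B').
Proof. by rewrite !gramE tr_col_mx mul_mx_row. Qed.

Lemma gram_lor x y : gram x y = (lor x y)%:M.
Proof. by rewrite gramE lorE [LHS]mx11_scalar. Qed.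

Lemma lorC x y : lor x y = lor y x.
Proof. by rewrite !lor_sum; apply: eq_bigr => i _; rewrite [x 0 i * _]mulrC. Qed.

Lemma lorDl x y z : lor (x + y) z = lor x z + lor y z.
Proof. by rewrite !lorE !mulmxDl mxE. Qed.

Lemma lorZl a x y : lor (a *: x) y = a * lor x y.
Proof. by rewrite !lorE -!scalemxAl mxE. Qed.

Lemma lorNl x y : lor (- x) y = - lor x y.
Proof. by rewrite -scaleN1r lorZl mulN1r. Qed.

Lemma lorBl x y z : lor (x - y) z = lor x z - lor y z.
Proof. by rewrite lorDl lorNl. Qed.

Lemma lorDr x y z : lor x (y + z) = lor x y + lor x z.
Proof. by rewrite lorC lorDl !(lorC x). Qed.

Lemma lorZr a x y : lor x (a *: y) = a * lor x y.
Proof. by rewrite lorC lorZl lorC. Qed.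

Lemma lorNr x y : lor x (- y) = - lor x y.
Proof. by rewrite lorC lorNl lorC. Qed.

Lemma lorBr x y z : lor x (y - z) = lor x y - lor x z.
Proof. by rewrite lorDr lorNr. Qed.

Lemma lor0l x : lor 0 x = 0.
Proof. by rewrite -(scale0r 0) lorZl mul0r. Qed.

Lemma lor0r x : lor x 0 = 0.
Proof. by rewrite lorC lor0l. Qed.

Lemma lor_suml (I : Type) (r : seq I) (f : I -> 'rV[R]_5) y :
  lor (\sum_(i <- r) f i) y = \sum_(i <- r) lor (f i) y.
Proof.
elim: r => [|i r IH]; first by rewrite !big_nil lor0l.
by rewrite !big_cons lorDl IH.
Qed.

Lemma lor_mulmxl n (a : 'rV[R]_n) (A : 'M[R]_(n, 5)) y :
  lor (a *m A) y = \sum_i a 0 i * lor (row i A) y.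
Proof. by rewrite mulmx_sum_row lor_suml; apply: eq_bigr => i _; rewrite lorZl. Qed.

Lemma gram_eq0P n x (B : 'M[R]_(n, 5)) :
  (gram x B = 0) <-> (forall i, lor x (row i B) = 0).
Proof.
split=> [xB i|xB]; last first.
  by apply/matrixP => i j; rewrite !mxE ord1 -[row 0 x]/(row 0 x) row_id xB.
by have /matrixP/(_ 0 i) := xB; rewrite !mxE row_id.
Qed.

Lemma lor_e0 x : lor (delta_mx 0 0) x = - x 0 0.
Proof.
rewrite /lor big1 ?addr0 ?mxE ?eqxx ?mul1r// => i _.
by rewrite mxE lift_eqF andbF mul0r.
Qed.

Lemma lor_eq0 x : (forall y, lor x y = 0) -> x = 0.
Proof.
move=> x0; apply/rowP => i; have := x0 (delta_mx 0 i).
rewrite lor_sum (bigD1 i)//= big1 ?addr0.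
  rewrite !mxE !eqxx mulr1 mulr1n => /eqP; rewrite mulf_eq0 => /orP[|/eqP//].
  by case: ifP; rewrite ?oppr_eq0 oner_eq0.
by move=> j ji; rewrite [delta_mx _ _ _ _]mxE (negPf ji) andbF !mulr0.
Qed.

(** Subtracting the multiple a x of x that kills the time coordinate of y gives z with <z,z> >= 0,
    and <y,y> = <z,z> - a^2 <x,x> by orthogonality. If a = 0 then z = y is a nonzero spatial
    vector. *)
Lemma lor_timelike_perp x y : lor x x < 0 -> lor x y = 0 -> y != 0 -> 0 < lor y y.
Proof.
move=> xx xy y0.
have nonneg z : z 0 0 = 0 -> 0 <= lor z z.
  move=> z0; rewrite /lor z0 mul0r oppr0 add0r sumr_ge0// => i _.
  by rewrite -expr2 sqr_ge0.
have zpos z : z 0 0 = 0 -> z != 0 -> 0 < lor z z.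
  move=> z0 zn; rewrite lt_neqAle nonneg// andbT; apply: contra_neq zn => zz.
  apply/rowP => i; rewrite mxE; have [j ->|->//] := unliftP 0 i.
  move: zz; rewrite /lor z0 mul0r oppr0 add0r => /esym/eqP.
  rewrite psumr_eq0; last by move=> k _; rewrite -expr2 sqr_ge0.
  by move=> /allP/(_ j (mem_index_enum _))/=; rewrite mulf_eq0 orbb => /eqP.
have x0 : x 0 0 != 0.
  by apply: contraTN xx => /eqP /nonneg; rewrite leNgt.
pose a := y 0 0 / x 0 0; pose z := y - a *: x.
have z0 : z 0 0 = 0 by rewrite !mxE /a divfK// subrr.
have Ez : lor z z = lor y y + a ^+ 2 * lor x x.
  by rewrite /z lorBl !lorBr !lorZl !lorZr (lorC y) xy; ring.
have [a0|a0] := eqVneq a 0.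
  have zy : z = y by rewrite /z a0 scale0r subr0.
  by rewrite -zy; apply: zpos => //; rewrite zy.
have a2 : a ^+ 2 * lor x x < 0 by rewrite pmulr_rlt0// exprn_even_gt0.
have := nonneg _ z0; rewrite Ez => h; lra.
Qed.

(** The tool behind the vector identities below: a difference is zero once it is orthogonal to a
    full frame. The row count is an equation [k = 5] so that stacked blocks can be used without a
    cast. *)
Lemma gram_unit_full k m (A : 'M[R]_(k, 5)) (y : 'M[R]_(m, 5)) : k = 5 ->
  gram A A \in unitmx -> gram y A = 0 -> y = 0.
Proof.
move=> k5; rewrite -row_full_unit => /row_fullP[P PA] yA.
have : row_full A.
  suff kA : (k <= \rank A)%N by rewrite /row_full eqn_leq rank_leq_col -[X in (X <= _)%N]k5.
  apply: (@leq_trans (\rank (gram A A))).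
    by rewrite -[X in (X <= _)%N](mxrank1 R k) -PA mxrankM_maxr.
  by rewrite gramE -mulmxA mxrankM_maxl.
move=> /row_fullP[L LA].
have : gram y (L *m A) = 0 by rewrite gram_mulr yA mul0mx.
rewrite LA gramE trmx1 mulmx1 => /(congr1 (mulmx^~ mink)).
by rewrite -mulmxA minkK mulmx1 mul0mx.
Qed.

Lemma exists_perp k (A : 'M[R]_(k, 5)) : (k < 5)%N ->
  exists2 y : 'rV[R]_5, y != 0 & gram y A = 0.
Proof.
move=> k5; pose K := kermx (mink *m A^T).
have Kn0 : K != 0.
  rewrite -mxrank_eq0 mxrank_ker subn_eq0 -ltnNge.
  exact: leq_ltn_trans (rank_leq_col _) k5.
exists (nz_row K); first by rewrite nz_row_eq0.
by apply/eqP; rewrite gramE -mulmxA; apply/eqP/sub_kermxP; exact: nz_row_sub.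
Qed.

Lemma unitmx_ker0 n (A : 'M[R]_n) :
  (forall v : 'rV[R]_n, v *m A = 0 -> v = 0) -> A \in unitmx.
Proof.
move=> h; rewrite -row_free_unit; apply/inj_row_free => v /h //.
Qed.

Lemma normal_part_perp k (B : 'M[R]_(k, 5)) v : gram B B \in unitmx ->
  gram (normal_part B v) B = 0.
Proof.
by move=> uB; rewrite /normal_part gramBl gram_mull mulmxKV// subrr.
Qed.

Lemma normal_partE k (B : 'M[R]_(k, 5)) v n (a : 'rV[R]_k) :
  gram B B \in unitmx -> v = n + a *m B -> gram n B = 0 -> normal_part B v = n.
Proof.
move=> uB -> nB; rewrite /normal_part gramDl nB add0r gram_mull.
by rewrite mulmxK// addrK.
Qed.

Lemma lor_normal_part k (B : 'M[R]_(k, 5)) v n : gram n B = 0 ->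
  lor (normal_part B v) n = lor v n.
Proof.
move=> nB; rewrite /normal_part lorBl [X in _ - X](_ : _ = 0) ?subr0//.
rewrite lorC; have /matrixP/(_ 0 0) := gram_lor n (gram v B *m invmx (gram B B) *m B).
by rewrite gram_mulr nB mul0mx !mxE eqxx mulr1n.
Qed.

(** The normal part depends only on the span of the rows; this will make it independent of the
    chart. *)
Lemma normal_part_mulmx k (P : 'M[R]_k) (B : 'M[R]_(k, 5)) v :
  P \in unitmx -> gram B B \in unitmx -> normal_part (P *m B) v = normal_part B v.
Proof.
move=> uP uB.
apply: (@normal_partE _ _ _ _ (gram v B *m invmx (gram B B) *m invmx P)).
- by rewrite gram_mull gram_mulr !unitmx_mul unitmx_tr uP uB.
- by rewrite mulmxA mulmxKV// subrK.
- by rewrite gram_mulr normal_part_perp// mul0mx.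
Qed.

Lemma gram_unit_free k (B : 'M[R]_(k, 5)) : gram B B \in unitmx -> row_free B.
Proof.
rewrite -row_free_unit /row_free !eqn_leq rank_leq_row gramE => /andP[_ h].
by rewrite rank_leq_row (leq_trans h)// -mulmxA mxrankM_maxl.
Qed.

Lemma gram_col_unit k1 k2 (A : 'M[R]_(k1, 5)) (B : 'M[R]_(k2, 5)) :
  gram A A \in unitmx -> gram B B \in unitmx -> gram A B = 0 ->
  gram (col_mx A B) (col_mx A B) \in unitmx.
Proof.
move=> uA uB AB; rewrite gram_col_mxl !gram_col_mxr AB -(tr_gram A B) AB trmx0.
by rewrite -/(block_mx _ _ _ _) block_diag_mx_unit uA uB.
Qed.

Lemma gram1_unit x : lor x x != 0 -> gram x x \in unitmx.
Proof. by rewrite gram_lor unitmxE det_scalar expr1 unitfE. Qed.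

(** The unipotent [P] replaces u by u + <x,u> x, which is orthogonal to x and has square <u,u> +
    <x,u>^2. *)
Lemma gram_pair_unit x u : lor x x = -1 -> lor u u + lor x u ^+ 2 != 0 ->
  gram (col_mx x u) (col_mx x u) \in unitmx.
Proof.
move=> xx xu.
pose P : 'M[R]_(1 + 1) := block_mx 1%:M 0 (- lor x u)%:M 1%:M.
have Pu : P \in unitmx by rewrite unitmxE det_lblock !det1 mulr1 unitr1.
have -> : col_mx x u = P *m col_mx x (u + lor x u *: x).
  rewrite mul_block_col !mul1mx mul0mx addr0 mul_scalar_mx scaleNr.
  by rewrite addrC addrK.
rewrite gram_mull gram_mulr !unitmx_mul unitmx_tr Pu.
rewrite andbT /=; apply: gram_col_unit.
- by apply: gram1_unit; rewrite xx oppr_eq0 oner_eq0.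
- apply: gram1_unit; rewrite !lorDl !lorDr !lorZl !lorZr xx (lorC u).
  by rewrite (_ : _ + _ = lor u u + lor x u ^+ 2) //; ring.
- by rewrite gram_lor lorDr lorZr xx mulrN1 addrN raddf0.
Qed.

Lemma gram_rowP k m (A : 'M[R]_(k, 5)) (B : 'M[R]_(m, 5)) :
  (gram A B = 0) <-> (forall i j, lor (row i A) (row j B) = 0).
Proof.
split=> [h i j|h]; last by apply/matrixP => i j; rewrite !mxE h.
by have /matrixP/(_ i j) := h; rewrite !mxE.
Qed.

Lemma normal_part_line k (B : 'M[R]_(k, 5)) n v : (k + 1 = 5)%N ->
  gram B B \in unitmx -> gram n B = 0 -> lor n n = 1 ->
  normal_part B v = lor v n *: n.
Proof.
move=> k5 uB nB nn; apply/eqP; rewrite -subr_eq0; apply/eqP.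
have uBn : gram (col_mx B n) (col_mx B n) \in unitmx.
  apply: gram_col_unit => //; first by apply: gram1_unit; rewrite nn oner_eq0.
  by rewrite -tr_gram nB trmx0.
apply: (gram_unit_full k5 uBn).
rewrite gram_col_mxr gramBl gramZl normal_part_perp// nB scaler0 subr0.
by rewrite gram_lor lorBl lor_normal_part// lorZl nn mulr1 subrr raddf0 row_mx0.
Qed.

(** The vector multiplying [lor v x] lies in the plane of x and u and pairs to 1 with x and to 0
    with u. As v is orthogonal to u, this is the only direction its normal part can have. *)
Lemma normal_part_plane k (B : 'M[R]_(k, 5)) x u v : (k + (1 + 1) = 5)%N ->
  gram B B \in unitmx -> gram x B = 0 -> gram u B = 0 ->
  lor x x = -1 -> lor u u + lor x u ^+ 2 != 0 -> lor v u = 0 ->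
  normal_part B v =
  lor v x *: ((lor u u + lor x u ^+ 2)^-1 *: (lor x u *: u - lor u u *: x)).
Proof.
move=> k5 uB xB uuB xx d0 vu; set eta := _ *: (_ - _).
have etax : lor eta x = 1.
  rewrite /eta lorZl lorBl !lorZl xx (lorC u x) -[RHS](mulVf d0); congr (_ * _); ring.
have etau : lor eta u = 0 by rewrite /eta lorZl lorBl !lorZl mulrC; ring.
have etaB : gram eta B = 0.
  by rewrite /eta gramZl gramBl !gramZl xB uuB !scaler0 subr0 scaler0.
clearbody eta; apply/eqP; rewrite -subr_eq0; apply/eqP.
have uBn : gram (col_mx B (col_mx x u)) (col_mx B (col_mx x u)) \in unitmx.
  apply: gram_col_unit => //; first exact: gram_pair_unit.
  by rewrite -tr_gram gram_col_mxl xB uuB col_mx0 trmx0.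
apply: (gram_unit_full k5 uBn).
rewrite !gram_col_mxr gramBl gramZl normal_part_perp// etaB scaler0 subr0.
rewrite !gram_lor (lorBl _ _ x) (lorBl _ _ u) !lor_normal_part// !lorZl.
rewrite etax etau vu mulr0 subr0 mulr1 subrr.
by rewrite !raddf0 !row_mx0.
Qed.

End Lorentz.

(** * Symmetric forms in the plane *)

Section PositiveForms.
Variable R : realType.

Lemma form_sum n (G : 'M[R]_n) (v w : 'rV[R]_n) :
  form G v w = \sum_i \sum_j v 0 i * G i j * w 0 j.
Proof.
rewrite /Defs.form mxE exchange_big; apply: eq_bigr => j _.
by rewrite !mxE mulr_suml.
Qed.

Lemma formC n (G : 'M[R]_n) (v w : 'rV[R]_n) : G^T = G -> form G v w = form G w v.
Proof.
move=> Gs; rewrite /Defs.form -[v *m G *m w^T]trmxK [LHS]mxE.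
by rewrite !trmx_mul trmxK Gs mulmxA.
Qed.

Lemma posdef_unit n (G : 'M[R]_n) : posdef G -> G \in unitmx.
Proof.
move=> pG; apply: unitmx_ker0 => v vG; apply/eqP/negPn/negP => /pG.
by rewrite /Defs.form vG mul0mx mxE ltxx.
Qed.

Lemma sum_mx_trace n (A B : 'M[R]_n) :
  \sum_(a < n) \sum_(b < n) A a b * B a b = \tr (A *m B^T).
Proof. by apply: eq_bigr => a _; rewrite mxE; apply: eq_bigr => b _; rewrite mxE. Qed.

Lemma sum2 (V : nmodType) (F : 'I_2 -> V) : \sum_(i < 2) F i = F 0 + F 1.
Proof. by rewrite big_ord_recl big_ord1; congr (_ + F _); apply: val_inj. Qed.

Lemma ord2P (i : 'I_2) : (i = 0) + (i = 1).
Proof. by case: i => [[|[|//]] p]; [left|right]; apply: val_inj. Qed.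

Lemma mx2P (A B : 'M[R]_2) : A 0 0 = B 0 0 -> A 0 1 = B 0 1 -> A 1 0 = B 1 0 ->
  A 1 1 = B 1 1 -> A = B.
Proof.
by move=> h1 h2 h3 h4; apply/matrixP => i j;
  case: (ord2P i) => ->; case: (ord2P j) => ->.
Qed.

(** Gram-Schmidt on the standard basis, written out: the second row of [E] is e_1 - (b/a) e_0
    divided by its length sqrt (D/a). *)
Lemma posdef_orthonormal (G : 'M[R]_2) : G^T = G -> posdef G ->
  exists E : 'M[R]_2, E *m G *m E^T = 1%:M.
Proof.
move=> Gs pG; set a := G 0 0; set b := G 0 1; set d := G 1 1.
have G10 : G 1 0 = b by rewrite -Gs mxE.
have form2 (x y : R) (v := \row_(j < 2) (if j == 0 then x else y)) :
    form G v v = a * x ^+ 2 + 2 * b * x * y + d * y ^+ 2.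
  by rewrite /Defs.form !mxE !sum2 !mxE !sum2 !mxE /= G10 -/a -/b -/d; ring.
have vn0 (x y : R) : (x != 0) || (y != 0) ->
    (\row_(j < 2) (if j == 0 then x else y)) != 0.
  by apply: contraTneq => /rowP v0; move: (v0 0) (v0 1); rewrite !mxE /= => -> ->;
    rewrite eqxx.
have a0 : 0 < a.
  have := pG _ (vn0 1 0 _); rewrite oner_eq0 form2 => /(_ isT).
  by rewrite expr1n expr0n /= !mulr0 !addr0 mulr1.
have D0 : 0 < a * d - b ^+ 2.
  (* The form takes the value a (a d - b^2) at (-b, a), so positivity there gives the
     determinant. *)
  have := pG _ (vn0 (- b) a _); rewrite form2 (gt_eqF a0) orbT => /(_ isT).
  rewrite (_ : _ + _ = a * (a * d - b ^+ 2)); last by ring.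
  by rewrite pmulr_rgt0.
set D := a * d - b ^+ 2 in D0.
have sa : Num.sqrt a != 0 by rewrite sqrtr_eq0 -ltNge.
have sD : Num.sqrt D != 0 by rewrite sqrtr_eq0 -ltNge.
have ea : a = Num.sqrt a ^+ 2 by rewrite sqr_sqrtr// ltW.
have eD : Num.sqrt D ^+ 2 = a * d - b ^+ 2 by rewrite sqr_sqrtr// ltW.
exists (\matrix_(i, j) if i == 0 then if j == 0 then (Num.sqrt a)^-1 else 0
   else if j == 0 then - b / (Num.sqrt a * Num.sqrt D) else Num.sqrt a / Num.sqrt D).
move: eD; set s := Num.sqrt a in sa ea *; set t := Num.sqrt D in sD * => eD.
have ed : d = (t ^+ 2 + b ^+ 2) / s ^+ 2.
  by rewrite eD subrK -ea mulrC mulKf ?gt_eqF.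
apply: mx2P; rewrite !mxE !sum2 !mxE !sum2 !mxE /= G10 -/a -/b -/d ea ?ed;
  by field; rewrite ?sa ?sD.
Qed.

Lemma orthonormal_inv (G E : 'M[R]_2) : E *m G *m E^T = 1%:M ->
  [/\ E \in unitmx, G \in unitmx & invmx G = E^T *m E].
Proof.
move=> EG; have [EGu Eu] := mulmx1_unit EG.
rewrite unitmx_tr in Eu.
have Gu : G \in unitmx by move: EGu; rewrite unitmx_mul => /andP[].
have GE : G *m (E^T *m E) = 1%:M.
  by move: EG; rewrite -mulmxA => /mulmx1C; rewrite -mulmxA.
by split=> //; rewrite -[LHS]mulmx1 -GE mulKmx.
Qed.

(** Cayley-Hamilton with zero trace: B^2 = - det B. *)
Lemma traceless_square (B : 'M[R]_2) : B^T = B -> \tr B = 0 ->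
  B *m B = (B 0 0 ^+ 2 + B 0 1 ^+ 2)%:M.
Proof.
move=> Bs; rewrite /mxtrace sum2 => /eqP; rewrite addrC addr_eq0 => /eqP B11.
have B10 : B 1 0 = B 0 1 by rewrite -[in RHS]Bs mxE.
by apply: mx2P; rewrite !mxE !sum2 ?B11 ?B10 ?mulr1n ?mulr0n; ring.
Qed.

Lemma traceless_eq0 (B : 'M[R]_2) : B^T = B -> \tr B = 0 ->
  B 0 0 ^+ 2 + B 0 1 ^+ 2 = 0 -> B = 0.
Proof.
move=> Bs; rewrite /mxtrace sum2 => /eqP; rewrite addrC addr_eq0 => /eqP B11.
have B10 : B 1 0 = B 0 1 by rewrite -[in RHS]Bs mxE.
move=> /eqP; rewrite paddr_eq0 ?sqr_ge0// !sqrf_eq0 => /andP[/eqP h0 /eqP h1].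
by apply: mx2P; rewrite ?B11 ?B10 ?h0 ?h1 !mxE ?oppr0.
Qed.

(** A traceless symmetric matrix is given by its entries 00 and 01, and the 01 entry of the
    commutator is twice the determinant of these two coordinate vectors. *)
Lemma traceless_proportional (B C : 'M[R]_2) : B^T = B -> C^T = C ->
  \tr B = 0 -> \tr C = 0 -> B != 0 -> (C *m B - B *m C) 0 1 = 0 ->
  exists l, C = l *: B.
Proof.
move=> Bs Cs Bt Ct B0; set b := B 0 0 ^+ 2 + B 0 1 ^+ 2.
have b0 : b != 0 by apply: contra_neq B0; exact: traceless_eq0.
move: Bt Ct; rewrite /mxtrace !sum2 => /eqP + /eqP.
rewrite addrC addr_eq0 => /eqP B11; rewrite addrC addr_eq0 => /eqP C11.
have B10 : B 1 0 = B 0 1 by rewrite -[in RHS]Bs mxE.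
have C10 : C 1 0 = C 0 1 by rewrite -[in RHS]Cs mxE.
rewrite !mxE !sum2 B11 C11 => h.
have h' : C 0 0 * B 0 1 = B 0 0 * C 0 1 by lra.
(* The coefficient of the orthogonal projection of C on B in these coordinates. *)
exists ((C 0 0 * B 0 0 + C 0 1 * B 0 1) / b).
have e0 : C 0 0 = (C 0 0 * B 0 0 + C 0 1 * B 0 1) / b * B 0 0.
  apply: (mulIf b0); rewrite mulrAC divfK// /b.
  rewrite [LHS](_ : _ = C 0 0 * B 0 0 ^+ 2 + (C 0 0 * B 0 1) * B 0 1); last by ring.
  by rewrite h'; ring.
have e1 : C 0 1 = (C 0 0 * B 0 0 + C 0 1 * B 0 1) / b * B 0 1.
  apply: (mulIf b0); rewrite mulrAC divfK// /b.
  rewrite [RHS](_ : _ = B 0 0 * (C 0 0 * B 0 1) + C 0 1 * B 0 1 ^+ 2); last by ring.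
  by rewrite h'; ring.
apply: mx2P; rewrite [RHS]mxE; [exact: e0|exact: e1|..].
  by rewrite B10 C10; exact: e1.
by rewrite B11 C11 mulrN; congr (- _); exact: e0.
Qed.

Section Frame.
Variables G E : 'M[R]_2.
Hypothesis EG : E *m G *m E^T = 1%:M.
(** The matrix of a bilinear form in the basis formed by the rows of [E]. There G is the identity,
    so that products through [invmx G] become plain products and the trace with respect to G becomes
    the plain trace. *)
Let fr (B : 'M[R]_2) := E *m B *m E^T.

Let fr_sym B : B^T = B -> (fr B)^T = fr B.
Proof. by move=> Bs; rewrite /fr !trmx_mul trmxK Bs mulmxA. Qed.

Let fr_tr B : \tr (invmx G *m B) = 0 -> \tr (fr B) = 0.
Proof.
have [_ _ ->] := orthonormal_inv EG.
by move=> h; rewrite /fr mxtrace_mulC mulmxA.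
Qed.

Let fr_inj B C : fr B = fr C -> B = C.
Proof.
have [Eu _ _] := orthonormal_inv EG.
move=> /(congr1 (fun M => invmx E *m M *m invmx E^T)).
by rewrite /fr !mulmxA !mulVmx// !mul1mx -!mulmxA !mulmxV ?unitmx_tr// !mulmx1.
Qed.

Let frM B C : fr B *m fr C = fr (B *m invmx G *m C).
Proof. by have [_ _ ->] := orthonormal_inv EG; rewrite /fr !mulmxA. Qed.

Let fr0 : fr 0 = 0. Proof. by rewrite /fr mulmx0 mul0mx. Qed.

Lemma traceless_conformal (B : 'M[R]_2) : B^T = B -> \tr (invmx G *m B) = 0 ->
  B != 0 -> exists2 lam, 0 < lam & B *m invmx G *m B = lam *: G.
Proof.
move=> /fr_sym Bs /fr_tr Bt B0.
exists (fr B 0 0 ^+ 2 + fr B 0 1 ^+ 2).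
  rewrite lt_neqAle addr_ge0 ?sqr_ge0// andbT eq_sym; apply: contra_neq B0 => h.
  by apply: fr_inj; rewrite fr0; exact: traceless_eq0.
apply: fr_inj; rewrite -frM traceless_square// /fr -scalemxAr -scalemxAl EG.
by rewrite scale_scalar_mx mulr1.
Qed.

(** In the orthonormal basis the commutator of two symmetric matrices is skew, so the single number
    given by the normal curvature determines it. *)
Lemma traceless_commute (B C : 'M[R]_2) : B^T = B -> C^T = C ->
  \tr (invmx G *m B) = 0 -> \tr (invmx G *m C) = 0 -> B != 0 ->
  (row 0 E *m (C *m invmx G *m B - B *m invmx G *m C) *m (row 1 E)^T) 0 0 = 0 ->
  exists l, C = l *: B.
Proof.
move=> Bs Cs Bt Ct B0.
have -> : (row 0 E *m (C *m invmx G *m B - B *m invmx G *m C) *m (row 1 E)^T) 0 0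
   = (fr C *m fr B - fr B *m fr C) 0 1.
  rewrite !frM /fr -mulmxBl -mulmxBr.
  by rewrite -row_mul !mxE; apply: eq_bigr => k _; rewrite !mxE.
move=> /(traceless_proportional (fr_sym Bs) (fr_sym Cs) (fr_tr Bt) (fr_tr Ct)).
case=> [|l El]; first by apply: contra_neq B0 => h; apply: fr_inj; rewrite fr0.
by exists l; apply: fr_inj; rewrite El /fr -scalemxAr -scalemxAl.
Qed.

End Frame.

(** B G^-1 B is a positive multiple of G, hence invertible: in dimension two a nonzero traceless
    form has no kernel. *)
Lemma traceless_unit (G B : 'M[R]_2) : posdef G -> G^T = G -> B^T = B ->
  \tr (invmx G *m B) = 0 -> B != 0 -> B \in unitmx.
Proof.
move=> pG Gs Bs Bt B0; have [E EG] := posdef_orthonormal Gs pG.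
have [lam lam0 h] := traceless_conformal EG Bs Bt B0.
have : lam *: G \in unitmx by rewrite unitmxZ ?unitfE ?gt_eqF ?posdef_unit.
by rewrite -h unitmx_mul => /andP[].
Qed.

End PositiveForms.

(** * Smooth maps into the Lorentzian space *)

Section ChartCalculus.
Variable R : realType.
Implicit Types V W : normedModType R.

Lemma smooth_differentiable V W (U : set V) (f : V -> W) x :
  smooth_on U f -> U x -> differentiable f x.
Proof. by move=> /(_ 1%N)[+ _] Ux; apply. Qed.

Lemma smooth_derive V W (U : set V) (f : V -> W) v :
  smooth_on U f -> smooth_on U ('D_v f).
Proof. by move=> fU k; have [_] := fU k.+1; apply. Qed.

Lemma derive_open_cst V W (U : set V) (f : V -> W) c v x : open U ->
  (forall y, U y -> f y = c) -> U x -> 'D_v f x = 0.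
Proof.
move=> oU fc Ux; rewrite (near_eq_derive (g := cst c)) ?derive_cst//.
by apply: filterS (open_near oU Ux) => y /fc.
Qed.

Lemma derive_lor V (f g : V -> 'rV[R]_5) x v :
  differentiable f x -> differentiable g x ->
  'D_v (fun y => lor (f y) (g y)) x = lor ('D_v f x) (g x) + lor (f x) ('D_v g x).
Proof.
move=> df dg.
have -> : (fun y => lor (f y) (g y)) =
    \sum_i (mink R i i *: (fun y => f y 0 i * g y 0 i)).
  by apply/funext => y; rewrite lor_sum fct_sumE.
have dfi i := @diff_derivable _ _ _ _ _ v (differentiable_mxE 0 i df).
have dgi i := @diff_derivable _ _ _ _ _ v (differentiable_mxE 0 i dg).
rewrite derive_sum => [|i]; last by apply: derivableZ; exact: derivableM.
rewrite !lor_sum -big_split/=; apply: eq_bigr => i _.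
rewrite deriveZ; last exact: derivableM.
rewrite deriveM// /GRing.scale/= -mulrDr; congr (_ * _).
rewrite addrC; congr (_ + _); rewrite /GRing.scale/=; last first.
  by congr (_ * _); exact/esym/derive_mxE.
by rewrite mulrC; congr (_ * _); exact/esym/derive_mxE.
Qed.

Lemma smooth_lor V (U : set V) (f g : V -> 'rV[R]_5) : open U ->
  smooth_on U f -> smooth_on U g -> smooth_on U (fun y => lor (f y) (g y)).
Proof.
move=> oU fU gU k.
apply: (@Ck_ext _ _ _ _ _ (fun y => \sum_(i < 5) (mink R i i * (f y 0 i * g y 0 i)))) => //.
  by move=> y _; rewrite lor_sum.
apply: Ck_seq_sum => // i; apply: CkM => //; first exact: Ck_cst.
apply: CkM => //; [exact: ((Ck_mxP _ _ oU).1 (fU k))|].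
exact: ((Ck_mxP _ _ oU).1 (gU k)).
Qed.

Lemma smooth_ext V W (U : set V) (f g : V -> W) : open U ->
  (forall x, U x -> f x = g x) -> smooth_on U f -> smooth_on U g.
Proof. by move=> oU fg fU k; apply: Ck_ext (fU k). Qed.

Lemma row_jacobian m n (f : 'rV[R]_m -> 'rV[R]_n) x a :
  differentiable f x -> row a ('J f x) = 'D_(e_ a) f x.
Proof. by move=> df; rewrite deriveEjacobian// rowE. Qed.

Lemma smooth_jacobian m n (U : set 'rV[R]_m) (f : 'rV[R]_m -> 'rV[R]_n) :
  open U -> smooth_on U f -> smooth_on U (fun x => 'J f x).
Proof.
move=> oU fU k; apply/(Ck_mxP _ _ oU) => i j.
apply: (Ck_ext oU) ((Ck_mxP _ _ oU).1 (smooth_derive (e_ i) fU k) 0 j) => x Ux.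
by rewrite -row_jacobian ?mxE//; exact: smooth_differentiable fU Ux.
Qed.

Lemma derive_coords m n (f : 'rV[R]_m -> 'rV[R]_n) x v :
  differentiable f x -> 'D_v f x = \sum_a v 0 a *: 'D_(e_ a) f x.
Proof.
move=> df; rewrite deriveEjacobian// mulmx_sum_row.
by apply: eq_bigr => a _; rewrite row_jacobian.
Qed.

Lemma derive2_coords m n (U : set 'rV[R]_m) (f : 'rV[R]_m -> 'rV[R]_n) x v w :
  open U -> smooth_on U f -> U x ->
  'D_v ('D_w f) x = \sum_a \sum_b (v 0 a * w 0 b) *: 'D_(e_ a) ('D_(e_ b) f) x.
Proof.
move=> oU fU Ux.
have d1 z := smooth_differentiable (smooth_derive z fU) Ux.
apply: (etrans (derive_coords v (d1 w))); apply: eq_bigr => a _.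
have -> : 'D_(e_ a) ('D_w f) x = 'D_(e_ a) (\sum_b w 0 b *: 'D_(e_ b) f) x.
  apply: near_eq_derive; apply: filterS (open_near oU Ux) => y Uy.
  rewrite fct_sumE; apply: derive_coords; exact: smooth_differentiable fU Uy.
have d2 b : derivable (w 0 b *: 'D_(e_ b) f) x (e_ a).
  apply: derivableZ; exact: diff_derivable.
apply: (etrans (congr1 _ (derive_sum d2))); rewrite scaler_sumr.
apply: eq_bigr => b _; rewrite -scalerA; congr (_ *: _).
by apply: deriveZ; exact: diff_derivable.
Qed.

(** The device by which derivatives are moved across every orthogonality relation below. *)
Lemma derive_lor_cst V (U : set V) (f g : V -> 'rV[R]_5) c x v : open U ->
  smooth_on U f -> smooth_on U g -> (forall y, U y -> lor (f y) (g y) = c) -> U x ->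
  lor ('D_v f x) (g x) = - lor (f x) ('D_v g x).
Proof.
move=> oU fU gU fg Ux; apply/eqP; rewrite -addr_eq0; apply/eqP.
apply: etrans (derive_open_cst v oU fg Ux); apply/esym/derive_lor.
  exact: smooth_differentiable fU Ux.
exact: smooth_differentiable gU Ux.
Qed.

Lemma smooth_cst V W (U : set V) (c : W) : smooth_on U (fun _ => c : W).
Proof. by move=> k; exact: Ck_cst. Qed.

Lemma derive_lor_cstr V (U : set V) (f : V -> 'rV[R]_5) w c x v : open U ->
  smooth_on U f -> (forall y, U y -> lor (f y) w = c) -> U x ->
  lor ('D_v f x) w = 0.
Proof.
move=> oU fU fw Ux.
rewrite (derive_lor_cst (g := fun=> w) v oU fU (smooth_cst U w) fw Ux).
by rewrite derive_cst lor0r oppr0.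
Qed.

Lemma derive_lor_self V (U : set V) (f : V -> 'rV[R]_5) c x v : open U ->
  smooth_on U f -> (forall y, U y -> lor (f y) (f y) = c) -> U x ->
  lor ('D_v f x) (f x) = 0.
Proof.
move=> oU fU ff Ux; have := derive_lor_cst v oU fU fU ff Ux.
rewrite (lorC (f x)); set a := lor _ _ => h; lra.
Qed.

Lemma smooth_mulmx V (U : set V) m n p (A : V -> 'M[R]_(m, n))
    (B : V -> 'M[R]_(n, p)) : open U ->
  smooth_on U A -> smooth_on U B -> smooth_on U (fun x => A x *m B x).
Proof. by move=> oU AU BU k; exact: Ck_mulmx. Qed.

Lemma smooth_gram V (U : set V) m n (A : V -> 'M[R]_(m, 5)) (B : V -> 'M[R]_(n, 5)) :
  open U -> smooth_on U A -> smooth_on U B -> smooth_on U (fun x => gram (A x) (B x)).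
Proof.
move=> oU AU BU k; apply: (@Ck_ext _ _ _ _ _ (fun x => A x *m mink R *m (B x)^T)) => //.
  by move=> x _; rewrite gramE.
apply: Ck_mulmx => //; last exact: Ck_trmx.
by apply: Ck_mulmx => //; exact: Ck_cst.
Qed.

Lemma smooth_invmx V (U : set V) n (A : V -> 'M[R]_n) : open U ->
  (forall x, U x -> A x \in unitmx) -> smooth_on U A -> smooth_on U (fun x => invmx (A x)).
Proof. by move=> oU uA AU k; exact: Ck_invmx. Qed.

End ChartCalculus.

(** * Gauss equation of an umbilical hypersurface *)

Section Forms.
Variable R : realType.

(** Strict Cauchy-Schwarz: the form is evaluated at <X,X> Y - <X,Y> X, nonzero by independence,
    where it equals <X,X> times the Gram determinant. *)
Lemma posdef_gram_det n (G : 'M[R]_n) (X Y : 'rV[R]_n) : G^T = G -> posdef G ->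
  row_free (col_mx X Y) -> 0 < form G X X * form G Y Y - form G X Y ^+ 2.
Proof.
move=> Gs pG XY.
have indep (a b : R) : a *: X + b *: Y = 0 -> b = 0.
  move=> h; have : row_mx a%:M b%:M *m col_mx X Y = 0.
    by rewrite mul_row_col !mul_scalar_mx.
  move/(congr1 (mulmx^~ (pinvmx (col_mx X Y)))); rewrite mul0mx mulmxKp//.
  move=> /(congr1 rsubmx); rewrite row_mxKr linear0 => /matrixP/(_ 0 0).
  by rewrite !mxE eqxx mulr1n.
have X0 : X != 0.
  have h := indep 1; apply/eqP => X0.
  have : row_mx (1%:M : 'M[R]_1) 0 *m col_mx X Y = 0.
    by rewrite mul_row_col mul1mx mul0mx addr0.
  move/(congr1 (mulmx^~ (pinvmx (col_mx X Y)))); rewrite mul0mx mulmxKp//.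
  move=> /(congr1 lsubmx); rewrite row_mxKl linear0 => /matrixP/(_ 0 0).
  by rewrite !mxE eqxx mulr1n => /eqP; rewrite oner_eq0.
have XX := pG _ X0.
have bil (a b : R) : form G (a *: X + b *: Y) (a *: X + b *: Y) =
   a ^+ 2 * form G X X + 2 * a * b * form G X Y + b ^+ 2 * form G Y Y.
  have -> : form G (a *: X + b *: Y) (a *: X + b *: Y) =
    a * a * form G X X + a * b * form G X Y + (b * a * form G Y X + b * b * form G Y Y).
    rewrite /Defs.form linearD /= !linearZ /= mulmxDl mulmxDl !mulmxDr.
    by rewrite -!scalemxAl -!scalemxAr !scalerA !mxE.
  by rewrite (formC Y X Gs); ring.
have Z0 : - form G X Y *: X + form G X X *: Y != 0.
  by apply/eqP => /indep/eqP; rewrite gt_eqF.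
have := pG _ Z0; rewrite bil.
rewrite (_ : _ + _ = form G X X * (form G X X * form G Y Y - form G X Y ^+ 2)); last by ring.
by rewrite pmulr_rgt0.
Qed.

(** The algebraic half of the curvature computation: a lowered curvature tensor of constant
    curvature type, contracted with X, Y, Y, X. The four-fold sums split into products of two double
    sums ([prod1], [prod2]). *)
Lemma contract_riemann n (g : 'M[R]_n) (d : R) (X Y : 'rV[R]_n)
    (r : 'I_n -> 'I_n -> 'I_n -> 'I_n -> R) :
  g^T = g ->
  (forall i j k l, \sum_m r i j k m * g m l = d * (g j k * g i l - g i k * g j l)) ->
  form g (\row_l \sum_i \sum_j \sum_k X 0 i * Y 0 j * Y 0 k * r i j k l) X =
  d * (form g X X * form g Y Y - form g X Y ^+ 2).
Proof.
move=> gs h.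
transitivity (\sum_i \sum_j \sum_k X 0 i * Y 0 j * Y 0 k *
   \sum_l (\sum_m r i j k m * g m l) * X 0 l).
  rewrite form_sum.
  under eq_bigr => m _ do under eq_bigr => l _ do rewrite mxE.
  rewrite exchange_big /=.
  under eq_bigr => l _ do
    (under eq_bigr => m _ do rewrite -mulrA mulr_suml; rewrite exchange_big /=).
  rewrite exchange_big /=; apply: eq_bigr => i _.
  under eq_bigr => l _ do
    (under eq_bigr => m _ do rewrite mulr_suml; rewrite exchange_big /=).
  rewrite exchange_big /=; apply: eq_bigr => j _.
  under eq_bigr => l _ do
    (under eq_bigr => m _ do rewrite mulr_suml; rewrite exchange_big /=).
  rewrite exchange_big /=; apply: eq_bigr => k _.
  rewrite mulr_sumr; apply: eq_bigr => l _.
  rewrite mulr_suml mulr_sumr; apply: eq_bigr => m _.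
  by rewrite !mulrA.
transitivity (\sum_i \sum_j \sum_k \sum_l
   (d * ((X 0 i * g i l * X 0 l) * (Y 0 j * g j k * Y 0 k)) -
    d * ((X 0 i * g i k * Y 0 k) * (Y 0 j * g j l * X 0 l)))).
  apply: eq_bigr => i _; apply: eq_bigr => j _; apply: eq_bigr => k _.
  by rewrite mulr_sumr; apply: eq_bigr => l _; rewrite h; ring.
have prod1 (A B : 'I_n -> 'I_n -> R) : \sum_i \sum_j \sum_k \sum_l A i l * B j k =
    (\sum_i \sum_l A i l) * (\sum_j \sum_k B j k).
  rewrite mulr_suml; apply: eq_bigr => i _; rewrite mulr_sumr.
  by apply: eq_bigr => j _; rewrite mulr_sumr; apply: eq_bigr => k _; rewrite mulr_suml.
have prod2 (A B : 'I_n -> 'I_n -> R) : \sum_i \sum_j \sum_k \sum_l A i k * B j l =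
    (\sum_i \sum_k A i k) * (\sum_j \sum_l B j l).
  rewrite mulr_suml; apply: eq_bigr => i _; rewrite mulr_sumr.
  by apply: eq_bigr => j _; rewrite mulr_suml; apply: eq_bigr => k _; rewrite mulr_sumr.
rewrite mulrBr expr2 {2}(formC X Y gs) !form_sum -prod1 -prod2 !mulr_sumr -sumrB.
apply: eq_bigr => i _; rewrite !mulr_sumr -sumrB.
apply: eq_bigr => j _; rewrite !mulr_sumr -sumrB.
apply: eq_bigr => k _; rewrite !mulr_sumr -sumrB.
by [].
Qed.

End Forms.

Section Gauss.
Variable R : realType.
Variables (V : set 'rV[R]_3) (phi : 'rV[R]_3 -> 'rV[R]_5) (w : 'rV[R]_5) (c : R).
Hypotheses (oV : open V) (sphi : smooth_on V phi)
  (phi_phi : forall y, V y -> lor (phi y) (phi y) = -1)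
  (phi_w : forall y, V y -> lor (phi y) w = c)
  (wc : lor w w + c ^+ 2 = 1)
  (phi_free : forall y, V y -> row_free ('J phi y)).

(* The derivatives are abstract variables: unification would unfold the limits that
   define them. *)
Variables (G : 'rV[R]_3 -> 'M[R]_3) (P : 'I_3 -> 'rV[R]_3 -> 'rV[R]_5)
  (PP : 'I_3 -> 'I_3 -> 'rV[R]_3 -> 'rV[R]_5)
  (Gam : 'I_3 -> 'I_3 -> 'I_3 -> 'rV[R]_3 -> R)
  (dGam : 'I_3 -> 'I_3 -> 'I_3 -> 'I_3 -> 'rV[R]_3 -> R).
Hypotheses (G_def : G = fun y => gram ('J phi y) ('J phi y))
  (P_def : forall i, P i = 'D_(e_ i) phi)
  (PP_def : forall i j, PP i j = 'D_(e_ i) (P j))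
  (Gam_def : forall i j k, Gam i j k = christoffel G i j k)
  (dGam_def : forall i j k m, dGam i j k m = 'D_(e_ i) (Gam j k m)).

Let sP i : smooth_on V (P i). Proof. by rewrite P_def; exact: smooth_derive. Qed.
Let sPP i j : smooth_on V (PP i j). Proof. by rewrite PP_def; exact: smooth_derive. Qed.

Let rowJ y i : V y -> row i ('J phi y) = P i y.
Proof.
by move=> Vy; rewrite P_def; apply: row_jacobian; exact: smooth_differentiable sphi Vy.
Qed.

Let GE y i j : V y -> G y i j = lor (P i y) (P j y).
Proof. by move=> Vy; rewrite G_def mxE !rowJ. Qed.

Let P_phi y i : V y -> lor (P i y) (phi y) = 0.
Proof. rewrite P_def; by move=> Vy; exact: (derive_lor_self _ oV sphi phi_phi Vy). Qed.

Let P_w y i : V y -> lor (P i y) w = 0.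
Proof. rewrite P_def; by move=> Vy; exact: (derive_lor_cstr _ oV sphi phi_w Vy). Qed.

Let PP_phi y i j : V y -> lor (PP i j y) (phi y) = - G y j i.
Proof.
move=> Vy; rewrite GE// PP_def (P_def i).
by apply: (derive_lor_cst (c := 0) _ oV (sP j) sphi _ Vy) => z Vz; exact: P_phi.
Qed.

Let PP_w y i j : V y -> lor (PP i j y) w = 0.
Proof.
move=> Vy; rewrite PP_def.
by apply: (derive_lor_cstr (c := 0) _ oV (sP j) _ Vy) => z Vz; exact: P_w.
Qed.

Let PPC y i j : V y -> PP i j y = PP j i y.
Proof. by move=> Vy; rewrite !PP_def !P_def; exact: (derive_comm _ _ oV (sphi 2) Vy). Qed.

Let Gsym y : (G y)^T = G y. Proof. by rewrite G_def tr_gram. Qed.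

Let Gpos y : V y -> posdef (G y).
Proof.
move=> Vy v v0.
have -> : form (G y) v v = lor (v *m 'J phi y) (v *m 'J phi y).
  by rewrite /Defs.form G_def gramE lorE trmx_mul !mulmxA.
apply: (@lor_timelike_perp _ (phi y)); first by rewrite phi_phi// ltrN10.
  rewrite lorC lor_mulmxl big1// => i _; rewrite rowJ// P_phi//.
  exact: mulr0.
by apply: contra_neq v0 => h; apply/eqP; rewrite -(mulmx_free_eq0 v (phi_free Vy)) h.
Qed.

Let Gu y : V y -> G y \in unitmx.
Proof. by move=> /Gpos/posdef_unit. Qed.

Let dmetE y i j l : V y ->
  dmet G i j l y = lor (PP i j y) (P l y) + lor (P j y) (PP i l y).
Proof.
move=> Vy; rewrite !PP_def; apply: etrans (derive_lor (e_ i)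
  (smooth_differentiable (sP j) Vy) (smooth_differentiable (sP l) Vy)).
by apply: near_eq_derive; apply: filterS (open_near oV Vy) => z Vz; exact: GE.
Qed.

(** By symmetry of second derivatives the three metric derivatives in the Christoffel symbol add up
    to 2 <PP_ij, P_l>. *)
Let GamE y i j k : V y ->
  Gam i j k y = \sum_l invmx (G y) k l * lor (PP i j y) (P l y).
Proof.
move=> Vy; rewrite Gam_def /christoffel mulr_sumr; apply: eq_bigr => l _.
rewrite mulrCA; congr (_ * _); rewrite !dmetE//.
rewrite (PPC j i)// (PPC l i)// (PPC l j)// (lorC (P j y)) (lorC (P i y)).
set a := lor _ _; set b := lor _ _; set d := lor _ _; lra.
Qed.

Let PP_P y i j l : V y -> lor (PP i j y) (P l y) = \sum_k Gam i j k y * G y k l.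
Proof.
move=> Vy; have : \row_k lor (PP i j y) (P k y) *m (invmx (G y) *m G y) =
  \row_k lor (PP i j y) (P k y) by rewrite mulVmx ?mulmx1// Gu.
rewrite mulmxA => /rowP/(_ l); rewrite [RHS]mxE => <-.
rewrite mxE; apply: eq_bigr => k _; congr (_ * _); rewrite mxE GamE//.
by apply: eq_bigr => q _; rewrite mxE mulrC -{1}(trmxK (invmx _)) mxE trmx_inv Gsym.
Qed.

Let sGam i j k : smooth_on V (Gam i j k).
Proof.
apply: (@smooth_ext _ _ _ _ (fun y => \sum_l invmx (G y) k l * lor (PP i j y) (P l y))) => //.
  by move=> y Vy; rewrite GamE.
move=> m; apply: Ck_seq_sum => // l; apply: CkM => //; last exact: smooth_lor.
apply: ((Ck_mxP _ _ oV).1 _ k l); apply: Ck_invmx => //.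
by rewrite G_def; apply: smooth_gram => //; exact: smooth_jacobian.
Qed.

(** The Gauss formula. The vector [lor w w *: phi - c *: w] pairs to -1 with phi and to 0 with w
    because <w,w> + c^2 = 1, while PP_ij pairs to -G_ij with phi and to 0 with w. That the normal
    component is proportional to G expresses umbilicity. *)
Let PP_decomp y i j : V y -> PP i j y =
  \sum_k Gam i j k y *: P k y + G y i j *: (lor w w *: phi y - c *: w).
Proof.
move=> Vy; apply/eqP; rewrite -subr_eq0; apply/eqP.
set r := _ - _.
pose A := col_mx (col_mx (phi y) w) ('J phi y).
have w2 : lor w w = 1 - c ^+ 2 by rewrite -wc addrK.
have rphi : lor r (phi y) = 0.
  rewrite lorBl lorDl lor_suml big1 => [|k _]; last by rewrite lorZl P_phi// mulr0.
  rewrite PP_phi// lorZl lorBl !lorZl phi_phi// (lorC w) phi_w// w2.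
  have -> : G y j i = G y i j by rewrite -[in LHS]Gsym mxE.
  by ring.
have rw : lor r w = 0.
  rewrite lorBl lorDl lor_suml big1 => [|k _]; last by rewrite lorZl P_w// mulr0.
  by rewrite PP_w// lorZl lorBl !lorZl phi_w// w2; ring.
have rP l : lor r (P l y) = 0.
  rewrite lorBl lorDl lor_suml PP_P// lorZl lorBl !lorZl.
  rewrite (lorC (phi y)) (lorC w) P_phi// P_w// !mulr0 subr0 mulr0 addr0.
  apply/eqP; rewrite subr_eq0; apply/eqP; apply: eq_bigr => k _.
  by rewrite lorZl GE.
have rA : gram r A = 0.
  rewrite /A !gram_col_mxr !gram_lor rphi rw.
  have -> : gram r ('J phi y) = 0 by apply/gram_eq0P => l; rewrite rowJ.
  by rewrite !raddf0 !row_mx0.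
apply: gram_unit_full rA => //; apply: gram_col_unit.
- apply: gram_pair_unit; rewrite ?phi_phi// phi_w// wc; exact: oner_neq0.
- by rewrite (_ : gram _ _ = G y); [exact: Gu|rewrite G_def].
- apply/gram_rowP => a b; rewrite rowJ// -(splitK a); case: (fintype.split a) => {}a /=.
    by rewrite rowKu [a]ord1 row_id lorC P_phi.
  by rewrite rowKd [a]ord1 row_id lorC P_w.
Qed.

(** Obtained by differentiating [PP_P]; the product <PP_jk, PP_il> is expanded with [PP_decomp], and
    its normal part yields the curvature term. *)
Let third y i j k l : V y -> lor ('D_(e_ i) (PP j k) y) (P l y) =
  \sum_m dGam i j k m y * G y m l +
  \sum_m Gam j k m y * lor (PP i m y) (P l y) +
  lor w w * (G y j k * G y i l).
Proof.
move=> Vy.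
have E : 'D_(e_ i) (fun z => lor (PP j k z) (P l z)) y =
  'D_(e_ i) (\sum_m (fun z => Gam j k m z * G z m l)) y.
  apply: near_eq_derive; apply: filterS (open_near oV Vy) => z Vz.
  by rewrite fct_sumE; exact: PP_P.
have dG m : derivable (fun z => G z m l) y (e_ i).
  apply: diff_derivable; apply: (@smooth_differentiable _ _ _ V) => //.
  apply: (smooth_ext oV _ (smooth_lor oV (sP m) (sP l))) => z Vz.
  by rewrite GE.
have gd m : derivable (Gam j k m) y (e_ i).
  by apply: diff_derivable; exact: (smooth_differentiable (sGam j k m) Vy).
have := etrans (etrans (esym (derive_lor (e_ i) (smooth_differentiable (sPP j k) Vy)
  (smooth_differentiable (sP l) Vy))) E) (derive_sum (fun m => derivableM (gd m) (dG m))).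
rewrite (eq_bigr (fun m => Gam j k m y * lor (PP i m y) (P l y) +
   Gam j k m y * lor (P m y) (PP i l y) +
   dGam i j k m y * G y m l)); last first.
  move=> m _; apply: etrans (deriveM (gd m) (dG m)) _.
  by rewrite -mulrDr; congr (_ + _); [congr (_ * _); exact: dmetE|rewrite dGam_def mulrC].
have DP : 'D_(e_ i) (P l) y = PP i l y by rewrite PP_def.
rewrite DP.
have -> : lor (PP j k y) (PP i l y) =
    \sum_m Gam j k m y * lor (P m y) (PP i l y) - lor w w * (G y j k * G y i l).
  rewrite [PP j k y](PP_decomp j k Vy) lorDl lor_suml lorZl lorBl !lorZl.
  rewrite (lorC (phi y)) (lorC w (PP _ _ _)) PP_phi// PP_w//.
  congr (_ + _); first by apply: eq_bigr => m _; rewrite lorZl.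
  have -> : G y l i = G y i l by rewrite -[in LHS]Gsym mxE.
  by ring.
rewrite !big_split /=.
set a := lor _ (P l y); set b := \sum_m Gam j k m y * lor (P m y) _.
set d := _ * (_ * _); set e := \sum_m dGam i j k m y * _.
set f := \sum_m Gam j k m y * _.
move=> /(canRL (addrK _)) ->; ring.
Qed.

(** The Gauss equation: third derivatives are symmetric in i and j, so antisymmetrizing [third]
    leaves the curvature against the two metric terms. *)
Let riemann_lower y i j k l : V y -> \sum_m riemann G i j k m y * G y m l =
  - lor w w * (G y j k * G y i l - G y i k * G y j l).
Proof.
move=> Vy.
have S : lor ('D_(e_ i) (PP j k) y) (P l y) = lor ('D_(e_ j) (PP i k) y) (P l y).
  rewrite !PP_def.
  exact: (congr1 (fun z => lor z (P l y)) (derive_comm _ _ oV (sP k 2) Vy)).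
have expand a b : \sum_m Gam a k m y * lor (PP b m y) (P l y) =
    \sum_m (\sum_r Gam a k r y * Gam b r m y) * G y m l.
  under [RHS]eq_bigr => m _ do rewrite mulr_suml.
  rewrite exchange_big /=; apply: eq_bigr => r _; rewrite PP_P// mulr_sumr.
  by apply: eq_bigr => m _; rewrite mulrA.
have rE m : riemann G i j k m y = (dGam i j k m y - dGam j i k m y) +
    \sum_r (Gam j k r y * Gam i r m y - Gam i k r y * Gam j r m y).
  rewrite !dGam_def !Gam_def; apply: (congr1 (fun z => _ + z)).
  by apply: eq_bigr => r _; rewrite !Gam_def.
have -> : \sum_m riemann G i j k m y * G y m l =
   (\sum_m dGam i j k m y * G y m l - \sum_m dGam j i k m y * G y m l) +
   (\sum_m Gam j k m y * lor (PP i m y) (P l y) - \sum_m Gam i k m y * lor (PP j m y) (P l y)).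
  rewrite !expand -!sumrB -big_split/=; apply: eq_bigr => m _.
  rewrite -!mulrBl -mulrDl; congr (_ * _).
  by rewrite rE sumrB.
move: S; rewrite (third i j k l Vy) (third j i k l Vy).
set a := \sum_m _; set b := \sum_m _; set a' := \sum_m _; set b' := \sum_m _ => h.
have -> : a - a' + (b - b') = (a + b + lor w w * (G y j k * G y i l)) - a' - b'
   - lor w w * (G y j k * G y i l) by ring.
by rewrite h; ring.
Qed.

Lemma sectional_constant x X Y : V x -> row_free (col_mx X Y) ->
  sectional G x X Y = - lor w w.
Proof.
move=> Vx XY; rewrite /sectional.
have -> : form (G x) (riemannXYY G x X Y) X =
   - lor w w * (form (G x) X X * form (G x) Y Y - form (G x) X Y ^+ 2).
  by apply: contract_riemann => // i j k l; exact: riemann_lower.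
rewrite mulfK// gt_eqF//; apply: posdef_gram_det => //; exact: Gpos.
Qed.

End Gauss.

Lemma umbilical_curvature (R : realType) (Q : umbilicalHypersurface R) :
  lor (hyp_dir Q) (hyp_dir Q) + hyp_level Q ^+ 2 = 1 ->
  has_sectional_curvature Q (- lor (hyp_dir Q) (hyp_dir Q)).
Proof.
move=> wc V phi [oV sphi phiQ] x Vx X Y XY.
have h1 y : V y -> lor (phi y) (phi y) = -1 by move=> /phiQ[[[]]].
have h2 y : V y -> lor (phi y) (hyp_dir Q) = hyp_level Q by move=> /phiQ[[]].
have h3 y : V y -> row_free ('J phi y) by move=> /phiQ[].
exact: (@sectional_constant _ _ _ _ _ oV sphi h1 h2 wc h3 _
  (fun i => 'D_(e_ i) phi) (fun i j => 'D_(e_ i) ('D_(e_ j) phi)) _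
  (fun i j k m => 'D_(e_ i) (christoffel _ j k m)) erefl
  (fun=> erefl) (fun _ _ => erefl) (fun _ _ _ => erefl) (fun _ _ _ _ => erefl)).
Qed.

(** * Duality between a minimal surface and its normal *)

Section SecondForm.
Variable R : realType.
Implicit Types (f : 'rV[R]_2 -> 'rV[R]_5) (x : 'rV[R]_2) (xi : 'rV[R]_5).

(** No normal projection is taken: for [xi] normal to the surface the tangential part of the second
    derivative pairs to zero with it. *)
Definition second_form f x xi : 'M[R]_2 :=
  \matrix_(a, b) lor ('D_(e_ a) ('D_(e_ b) f) x) xi.

Lemma second_form_sym U f x xi : open U -> smooth_on U f -> U x ->
  (second_form f x xi)^T = second_form f x xi.
Proof.
move=> oU fU Ux; apply/matrixP => a b; rewrite !mxE.
exact: (congr1 (fun z => lor z xi) (derive_comm _ _ oU (fU 2) Ux)).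
Qed.

Lemma lor_derive2 U f x xi v w : open U -> smooth_on U f -> U x ->
  lor ('D_v ('D_w f) x) xi = form (second_form f x xi) v w.
Proof.
move=> oU fU Ux; rewrite form_sum.
apply: (etrans (congr1 (fun z => lor z xi) (derive2_coords v w oU fU Ux))).
rewrite lor_suml; apply: eq_bigr => a _; rewrite lor_suml; apply: eq_bigr => b _.
by rewrite lorZl mxE mulrAC.
Qed.

Lemma mean_curvature_line k (nu : 'rV[R]_5 -> 'M[R]_(k, 5)) f x
    (B : 'M[R]_2) (n : 'rV[R]_5) :
  (forall a b, sff nu f x (e_ a) (e_ b) = B a b *: n) ->
  mean_curvature nu f x = (2^-1 * \tr (invmx (induced f x) *m B^T)) *: n.
Proof.
move=> sffB; rewrite /mean_curvature -sum_mx_trace -scalerA; congr (_ *: _).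
rewrite scaler_suml; apply: eq_bigr => a _; rewrite scaler_suml.
by apply: eq_bigr => b _; rewrite sffB scalerA.
Qed.

Lemma mean_curvature_line_eq0 k (nu : 'rV[R]_5 -> 'M[R]_(k, 5)) f x
    (B : 'M[R]_2) (n : 'rV[R]_5) :
  (forall a b, sff nu f x (e_ a) (e_ b) = B a b *: n) -> n != 0 -> B^T = B ->
  (mean_curvature nu f x = 0) <-> (\tr (invmx (induced f x) *m B) = 0).
Proof.
move=> sffB n0 Bs; rewrite (mean_curvature_line sffB) Bs.
split=> [/eqP|->]; last by rewrite mulr0 scale0r.
by rewrite scaler_eq0 (negPf n0) orbF mulf_eq0 invr_eq0 pnatr_eq0 /= => /eqP.
Qed.

(** All shape operators are multiples of one matrix, so they commute. *)
Lemma normal_curvature_line k (nu : 'rV[R]_5 -> 'M[R]_(k, 5)) f x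
    (B : 'M[R]_2) (n : 'rV[R]_5)
    e1 e2 e3 e4 :
  (forall a b, sff nu f x (e_ a) (e_ b) = B a b *: n) ->
  normal_curvature nu f x e1 e2 e3 e4 = 0.
Proof.
move=> sffB.
have shapeE xi : shape nu f x xi = lor n xi *: (B *m invmx (induced f x)).
  rewrite /Defs.shape scalemxAl; congr (_ *m _); apply/matrixP => a b.
  by rewrite !mxE sffB lorZl mulrC.
rewrite /normal_curvature !shapeE -!scalemxAr -!scalemxAl !scalerA.
by rewrite (mulrC (lor n e3)) subrr /Defs.form !mul0mx mxE.
Qed.

Lemma totally_geodesic_line U k (nu : 'rV[R]_5 -> 'M[R]_(k, 5)) f x (n n' : 'rV[R]_5) :
  open U -> smooth_on U f -> U x -> n != 0 ->
  (forall v w, sff nu f x v w = lor ('D_v ('D_w f) x) n' *: n) ->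
  (forall v w, sff nu f x v w = 0) <-> second_form f x n' = 0.
Proof.
move=> oU fU Ux n0 sffn; split=> [s0|B0 v w].
  apply/matrixP => a b; rewrite !mxE; apply/eqP.
  by have /eqP := s0 (e_ a) (e_ b); rewrite sffn scaler_eq0 (negPf n0) orbF.
by rewrite sffn (lor_derive2 _ _ _ oU fU Ux) B0 /Defs.form mulmx0 mul0mx mxE scale0r.
Qed.

(** The Gram matrix of J' is B I^-1 B, a positive multiple of I, and being traceless is a
    conformally invariant condition. Stated for abstract Jacobians so that it passes from h to N and
    from N to h. *)
Lemma conformal_swap (I B : 'M[R]_2) (J J' : 'M[R]_(2, 5)) :
  posdef I -> I^T = I -> B^T = B -> \tr (invmx I *m B) = 0 -> B != 0 ->
  gram J J = I -> J' = - (B *m invmx I *m J) ->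
  [/\ posdef (gram J' J'), row_free J' & \tr (invmx (gram J' J') *m B) = 0].
Proof.
move=> pI Is Bs Bt B0 JJ J'E.
have [E EI] := posdef_orthonormal Is pI.
have [lam lam0 BB] := traceless_conformal EI Bs Bt B0.
have uI := posdef_unit pI.
have GE : gram J' J' = lam *: I.
  have -> : gram J' J' = gram (B *m invmx I *m J) (B *m invmx I *m J).
    by rewrite J'E !gramE raddfN mulmxN !mulNmx opprK.
  by rewrite gram_mull gram_mulr JJ mulmxA mulmxKV// trmx_mul trmx_inv Is Bs mulmxA BB.
have pG : posdef (lam *: I).
  by move=> v /pI v0; rewrite /Defs.form -scalemxAr -scalemxAl mxE mulr_gt0.
rewrite GE; split=> //.
  by apply: gram_unit_free; rewrite GE; exact: posdef_unit.
by rewrite invmxZ ?unitmxZ ?unitfE ?gt_eqF// -scalemxAl mxtraceZ Bt mulr0.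
Qed.

End SecondForm.

Section DualPair.
Variable R : realType.
Variables (U : set 'rV[R]_2) (h N : 'rV[R]_2 -> 'rV[R]_5) (w : 'rV[R]_5) (c : R).
Hypotheses (oU : open U) (sh : smooth_on U h) (sN : smooth_on U N).
Hypotheses (hh : forall y, U y -> lor (h y) (h y) = -1)
  (hw : forall y, U y -> lor (h y) w = c)
  (NN : forall y, U y -> lor (N y) (N y) = 1)
  (hN : forall y, U y -> lor (h y) (N y) = 0)
  (Nw : forall y, U y -> lor (N y) w = 0)
  (dhN : forall y, U y -> gram ('J h y) (N y) = 0)
  (wc : lor w w + c ^+ 2 != 0).

Let rowh y a : U y -> row a ('J h y) = 'D_(e_ a) h y.
Proof. by move=> Uy; apply: row_jacobian; exact: smooth_differentiable sh Uy. Qed.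
Let rowN y a : U y -> row a ('J N y) = 'D_(e_ a) N y.
Proof. by move=> Uy; apply: row_jacobian; exact: smooth_differentiable sN Uy. Qed.

Let gramJ (J : 'M[R]_(2, 5)) (z : 'rV[R]_5) :
  (forall a, lor (row a J) z = 0) -> gram J z = 0.
Proof. by move=> H; apply/gram_rowP => a j; rewrite [j]ord1 row_id. Qed.

Let dhN' y a : U y -> lor ('D_(e_ a) h y) (N y) = 0.
Proof. by move=> Uy; rewrite -rowh//; have /gram_rowP/(_ a 0) := dhN Uy; rewrite row_id. Qed.

Let dNh' y a : U y -> lor ('D_(e_ a) N y) (h y) = 0.
Proof.
move=> Uy; have Nh z : U z -> lor (N z) (h z) = 0 by move=> Uz; rewrite lorC hN.
rewrite (derive_lor_cst (e_ a) oU sN sh Nh Uy) lorC.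
by rewrite dhN' ?oppr0.
Qed.

Let Jh_h y : U y -> gram ('J h y) (h y) = 0.
Proof. by move=> Uy; apply: gramJ => a; rewrite rowh//; exact: (derive_lor_self _ oU sh hh). Qed.
Let Jh_w y : U y -> gram ('J h y) w = 0.
Proof. by move=> Uy; apply: gramJ => a; rewrite rowh//; exact: (derive_lor_cstr _ oU sh hw). Qed.
Let JN_h y : U y -> gram ('J N y) (h y) = 0.
Proof. by move=> Uy; apply: gramJ => a; rewrite rowN//; exact: dNh'. Qed.
Let JN_w y : U y -> gram ('J N y) w = 0.
Proof. by move=> Uy; apply: gramJ => a; rewrite rowN//; exact: (derive_lor_cstr _ oU sN Nw). Qed.
Let JN_N y : U y -> gram ('J N y) (N y) = 0.
Proof. by move=> Uy; apply: gramJ => a; rewrite rowN//; exact: (derive_lor_self _ oU sN NN). Qed.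

(** The Weingarten equation, from differentiating <dh, N> = 0. *)
Let JN_Jh y : U y -> gram ('J N y) ('J h y) = - second_form h y (N y).
Proof.
move=> Uy; apply/matrixP => a b; rewrite !mxE rowN// rowh//.
have dN z : U z -> lor ('D_(e_ b) h z) (N z) = 0 by exact: dhN'.
by rewrite (derive_lor_cst (e_ a) oU (smooth_derive (e_ b) sh) sN dN Uy) opprK lorC.
Qed.

(** Both sides are minus the pairing of dN with dh: one by differentiating <dN, h> = 0, the other by
    [JN_Jh]. *)
Lemma dual_second_form y : U y -> second_form N y (h y) = second_form h y (N y).
Proof.
move=> Uy; have := JN_Jh Uy => /(congr1 trmx); rewrite tr_gram linearN /=.
rewrite (second_form_sym _ oU sh Uy) => E.
apply: oppr_inj; rewrite -E; apply/matrixP => a b; rewrite !mxE rowN// rowh//.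
have dN z : U z -> lor ('D_(e_ b) N z) (h z) = 0 by exact: dNh'.
by rewrite (derive_lor_cst (e_ a) oU (smooth_derive (e_ b) sN) sh dN Uy) opprK lorC.
Qed.

Let second_w f : smooth_on U f -> (forall y, U y -> gram ('J f y) w = 0) ->
  forall y v v', U y -> lor ('D_v ('D_v' f) y) w = 0.
Proof.
move=> sf fw y v v' Uy.
apply: (derive_lor_cstr (c := 0) v oU (smooth_derive v' sf) _ Uy) => z Uz.
rewrite deriveEjacobian; last exact: smooth_differentiable sf Uz.
by apply/eqP; rewrite -(lorC w); have := gram_mull v' ('J f z) w;
  rewrite fw// mulmx0 gram_lor lorC => /matrixP/(_ 0 0); rewrite !mxE eqxx mulr1n => ->.
Qed.

Let frame_unit y (J : 'M[R]_(2, 5)) : U y -> gram J J \in unitmx ->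
  gram J (h y) = 0 -> gram J w = 0 ->
  gram (col_mx (col_mx (h y) w) J) (col_mx (col_mx (h y) w) J) \in unitmx.
Proof.
move=> Uy uJ Jh Jw; apply: gram_col_unit => //.
  by apply: gram_pair_unit; rewrite ?hh// hw.
by rewrite -tr_gram gram_col_mxr Jh Jw row_mx0 trmx0.
Qed.

(** Both Jacobians are orthogonal to the nondegenerate span of h, w and N. Its complement has
    dimension two and is the row space of J, so J' is a combination of the rows of J with
    coefficients read from <J', J>. *)
Let JN_Jh_swap y (J J' : 'M[R]_(2, 5)) B : U y -> gram J J \in unitmx ->
  gram J (h y) = 0 -> gram J w = 0 -> gram J (N y) = 0 ->
  gram J' (h y) = 0 -> gram J' w = 0 -> gram J' (N y) = 0 ->
  gram J' J = - B -> J' = - (B *m invmx (gram J J) *m J).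
Proof.
move=> Uy uJ Jh Jw JN J'h J'w J'N J'J; apply/eqP; rewrite -addr_eq0; apply/eqP.
have uF := frame_unit Uy uJ Jh Jw.
have uG : gram (col_mx (col_mx (col_mx (h y) w) J) (N y))
    (col_mx (col_mx (col_mx (h y) w) J) (N y)) \in unitmx.
  apply: gram_col_unit => //; first by apply: gram1_unit; rewrite NN// oner_eq0.
  by rewrite !gram_col_mxl JN !gram_lor hN// (lorC w) Nw// raddf0 !col_mx0.
apply: (gram_unit_full _ uG) => //.
rewrite !gram_col_mxr !gramDl !gram_mull J'h J'w J'N J'J Jh Jw JN !mulmx0 !addr0.
by rewrite mulmxKV// addNr !row_mx0.
Qed.

Section AtPoint.
Variable x : 'rV[R]_2.
Hypothesis Ux : U x.
Let B := second_form h x (N x).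

Lemma dual_sff_h (nu : 'rV[R]_5 -> 'M[R]_(1 + 1, 5)) v v' :
  posdef (induced h x) -> nu (h x) = col_mx (h x) w ->
  sff nu h x v v' = lor ('D_v ('D_v' h) x) (N x) *: N x.
Proof.
move=> /posdef_unit uI nuE; rewrite /sff nuE; apply: normal_part_line => //.
- by apply: frame_unit => //; [exact: Jh_h|exact: Jh_w].
- rewrite !gram_col_mxr -(tr_gram ('J h x)) dhN// trmx0.
  by rewrite !gram_lor (lorC _ (h x)) hN// Nw// raddf0 !row_mx0.
- exact: NN.
Qed.

(** The normal direction of N in the plane of h and w with <eta,h> = 1 and <eta,w> = 0. Second
    derivatives of N are orthogonal to w, so its second fundamental form is a multiple of eta. *)
Let eta := (lor w w + c ^+ 2)^-1 *: (c *: w - lor w w *: h x).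

Let eta0 : eta != 0.
Proof.
suff : lor eta (h x) != 0 by apply: contra_neq => ->; rewrite lor0l.
rewrite /eta lorZl lorBl !lorZl hh// (lorC w) hw//.
by rewrite mulrN1 opprK -expr2 [X in _ * X]addrC mulVf// oner_eq0.
Qed.

Lemma dual_sff_N v v' : posdef (induced N x) ->
  sff (@nuS R) N x v v' = lor ('D_v ('D_v' N) x) (h x) *: eta.
Proof.
move=> /posdef_unit uI; rewrite /sff /nuS.
have := @normal_part_plane _ (1 + 2) (col_mx (N x) ('J N x)) (h x) w
  ('D_v ('D_v' N) x) erefl.
rewrite hw// => -> //.
- apply: gram_col_unit => //; first by apply: gram1_unit; rewrite NN// oner_eq0.
  by rewrite -tr_gram JN_N// trmx0.
- by rewrite gram_col_mxr gram_lor hN// -tr_gram JN_h// trmx0 raddf0 row_mx0.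
- by rewrite gram_col_mxr gram_lor (lorC w) Nw// -tr_gram JN_w// trmx0 raddf0 row_mx0.
- exact: hh.
- by apply: second_w => //; exact: JN_w.
Qed.

Let Bs : B^T = B. Proof. exact: second_form_sym oU sh Ux. Qed.
Let N0 : N x != 0.
Proof.
apply/eqP => e; have := NN Ux; rewrite e lor0l => /esym/eqP.
by rewrite oner_eq0.
Qed.

Lemma dual_of_minimal (nu : 'rV[R]_5 -> 'M[R]_(1 + 1, 5)) :
  nu (h x) = col_mx (h x) w -> posdef (induced h x) ->
  mean_curvature nu h x = 0 -> ~ (forall v v', sff nu h x v v' = 0) ->
  [/\ posdef (induced N x), row_free ('J N x), mean_curvature (@nuS R) N x = 0,
      forall e1 e2 e3 e4, normal_curvature (@nuS R) N x e1 e2 e3 e4 = 0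
    & ~ (forall v v', sff (@nuS R) N x v v' = 0)].
Proof.
move=> nuE pI mc ntg.
have sffh v v' := dual_sff_h v v' pI nuE.
have B0 : B != 0.
  apply/eqP => B0; apply: ntg.
  by apply/(totally_geodesic_line oU sh Ux N0 sffh).
have sffhB a b : sff nu h x (e_ a) (e_ b) = B a b *: N x by rewrite sffh /B mxE.
have Bt : \tr (invmx (induced h x) *m B) = 0.
  exact: (mean_curvature_line_eq0 sffhB N0 Bs).1 mc.
have JE := JN_Jh_swap Ux (posdef_unit pI) (Jh_h Ux) (Jh_w Ux) (dhN Ux) (JN_h Ux)
  (JN_w Ux) (JN_N Ux) (JN_Jh Ux).
have [pN fN Nt] := conformal_swap pI (tr_gram _ _) Bs Bt B0 erefl JE.
have sffN v v' := dual_sff_N v v' pN.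
have sffNB a b : sff (@nuS R) N x (e_ a) (e_ b) = B a b *: eta.
  by rewrite sffN /B -(dual_second_form Ux) mxE.
split.
- exact: pN.
- exact: fN.
- exact: (mean_curvature_line_eq0 sffNB eta0 Bs).2 Nt.
- by move=> e1 e2 e3 e4; exact: normal_curvature_line sffNB.
- move=> /(totally_geodesic_line oU sN Ux eta0 sffN).
  by rewrite dual_second_form//; exact/eqP.
Qed.

(** The same form [B] is now traceless for the metric of N, and the swap is run with the roles of h
    and N exchanged. That h is an immersion comes out of conformality. *)
Lemma minimal_of_dual (nu : 'rV[R]_5 -> 'M[R]_(1 + 1, 5)) :
  nu (h x) = col_mx (h x) w -> posdef (induced N x) ->
  mean_curvature (@nuS R) N x = 0 -> ~ (forall v v', sff (@nuS R) N x v v' = 0) ->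
  [/\ row_free ('J h x), mean_curvature nu h x = 0
    & ~ (forall v v', sff nu h x v v' = 0)].
Proof.
move=> nuE pN mc ntg.
have sffN v v' := dual_sff_N v v' pN.
have sffNB a b : sff (@nuS R) N x (e_ a) (e_ b) = B a b *: eta.
  by rewrite sffN /B -(dual_second_form Ux) mxE.
have B0 : B != 0.
  apply/eqP => B0; apply: ntg.
  by apply/(totally_geodesic_line oU sN Ux eta0 sffN); rewrite dual_second_form.
have Bt : \tr (invmx (induced N x) *m B) = 0.
  exact: (mean_curvature_line_eq0 sffNB eta0 Bs).1 mc.
have Jh_JN : gram ('J h x) ('J N x) = - B.
  by rewrite -tr_gram JN_Jh// linearN /= Bs.
have JE := JN_Jh_swap Ux (posdef_unit pN) (JN_h Ux) (JN_w Ux) (JN_N Ux) (Jh_h Ux)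
  (Jh_w Ux) (dhN Ux) Jh_JN.
have [ph fh ht] := conformal_swap pN (tr_gram _ _) Bs Bt B0 erefl JE.
have sffh v v' := dual_sff_h v v' ph nuE.
have sffhB a b : sff nu h x (e_ a) (e_ b) = B a b *: N x by rewrite sffh /B mxE.
split.
- exact: fh.
- exact: (mean_curvature_line_eq0 sffhB N0 Bs).2 ht.
- by move=> /(totally_geodesic_line oU sh Ux N0 sffh)/eqP; exact/negP.
Qed.

End AtPoint.
End DualPair.

(** * From minimal surfaces to stationary surfaces *)

Section PartOne.
Variables (R : realType) (M : orientedSurface R).

Lemma chart_imageP (i : chart M) x : chart_image i x ->
  dom i (param i x) /\ coord i (param i x) = x.
Proof. by move=> [p ip <-]; rewrite (coordK ip). Qed.

(** This number is the square of w + c p, the projection of w to the tangent space of H4 at p: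
    nonzero by transversality and orthogonal to the timelike p. *)
Lemma umbilical_nondeg (Q : umbilicalHypersurface R) :
  0 < lor (hyp_dir Q) (hyp_dir Q) + hyp_level Q ^+ 2.
Proof.
have [p Qp] := umb_nonempty Q; have := umb_transversal Qp.
have [[pp _] pw] := Qp; set w := hyp_dir Q; set c := hyp_level Q in pw *.
move=> free; have u0 : w + c *: p != 0.
  apply/eqP => u0; have : row_mx c%:M 1%:M *m col_mx p w = 0.
    by rewrite mul_row_col !mul_scalar_mx scale1r addrC.
  move=> /eqP; rewrite (mulmx_free_eq0 _ free) => /eqP.
  move=> /(congr1 rsubmx); rewrite row_mxKr linear0 => /matrixP/(_ 0 0).
  by rewrite !mxE eqxx => /eqP; rewrite oner_eq0.
have -> : lor w w + c ^+ 2 = lor (w + c *: p) (w + c *: p).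
  by rewrite lorDl !lorDr !lorZl !lorZr (lorC w p) pp pw; ring.
apply: (@lor_timelike_perp _ p) => //; first by rewrite pp ltrN10.
by rewrite lorDr lorZr pp pw; ring.
Qed.

Lemma normal_vectorP k (nu : 'rV[R]_5 -> 'M[R]_(k, 5)) f x xi :
  normal_vector nu f x xi <-> gram xi (nu (f x)) = 0 /\ gram xi ('J f x) = 0.
Proof.
rewrite /normal_vector gram_col_mxr; split=> [/eqP|[-> ->]]; last exact: row_mx0.
by rewrite row_mx_eq0 => /andP[/eqP -> /eqP ->].
Qed.

Variable m : riemannianMetric M.

Lemma associate_stationary (Q : umbilicalHypersurface R) (h N : M -> 'rV[R]_5) :
  minimal_immersion Q h -> isometric m h ->
  no_totally_geodesic_point (nuQ Q) h -> associate Q h N ->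
  [/\ stationary_immersion N, flat_normal_bundle N
    & no_totally_geodesic_point (@nuS R) N].
Proof.
move=> [[hQ sh fh] mch] iso ntg [sN NN nv].
have normal (i : chart M) x : chart_image i x ->
    [/\ lor (h (param i x)) (N (param i x)) = 0,
        lor (N (param i x)) (hyp_dir Q) = 0
      & gram ('J (h \o param i) x) (N (param i x)) = 0].
  move=> /nv /normal_vectorP[+ J]; rewrite /nuQ gram_col_mxr !gram_lor => /eqP.
  rewrite row_mx_eq0 => /andP[/eqP /matrixP/(_ 0 0) + /eqP /matrixP/(_ 0 0)].
  rewrite !mxE eqxx !mulr1n => h1 h2; split=> //; first by rewrite lorC.
  by rewrite -tr_gram J trmx0.
have key (i : chart M) x : chart_image i x ->
  [/\ posdef (induced (N \o param i) x), row_free ('J (N \o param i) x),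
      mean_curvature (@nuS R) (N \o param i) x = 0,
      forall e1 e2 e3 e4, normal_curvature (@nuS R) (N \o param i) x e1 e2 e3 e4 = 0
    & ~ (forall v v', sff (@nuS R) (N \o param i) x v v' = 0)].
  move=> Ux; have [ip xE] := chart_imageP Ux.
  have hQi y : chart_image i y -> umb_set Q ((h \o param i) y) by move=> _; exact: hQ.
  apply: (@dual_of_minimal _ (chart_image i) (h \o param i) (N \o param i)
    (hyp_dir Q) (hyp_level Q) _ (sh i) (sN i) _ _ _ _ _ _ _ x Ux (nuQ Q) erefl).
  - exact: image_open.
  - by move=> y /hQi[[]].
  - by move=> y /hQi[].
  - by move=> y _; exact: NN.
  - by move=> y /normal[].
  - by move=> y /normal[].
  - by move=> y /normal[].
  - by rewrite gt_eqF// umbilical_nondeg.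
  - by rewrite iso//; exact: met_posdef.
  - exact: mch.
  - by move=> tg; apply: (ntg (param i x)); exists i; [exact: ip|rewrite xE; exact: tg].
split.
- split; first split.
  + exact: NN.
  + exact: sN.
  + by move=> i x /key[].
  + by move=> i x /key[].
  + by move=> i x /key[].
- by move=> i x /key[_ _ _ nc _] e1 e2 e3 e4 _; exact: nc.
- move=> p [i ip tg]; have Ux : chart_image i (coord i p) by exists p.
  by have [_ _ _ _] := key _ _ Ux; apply.
Qed.

End PartOne.

(** * Normal bundle of a stationary surface *)

Section NormalPlane.
Variable R : realType.
Implicit Types (x y z w xi : 'rV[R]_5).

Lemma gram_free_full k m (A : 'M[R]_(k, 5)) (y : 'M[R]_(m, 5)) : k = 5 ->
  row_free A -> gram y A = 0 -> y = 0.
Proof.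
move=> k5 fA yA.
have /row_fullP[L LA] : row_full A.
  by move: fA; rewrite /row_free /row_full => /eqP ->; apply/eqP.
have : gram y (L *m A) = 0 by rewrite gram_mulr yA mul0mx.
rewrite LA gramE trmx1 mulmx1 => /(congr1 (mulmx^~ (mink R))).
by rewrite -mulmxA minkK mulmx1 mul0mx.
Qed.

Lemma lor_neq0 w : w != 0 -> exists k, lor k w != 0.
Proof.
move=> w0; apply: contrapT => h; move/eqP: w0; apply.
apply: lor_eq0 => y; apply/eqP/negP => /negP wy; apply: h.
by exists y; rewrite lorC.
Qed.

Lemma lor_gram k (A : 'M[R]_(k, 5)) (a : 'rV[R]_k) :
  lor (a *m A) (a *m A) = form (gram A A) a a.
Proof. by rewrite /Defs.form gramE lorE trmx_mul !mulmxA. Qed.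

Lemma posdef_gram_point x (J : 'M[R]_(2, 5)) : lor x x = 1 -> gram J x = 0 ->
  posdef (gram J J) -> posdef (gram (col_mx x J) (col_mx x J)).
Proof.
move=> xx Jx pJ v v0; rewrite -lor_gram.
rewrite -[v](@hsubmxK _ 1 1 2) mul_row_col [lsubmx v]mx11_scalar mul_scalar_mx.
set a := lsubmx v 0 0; set b := rsubmx v.
have bx : lor (b *m J) x = 0.
  have := gram_mull b J x; rewrite Jx mulmx0 gram_lor => /matrixP/(_ 0 0).
  by rewrite !mxE eqxx mulr1n.
rewrite lorDl !lorDr !lorZl !lorZr (lorC x) bx xx !mulr0 addr0 add0r mulr1 lor_gram.
have [b0|/pJ b0] := eqVneq b 0; last by apply: ltr_wpDl => //; rewrite -expr2 sqr_ge0.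
rewrite b0 /Defs.form !mul0mx mxE addr0 -expr2 lt_neqAle sqr_ge0 andbT eq_sym sqrf_eq0.
apply: contra_neq v0 => a0.
rewrite -[v](@hsubmxK _ 1 1 2) [lsubmx v]mx11_scalar -/a a0 -/b b0 raddf0.
exact: row_mx0.
Qed.

(** The part removed lies in a positive definite subspace, so removing it can only lower <x,x>. *)
Lemma timelike_normal_part k (A : 'M[R]_(k, 5)) x : posdef (gram A A) ->
  lor (normal_part A x) (normal_part A x) <= lor x x.
Proof.
move=> pA; have uA := posdef_unit pA; set s := normal_part A x.
pose a := gram x A *m invmx (gram A A).
have xE : x = s + a *m A by rewrite /s /normal_part subrK.
have sA : lor s (a *m A) = 0.
  have := gram_mulr a s A; rewrite normal_part_perp// mul0mx gram_lor.
  by move=> /matrixP/(_ 0 0); rewrite !mxE eqxx mulr1n.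
clearbody s; rewrite [in leRHS]xE lorDl !lorDr sA (lorC _ s) sA addr0 add0r lor_gram.
rewrite lerDl; have [->|/pA/ltW//] := eqVneq a 0.
by rewrite /Defs.form !mul0mx mxE.
Qed.

Lemma lor_e0e0 : lor (delta_mx 0 0) (delta_mx 0 0) = -1 :> R.
Proof. by rewrite lor_e0 mxE !eqxx. Qed.

Lemma normalize_pos y : 0 < lor y y -> lor ((Num.sqrt (lor y y))^-1 *: y)
  ((Num.sqrt (lor y y))^-1 *: y) = 1.
Proof.
move=> yy; rewrite lorZl lorZr mulrA -expr2 exprVn sqr_sqrtr ?ltW//.
by rewrite mulVf// gt_eqF.
Qed.

Lemma normalize_neg y : lor y y < 0 -> lor ((Num.sqrt (- lor y y))^-1 *: y)
  ((Num.sqrt (- lor y y))^-1 *: y) = -1.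
Proof.
move=> yy; rewrite lorZl lorZr mulrA -expr2 exprVn sqr_sqrtr ?oppr_ge0 ?ltW//.
by rewrite invrN mulNr mulVf// lt_eqF.
Qed.

(** e_4 is the normalized normal part of the time axis, timelike by [timelike_normal_part]; e_3 is
    orthogonal to it and hence spacelike. *)
Lemma normal_frame k (A : 'M[R]_(k, 5)) : (k + 2 = 5)%N -> posdef (gram A A) ->
  exists e3 e4, [/\ gram e3 A = 0, gram e4 A = 0, lor e3 e3 = 1, lor e4 e4 = -1
    & lor e3 e4 = 0].
Proof.
move=> k5 pA; have uA := posdef_unit pA.
set s := normal_part A (delta_mx 0 0).
have ss : lor s s < 0.
  by apply: le_lt_trans (timelike_normal_part _ pA) _; rewrite lor_e0e0 ltrN10.
have sA : gram s A = 0 by exact: normal_part_perp.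
clearbody s; have k1 : (k + 1 < 5)%N by rewrite -k5 ltn_add2l.
have [y y0] := exists_perp (col_mx A s) k1.
rewrite gram_col_mxr => /eqP; rewrite row_mx_eq0 => /andP[/eqP yA].
rewrite gram_lor => /eqP/matrixP/(_ 0 0); rewrite !mxE eqxx mulr1n => ys.
have yy : 0 < lor y y by apply: (@lor_timelike_perp _ s) => //; rewrite lorC.
exists ((Num.sqrt (lor y y))^-1 *: y), ((Num.sqrt (- lor s s))^-1 *: s).
split; first by rewrite gramZl yA scaler0.
- by rewrite gramZl sA scaler0.
- exact: normalize_pos.
- exact: normalize_neg.
- by rewrite lorZl lorZr ys !mulr0.
Qed.

Lemma normal_expand k (A : 'M[R]_(k, 5)) e3 e4 xi : (k + 2 = 5)%N ->
  gram A A \in unitmx -> gram e3 A = 0 -> gram e4 A = 0 -> lor e3 e3 = 1 ->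
  lor e4 e4 = -1 -> lor e3 e4 = 0 -> gram xi A = 0 ->
  xi = lor xi e3 *: e3 - lor xi e4 *: e4.
Proof.
move=> k5 uA e3A e4A e33 e44 e34 xiA; apply/eqP; rewrite -subr_eq0; apply/eqP.
have uF : gram (col_mx A (col_mx e4 e3)) (col_mx A (col_mx e4 e3)) \in unitmx.
  apply: gram_col_unit => //.
    apply: gram_pair_unit => //.
    by rewrite e33 lorC e34 expr0n addr0 oner_eq0.
  by rewrite -tr_gram gram_col_mxl e3A e4A col_mx0 trmx0.
apply: (gram_unit_full _ uF) => //.
set r := xi - _.
have r3 : lor r e3 = 0.
  by rewrite /r !lorBl !lorZl e33 (lorC e4) e34; ring.
have r4 : lor r e4 = 0 by rewrite /r !lorBl !lorZl e44 e34; ring.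
have rA : gram r A = 0 by rewrite /r !gramBl !gramZl xiA e3A e4A !scaler0 !subr0.
by rewrite !gram_col_mxr rA !gram_lor r3 r4 raddf0 !row_mx0.
Qed.

Lemma nondegenerate_normal k (A : 'M[R]_(k, 5)) eta : gram A A \in unitmx ->
  gram eta A = 0 -> eta != 0 -> exists2 xi, gram xi A = 0 & lor eta xi != 0.
Proof.
move=> uA eA /lor_neq0[y ye]; exists (normal_part A y); first exact: normal_part_perp.
by rewrite lorC lor_normal_part.
Qed.

(* Pairing a linear relation with w isolates the coefficient of k, and pairing with
   a normal vector isolates that of v. *)
Lemma free_normal_extension k (A : 'M[R]_(k, 5)) v w xi z :
  gram A A \in unitmx -> gram w A = 0 -> lor v w = 0 -> lor z w != 0 ->
  gram xi A = 0 -> lor v xi != 0 ->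
  row_free (col_mx (col_mx A v) z).
Proof.
move=> uA wA vw zw xiA vxi; apply/inj_row_free => a.
rewrite -[a]hsubmxK -[lsubmx a]hsubmxK !mul_row_col.
set b := lsubmx (lsubmx a); set c := rsubmx (lsubmx a); set d := rsubmx a.
have Aw : gram A w = 0 by rewrite -tr_gram wA trmx0.
have Axi : gram A xi = 0 by rewrite -tr_gram xiA trmx0.
move=> E.
have d0 : d = 0.
  have := congr1 (fun t => gram t w) E; rewrite !gramDl !gram_mull Aw !gram_lor vw lor0l.
  rewrite mulmx0 raddf0 mulmx0 !add0r mul_mx_scalar => /eqP.
  by rewrite scaler_eq0 (negPf zw) => /eqP.
have c0 : c = 0.
  have := congr1 (fun t => gram t xi) E; rewrite d0 mul0mx addr0 !gramDl.
  rewrite !gram_mull Axi !gram_lor lor0l.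
  rewrite mulmx0 raddf0 !add0r mul_mx_scalar => /eqP.
  by rewrite scaler_eq0 (negPf vxi) => /eqP.
have b0 : b = 0.
  have := congr1 (fun t => gram t A) E; rewrite d0 c0 !mul0mx !addr0 gram_mull.
  have -> : gram (0 : 'rV[R]_5) A = 0 by rewrite gramE !mul0mx.
  by move=> /(congr1 (mulmx^~ (invmx (gram A A)))); rewrite mulmxK// mul0mx.
by rewrite b0 c0 d0 !row_mx0.
Qed.

End NormalPlane.

Lemma open_nonzero (R : realType) (V : normedModType R) (U : set V) (f : V -> R) :
  open U -> smooth_on U f -> open [set y | U y /\ f y != 0].
Proof.
move=> oU fU; rewrite openE => y [Uy fy]; apply: filterI; first exact: open_near.
by apply: cvgr_neq0 fy; exact: (fU 0%N y Uy).
Qed.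

(** * The local constant normal vector of a stationary surface *)

Section StationaryPoint.
Variable R : realType.
Variables (U : set 'rV[R]_2) (G : 'rV[R]_2 -> 'rV[R]_5).
Hypotheses (oU : open U) (sG : smooth_on U G).
Hypothesis GG : forall y, U y -> lor (G y) (G y) = 1.
Hypothesis Gpos : forall y, U y -> posdef (induced G y).
Hypothesis Gmc : forall y, U y -> mean_curvature (@nuS R) G y = 0.
Hypothesis Gflat : forall y, U y -> forall e1 e2 e3 e4,
  adapted_frame (@nuS R) G y e1 e2 e3 e4 ->
  normal_curvature (@nuS R) G y e1 e2 e3 e4 = 0.
Hypothesis Gtg : forall y, U y -> ~ (forall v w, sff (@nuS R) G y v w = 0).

(** The position vector is included so that the orthogonal complement of the rows is the Lorentzian
    normal plane inside the tangent space of S41. *)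
Definition tangent_frame y : 'M[R]_(1 + 2, 5) := col_mx (G y) ('J G y).

Lemma rowG y a : U y -> row a ('J G y) = 'D_(e_ a) G y.
Proof. by move=> Uy; apply: row_jacobian; exact: smooth_differentiable sG Uy. Qed.

Lemma jacobian_point_perp y : U y -> gram ('J G y) (G y) = 0.
Proof.
move=> Uy; apply/gram_rowP => a j; rewrite [j]ord1 row_id rowG//.
exact: (derive_lor_self _ oU sG GG).
Qed.

Lemma tangent_frame_posdef y : U y -> posdef (gram (tangent_frame y) (tangent_frame y)).
Proof.
by move=> Uy; apply: posdef_gram_point; [exact: GG|exact: jacobian_point_perp|exact: Gpos].
Qed.

Lemma tangent_frame_unit y : U y -> gram (tangent_frame y) (tangent_frame y) \in unitmx.
Proof. by move=> Uy; exact/posdef_unit/tangent_frame_posdef. Qed.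

Lemma tangent_frame_perp y xi : U y -> (gram xi (tangent_frame y) = 0) <->
  (lor xi (G y) = 0 /\ forall a, lor xi ('D_(e_ a) G y) = 0).
Proof.
move=> Uy; rewrite /tangent_frame gram_col_mxr gram_lor; split=> [/eqP|[-> h]].
  rewrite row_mx_eq0 => /andP[/eqP/matrixP/(_ 0 0)]; rewrite !mxE eqxx mulr1n => -> /eqP h.
  by split=> // a; rewrite -rowG//; have /gram_eq0P := h.
rewrite raddf0 (_ : gram xi _ = 0) ?row_mx0//; apply/gram_eq0P => a.
by rewrite rowG.
Qed.

Section AtPoint.
Variable x : 'rV[R]_2.
Hypothesis Ux : U x.
Let A := tangent_frame x.
Let I := induced G x.
Let uA : gram A A \in unitmx. Proof. exact: tangent_frame_unit. Qed.

Let sff_lor v w xi : gram xi A = 0 ->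
  lor (sff (@nuS R) G x v w) xi = form (second_form G x xi) v w.
Proof.
move=> xiA; rewrite -(lor_derive2 xi v w oU sG Ux); exact: lor_normal_part.
Qed.

Let sff_lor_e a b xi : gram xi A = 0 ->
  lor (sff (@nuS R) G x (e_ a) (e_ b)) xi = second_form G x xi a b.
Proof. by move=> xiA; rewrite mxE; exact: lor_normal_part. Qed.

Let shapeE xi : gram xi A = 0 ->
  shape (@nuS R) G x xi = second_form G x xi *m invmx I.
Proof.
move=> xiA; rewrite /Defs.shape; apply: (congr1 (mulmx^~ (invmx I))).
by apply/matrixP => a b; rewrite mxE sff_lor_e.
Qed.

Let second_form_tr xi : gram xi A = 0 -> \tr (invmx I *m second_form G x xi) = 0.
Proof.
move=> xiA; have := congr1 (fun z => lor z xi) (Gmc Ux); rewrite lor0l.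
rewrite /mean_curvature lorZl lor_suml => /eqP; rewrite mulf_eq0 invr_eq0 pnatr_eq0.
move=> /= /eqP h; rewrite -(second_form_sym xi oU sG Ux) -sum_mx_trace -[RHS]h; apply: eq_bigr => a _.
by rewrite lor_suml; apply: eq_bigr => b _; rewrite lorZl sff_lor_e.
Qed.

Lemma second_form_rank1 : exists B eta, [/\ B^T = B, B \in unitmx, eta != 0,
  gram eta A = 0 & forall xi, gram xi A = 0 -> second_form G x xi = lor eta xi *: B].
Proof.
have pI : posdef I by exact: Gpos.
have Is : I^T = I by exact: tr_gram.
have [E EI] := posdef_orthonormal Is pI.
have [e3 [e4 [e3A e4A e33 e44 e34]]] :=
  normal_frame (erefl : (1 + 2 + 2 = 5)%N) (tangent_frame_posdef Ux).
have expand xi : gram xi A = 0 -> xi = lor xi e3 *: e3 - lor xi e4 *: e4.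
  by apply: normal_expand.
have formE i j : form I (row i E) (row j E) = (E *m I *m E^T) i j.
  rewrite /Defs.form -!row_mul !mxE; apply: eq_bigr => k _.
  by rewrite !mxE.
have fr : adapted_frame (@nuS R) G x (row 0 E) (row 1 E) e3 e4.
  by split; split; rewrite ?formE ?EI ?mxE.
have := Gflat Ux fr; rewrite /normal_curvature !shapeE//.
set B3 := second_form G x e3; set B4 := second_form G x e4 => nc.
(* The metric contained in [form] cancels the last inverse metric of the two shape operators. *)
have nc0 : (row 0 E *m (B4 *m invmx I *m B3 - B3 *m invmx I *m B4) *m (row 1 E)^T) 0 0 = 0.
  rewrite -[RHS]nc /Defs.form; congr ((_ *m (row 1 E)^T) 0 0).
  by rewrite -/I !mulmxA -mulmxBl mulmxKV ?posdef_unit// mulmxBr !mulmxA.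
have B3s : B3^T = B3 by exact: second_form_sym oU sG Ux.
have B4s : B4^T = B4 by exact: second_form_sym oU sG Ux.
have B3t := second_form_tr e3A; have B4t := second_form_tr e4A.
have comb xi : gram xi A = 0 -> second_form G x xi = lor xi e3 *: B3 - lor xi e4 *: B4.
  move=> xiA; apply/matrixP => a b; rewrite -sff_lor_e// {1}(expand xi xiA).
  by rewrite lorBr !lorZr !sff_lor_e// !mxE.
have e30 : e3 != 0.
  by apply/eqP => e; move: e33; rewrite e lor0l => /esym/eqP; rewrite oner_eq0.
have [B30|B30] := eqVneq B3 0; last first.
  have [l El] := traceless_commute EI B3s B4s B3t B4t B30 nc0.
  (* With B4 = l B3, the combination <xi,e3> B3 - <xi,e4> B4 is <e3 - l e4, xi> B3. *)
  exists B3, (e3 - l *: e4); split=> //.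
  - exact: traceless_unit pI Is B3s B3t B30.
  - apply/eqP => e; have := congr1 (lor e3) e.
    by rewrite lorBr lorZr e33 e34 mulr0 subr0 lor0r => /eqP; rewrite oner_eq0.
  - by rewrite gramBl gramZl e3A e4A scaler0 subr0.
  - move=> xi xiA; rewrite comb// El scalerA -scalerBl lorBl lorZl.
    by rewrite !(lorC xi) (mulrC l).
have B40 : B4 != 0.
  apply/eqP => B40; apply: (Gtg Ux) => v w.
  have nA : gram (sff (@nuS R) G x v w) A = 0 by exact: normal_part_perp.
  rewrite (expand _ nA) !sff_lor// -/B3 -/B4 B30 B40.
  by rewrite /Defs.form !mulmx0 !mul0mx mxE !scale0r subrr.
exists B4, (- e4); split=> //.
- exact: traceless_unit pI Is B4s B4t B40.
- rewrite oppr_eq0; apply/eqP => e; move: e44; rewrite e lor0l => /eqP.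
  by rewrite eq_sym oppr_eq0 oner_eq0.
- by rewrite -scaleN1r gramZl e4A scaler0.
- by move=> xi xiA; rewrite comb// B30 scaler0 sub0r -scaleNr lorNl (lorC xi).
Qed.

End AtPoint.

Lemma stationary_degenerate_near x0 : U x0 ->
  exists2 w : 'rV[R]_5, w != 0 & \forall y \near x0, lor (G y) w = 0.
Proof.
move=> Ux0; have [B [eta [_ Bu eta0 etaA sfE]]] := second_form_rank1 Ux0.
have uA := tangent_frame_unit Ux0.
have [a [b Bab]] : exists a b, B a b != 0.
  apply: contrapT => h; have B0 : B = 0.
    apply/matrixP => i j; rewrite mxE; apply/eqP/negP => /negP Bij.
    by apply: h; exists i, j.
  by move: Bu; rewrite B0 unitmxE det0 unitr0.
(* At [x0] the line sought is that of [w0], normal and orthogonal to [eta]. Here [k] detects [w0]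
   and [zeta] detects [eta], which makes [F x0] invertible. *)
have [w0 w00] := exists_perp (col_mx (tangent_frame x0) eta) (erefl : (1 + 2 + 1 < 5)%N).
rewrite gram_col_mxr => /eqP; rewrite row_mx_eq0 => /andP[/eqP w0A].
rewrite gram_lor => /eqP/matrixP/(_ 0 0); rewrite !mxE eqxx mulr1n => w0eta.
have [k kw] := lor_neq0 w00.
have [zeta zetaA ezeta] := nondegenerate_normal uA etaA eta0.
have [H HE] : exists H, H = 'D_(e_ a) ('D_(e_ b) G) by eexists.
have sH : smooth_on U H by rewrite HE; exact/smooth_derive/smooth_derive.
have sfH y z : second_form G y z a b = lor (H y) z by rewrite HE mxE.
pose F y : 'M[R]_5 := col_mx (col_mx (tangent_frame y) (H y)) k.
have F0 : F x0 \in unitmx.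
  have Hw0 : lor (H x0) w0 = 0 by rewrite -sfH sfE// mxE lorC w0eta mul0r.
  have Hzeta : lor (H x0) zeta != 0 by rewrite -sfH sfE// mxE mulf_neq0.
  by have := free_normal_extension uA w0A Hw0 kw zetaA Hzeta; rewrite row_free_unit.
have sF : smooth_on U F.
  move=> n; apply: (@Ck_col_mx _ _ _ _ 4 1 5) => //; last exact: Ck_cst.
  apply: (@Ck_col_mx _ _ _ _ 3 1 5) => //.
  by apply: (@Ck_col_mx _ _ _ _ 1 2 5) => //; exact: smooth_jacobian.
pose U' := [set y | U y /\ \det (F y) != 0].
have oU' : open U' by apply: open_nonzero => // n; exact: Ck_det.
have UU' : U' `<=` U by move=> y [].
have Fu y : U' y -> F y \in unitmx by move=> [_]; rewrite unitmxE unitfE.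
have sub (W : normedModType R) (f : _ -> W) : smooth_on U f -> smooth_on U' f.
  by move=> fU n; exact: Ck_subset UU' (fU n).
pose sol (r : 'rV[R]_5) y := r *m invmx (F y)^T *m mink R.
have solE r y : U' y -> gram (sol r y) (F y) = r.
  move=> /Fu uF; rewrite gramE /sol -!mulmxA (mulmxA (mink R)) minkK mul1mx.
  by rewrite mulVmx ?unitmx_tr// mulmx1.
have gramF (z : 'rV[R]_5) y : gram z (F y) = row_mx (row_mx (gram z (tangent_frame y))
    (gram z (H y))) (gram z k) :> 'M[R]_(1, 1 + 2 + 1 + 1).
  by rewrite -!gram_col_mxr.
have FE (z : 'rV[R]_5) y r1 r2 r3 :
    gram z (F y) = row_mx (row_mx r1 r2%:M) r3%:M :> 'M[R]_(1, 1 + 2 + 1 + 1) ->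
    [/\ gram z (tangent_frame y) = r1, lor z (H y) = r2 & lor z k = r3].
  rewrite gramF => /eq_row_mx[/eq_row_mx[h1 h2] h3]; split=> //.
    by move/matrixP/(_ 0 0) : h2; rewrite gram_lor !mxE eqxx !mulr1n.
  by move/matrixP/(_ 0 0) : h3; rewrite gram_lor !mxE eqxx !mulr1n.
pose xi := sol (row_mx (row_mx 0 0%:M) 1%:M : 'M[R]_(1, 1 + 2 + 1 + 1)).
have xiF y : U' y -> [/\ gram (xi y) (tangent_frame y) = 0, lor (xi y) (H y) = 0
    & lor (xi y) k = 1].
  by move=> U'y; apply: FE; exact: solE.
(* Only the pairing with the one second derivative [H] is prescribed. The solution [z] dual to [H]
   shows that the (a, b) entry of B' is nonzero, so <xi,H> = 0 forces <eta',xi> = 0 and the whole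
   form vanishes. *)
have xi_sf y : U' y -> second_form G y (xi y) = 0.
  move=> U'y; have [B' [eta' [_ _ _ _ sfE']]] := second_form_rank1 (UU' _ U'y).
  have [xA xH _] := xiF y U'y; rewrite sfE'//.
  have := solE (row_mx (row_mx 0 1%:M) 0%:M : 'M[R]_(1, 1 + 2 + 1 + 1)) y U'y.
  set z := sol _ y => /FE[zA zH _].
  have B'ab : B' a b != 0.
    apply/eqP => B'0; have := sfH y z; rewrite sfE'// mxE B'0 mulr0 lorC zH => /eqP.
    by rewrite eq_sym oner_eq0.
  have /eqP := sfH y (xi y); rewrite sfE'// mxE lorC -(lorC (xi y)) xH.
  by rewrite mulf_eq0 (negPf B'ab) orbF lorC => /eqP ->; rewrite scale0r.
have sxi : smooth_on U' xi.
  apply: smooth_mulmx => //; last exact: smooth_cst.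
  apply: smooth_mulmx => //; first exact: smooth_cst.
  apply: smooth_invmx => //; first by move=> y /Fu; rewrite unitmx_tr.
  by move=> n; apply: Ck_trmx => //; exact: (sub _ _ sF n).
have dxi0 y c : U' y -> 'D_(e_ c) xi y = 0.
  move=> U'y; have Uy := UU' _ U'y.
  have [B' [eta' [_ B'u _ _ sfE']]] := second_form_rank1 Uy.
  have xiG z : U' z -> lor (xi z) (G z) = 0.
    by move=> U'z; have [/(tangent_frame_perp _ (UU' _ U'z))[]] := xiF z U'z.
  have xidG d z : U' z -> lor (xi z) ('D_(e_ d) G z) = 0.
    by move=> U'z; have [/(tangent_frame_perp _ (UU' _ U'z))[]] := xiF z U'z.
  have xiddG d e z : U' z -> lor (xi z) ('D_(e_ d) ('D_(e_ e) G) z) = 0.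
    by move=> /xi_sf/matrixP/(_ d e); rewrite !mxE lorC.
  (* The derivative of [xi] is again normal, since [xi] is orthogonal to g and to its first and
     second derivatives; [second_form_rank1] then applies to it. *)
  have dA d : gram ('D_(e_ d) xi y) (tangent_frame y) = 0.
    apply/(tangent_frame_perp _ Uy); split=> [|e].
      apply: etrans (derive_lor_cst (e_ d) oU' sxi (sub _ _ sG) xiG U'y) _.
      by rewrite xidG// oppr0.
    apply: etrans (derive_lor_cst (e_ d) oU' sxi (sub _ _ (smooth_derive (e_ e) sG))
      (xidG e) U'y) _.
    by rewrite xiddG// oppr0.
  have [T TE] : exists T : 'I_2 -> 'I_2 -> 'I_2 -> R, forall d e f,
      T d e f = lor (xi y) ('D_(e_ d) ('D_(e_ e) ('D_(e_ f) G)) y) by eexists.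
  have TS d e f : T d e f = T e d f.
    rewrite !TE.
    exact: (congr1 (lor (xi y)) (derive_comm _ _ oU (smooth_derive (e_ f) sG 2) Uy)).
  have dT d e f : second_form G y ('D_(e_ d) xi y) e f = - T d e f.
    rewrite mxE TE lorC.
    exact: (derive_lor_cst (e_ d) oU' sxi
      (sub _ _ (smooth_derive (e_ e) (smooth_derive (e_ f) sG)))
      (xiddG e f) U'y).
  pose th d := lor eta' ('D_(e_ d) xi y).
  have thB d e f : th d * B' e f = - T d e f.
    by apply: etrans (dT d e f); rewrite (sfE' _ (dA d)) mxE.
  clearbody th.
  have th0 d : th d = 0.
    (* Symmetry of T in its first two indices reads th_1 B'_0f = th_0 B'_1f, that is v B' = 0 with
       B' invertible. *)
    pose v : 'rV[R]_2 := \row_j (if j == 0 then th 1 else - th 0).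
    have vB : v *m B' = 0.
      apply/rowP => f; rewrite !mxE sum2 !mxE /= mulNr !thB TS.
      by rewrite opprK addNr.
    have v0 : v = 0 by rewrite -[v](mulmxK B'u) vB mul0mx.
    move/rowP : v0 => v0; move: (v0 0) (v0 1); rewrite !mxE /= => h1 /eqP.
    rewrite oppr_eq0 => /eqP h0.
    by case: (ord2P d) => ->.
  (* The derivative of [xi] is orthogonal to every row of the frame, the row [k] being covered by
     the normalization <xi,k> = 1. *)
  apply: (@gram_free_full _ 5 1 (F y)) => //; first by rewrite row_free_unit Fu.
  rewrite gramF dA !gram_lor.
  have -> : lor ('D_(e_ c) xi y) (H y) = 0.
    by rewrite lorC -sfH dT -thB th0 mul0r.
  have -> : lor ('D_(e_ c) xi y) k = 0.
    by apply: (derive_lor_cstr (c := 1) _ oU' sxi _ U'y) => z /xiF[].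
  by rewrite raddf0 !row_mx0.
have U'x0 : U' x0 by split=> //; move: F0; rewrite unitmxE unitfE.
have [r /= r0 br] := (nbhs_ballP _ _).1 (open_near oU' U'x0).
have [_ _ xik] := xiF _ U'x0.
exists (xi x0).
  by apply/eqP => e; move: xik; rewrite e lor0l => /esym/eqP; rewrite oner_eq0.
apply/nbhs_ballP; exists r => // y yb.
have dxi z : ball x0 r z -> differentiable xi z.
  by move=> /br; exact: smooth_differentiable.
rewrite -(@zero_derive_ball _ _ _ _ xi x0 r dxi _ y yb).
  by have [/(tangent_frame_perp _ (UU' _ (br _ yb)))[h _] _ _] := xiF _ (br _ yb); rewrite lorC.
move=> z v zb; rewrite (derive_coords v (dxi z zb)) big1// => c _.
by rewrite dxi0 ?scaler0//; exact: br.
Qed.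

Lemma normal_of_near x0 w : U x0 -> (\forall y \near x0, lor (G y) w = 0) ->
  gram w (tangent_frame x0) = 0 /\ second_form G x0 w = 0.
Proof.
move=> Ux0 near0.
(* An open set is needed to differentiate the relation. *)
pose V := interior [set y | U y /\ lor (G y) w = 0].
have oV : open V by exact: open_interior.
have Vx0 : V x0 by exact: filterI (open_near oU Ux0) near0.
have VE : V `<=` [set y | U y /\ lor (G y) w = 0] by exact: interior_subset.
have sV : smooth_on V G by move=> n; apply: Ck_subset (sG n) => y /VE[].
have h0 y : V y -> lor (G y) w = 0 by move=> /VE[].
have h1 a y : V y -> lor ('D_(e_ a) G y) w = 0.
  by move=> Vy; exact: (derive_lor_cstr _ oV sV h0 Vy).
split.
  apply/(tangent_frame_perp _ Ux0); rewrite lorC h0//; split=> // a.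
  by rewrite lorC h1.
apply/matrixP => a b; rewrite !mxE.
exact: (derive_lor_cstr _ oV (smooth_derive (e_ b) sV) (h1 b) Vx0).
Qed.

(** Both vectors lie in the normal plane at [x0] and are orthogonal to [eta], which leaves a line.
    This rigidity carries a local solution along the surface. *)
Lemma normal_of_near_unique x0 w w0 : U x0 -> w0 != 0 ->
  (\forall y \near x0, lor (G y) w = 0) -> (\forall y \near x0, lor (G y) w0 = 0) ->
  exists l, w = l *: w0.
Proof.
move=> Ux0 w00 /(normal_of_near Ux0)[wA wS] /(normal_of_near Ux0)[w0A w0S].
have [B [eta [_ Bu eta0 etaA sfE]]] := second_form_rank1 Ux0.
have B0 : B != 0 by apply: contraTneq Bu => ->; rewrite unitmxE det0 unitr0.
have eta_perp z : gram z (tangent_frame x0) = 0 -> second_form G x0 z = 0 -> lor eta z = 0.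
  move=> zA zS; have := sfE z zA; rewrite zS => /esym/eqP.
  by rewrite scaler_eq0 (negPf B0) orbF => /eqP.
have ew := eta_perp _ wA wS; have ew0 := eta_perp _ w0A w0S.
have uA := tangent_frame_unit Ux0.
have [k kw] := lor_neq0 w00.
have [zeta zetaA ezeta] := nondegenerate_normal uA etaA eta0.
have F := free_normal_extension uA w0A ew0 kw zetaA ezeta.
exists (lor k w / lor k w0); apply/eqP; rewrite -subr_eq0; apply/eqP.
apply: (gram_free_full _ F) => //.
rewrite 2!gram_col_mxr; set z := w - _.
have zA : gram z (tangent_frame x0) = 0.
  by rewrite /z gramBl gramZl wA w0A scaler0 subr0.
have ze : lor z eta = 0 by rewrite lorC /z lorBr lorZr ew ew0 mulr0 subr0.
have zk : lor z k = 0 by rewrite lorC /z lorBr lorZr divfK// subrr.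
rewrite zA !gram_lor ze zk.
by rewrite raddf0 !row_mx0.
Qed.

End StationaryPoint.

(** * Passing to the whole surface *)

Section Charts.
Variables (R : realType) (M : orientedSurface R).

Lemma near_coord (i : chart M) p (P : set 'rV[R]_2) : dom i p ->
  (\forall x \near coord i p, P x) -> \forall q \near p, P (coord i q).
Proof. by move=> ip; exact: (Defs.coord_continuous ip). Qed.

Lemma near_param (i : chart M) p (P : set M) : dom i p ->
  (\forall q \near p, P q) -> \forall x \near coord i p, P (param i x).
Proof.
move=> ip Pp; have Ux : chart_image i (coord i p) by exists p.
by apply: (param_continuous Ux); rewrite /= coordK.
Qed.

Lemma jacobian_comp m n k (t : 'rV[R]_m -> 'rV[R]_n) (f : 'rV[R]_n -> 'rV[R]_k) x :
  differentiable t x -> differentiable f (t x) ->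
  'J (f \o t) x = 'J t x *m 'J f (t x).
Proof.
move=> dt df; have dc := differentiable_comp dt df.
apply/row_matrixP => a; rewrite row_mul (row_jacobian a dt) (row_jacobian a dc).
apply: etrans (deriveE _ dc) _; rewrite (diff_comp dt df) /= (deriveE _ dt).
by rewrite /jacobian mul_rV_lin1.
Qed.

Lemma near_jacobian m n (f g : 'rV[R]_m -> 'rV[R]_n) x :
  differentiable f x -> (\forall y \near x, f y = g y) -> 'J f x = 'J g x.
Proof.
move=> df fg; have dg := near_eq_differentiable fg df.
apply/row_matrixP => a; apply: (etrans (row_jacobian a df)).
by apply: etrans (esym (row_jacobian a dg)); exact: near_eq_derive.
Qed.

(** The positive determinant is the orientation of the surface; it lets a normalized cross product
    agree on overlapping charts. *)
Lemma jacobian_chart_change (f : M -> 'rV[R]_5) (i j : chart M) p : smooth_map f ->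
  dom i p -> dom j p -> exists T : 'M[R]_2,
  0 < \det T /\ 'J (f \o param i) (coord i p) = T *m 'J (f \o param j) (coord j p).
Proof.
move=> sf ip jp; set x := coord i p.
have xij : (coord i @` (dom i `&` dom j)) x by exists p.
pose t := coord j \o param i.
have tx : t x = coord j p by rewrite /t /= coordK.
exists ('J t x); split; first exact: transition_oriented.
have dt : differentiable t x by exact: (smooth_differentiable (transition_smooth i j)).
have dj : differentiable (f \o param j) (t x).
  by rewrite tx; apply: (smooth_differentiable (sf j)); exists p.
rewrite -tx; apply: etrans (jacobian_comp dt dj); apply: near_jacobian.
  by apply: (smooth_differentiable (sf i)); exists p.
have := near_param ip (open_nbhs_nbhs (conj (dom_open j) jp)).
by apply: filterS => y jy; rewrite /t /= coordK.
Qed.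

Lemma glue_charts (Phi : chart M -> 'rV[R]_2 -> 'rV[R]_5) :
  (forall i, smooth_on (chart_image i) (Phi i)) ->
  (forall i j p, dom i p -> dom j p -> Phi i (coord i p) = Phi j (coord j p)) ->
  exists h : M -> 'rV[R]_5,
    smooth_map h /\ forall i p, dom i p -> h p = Phi i (coord i p).
Proof.
move=> sPhi inv;
pose h p := Phi (sval (cid (dom_cover p))) (coord (sval (cid (dom_cover p))) p).
have hE i p : dom i p -> h p = Phi i (coord i p).
  by move=> ip; apply: inv => //; exact: svalP (cid (dom_cover p)).
exists h; split=> // i; apply: smooth_ext (sPhi i); first exact: image_open.
by move=> x /chart_imageP[ip xE]; rewrite /= (hE i)// xE.
Qed.

End Charts.

Section GlobalNormal.
Variables (R : realType) (M : orientedSurface R) (g : M -> 'rV[R]_5).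
Hypotheses (stat : stationary_immersion g) (flat : flat_normal_bundle g)
  (ntg : no_totally_geodesic_point (@nuS R) g).

Let gS p : lor (g p) (g p) = 1. Proof. by have [[h _ _] _ _] := stat; exact: h. Qed.
Let sg : smooth_map g. Proof. by have [[]] := stat. Qed.
Let gpos (i : chart M) x : chart_image i x -> posdef (induced (g \o param i) x).
Proof. by have [_ h _] := stat; exact: h. Qed.
Let gmc (i : chart M) x : chart_image i x ->
  mean_curvature (@nuS R) (g \o param i) x = 0.
Proof. by have [_ _ h] := stat; exact: h. Qed.
Let gtg (i : chart M) x : chart_image i x ->
  ~ (forall v w, sff (@nuS R) (g \o param i) x v w = 0).
Proof.
move=> /chart_imageP[ip xE] tg; apply: (ntg (p := param i x)); exists i; first exact: ip.
rewrite xE; exact: tg.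
Qed.

Let local (p : M) : exists2 w : 'rV[R]_5, w != 0 & \forall q \near p, lor (g q) w = 0.
Proof.
have [i ip] := dom_cover p; have Ux : chart_image i (coord i p) by exists p.
have [w w0 near0] := stationary_degenerate_near (@image_open _ M i) (sg i)
  (fun _ _ => gS _) (@gpos i) (@gmc i) (flat (i := i)) (@gtg i) Ux.
exists w => //; have n1 := near_coord ip near0.
have n2 : nbhs p (dom i) by apply: open_nbhs_nbhs; split=> //; exact: dom_open.
by apply: filterS2 n1 n2 => q /= + iq; rewrite coordK.
Qed.

Let unique (p : M) (w w0 : 'rV[R]_5) : w0 != 0 ->
  (\forall q \near p, lor (g q) w = 0) -> (\forall q \near p, lor (g q) w0 = 0) ->
  exists l, w = l *: w0.
Proof.
move=> w00 nw nw0; have [i ip] := dom_cover p.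
have Ux : chart_image i (coord i p) by exists p.
exact: (normal_of_near_unique (@image_open _ M i) (sg i)
  (fun _ _ => gS _) (@gpos i) (@gmc i) (flat (i := i)) (@gtg i) Ux w00
  (near_param ip nw) (near_param ip nw0)).
Qed.

(** The set of points near which g is orthogonal to w is open, and so is its complement: if w' works
    near p and a nearby q lies in the set, then w is a multiple of w' by uniqueness at q, and
    therefore works near p. *)
Lemma stationary_constant_normal (p0 : M) :
  exists2 w : 'rV[R]_5, w != 0 & forall p, lor (g p) w = 0.
Proof.
have [w w0 near0] := local p0; exists w => //.
pose S := interior [set q | lor (g q) w = 0].
have oS : open S by exact: open_interior.
suff ST : S = [set: M] by move=> p; have Sp : S p; [rewrite ST|exact: interior_subset Sp].
apply: (@surface_connected _ M).
- by exists p0.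
- by exists S; rewrite ?setTI.
exists S; rewrite ?setTI//; rewrite -openC openE => p nSp.
have [w' w'0 near'] := local p.
have n1 : nbhs p (interior [set q | lor (g q) w' = 0]).
  by apply: open_nbhs_nbhs; split; [exact: open_interior|exact: near'].
apply: filterS n1 => q near'q Sq; apply: nSp.
have [l El] := unique w'0 Sq near'q.
rewrite /S /interior; apply: filterS near' => r /= E.
by rewrite El lorZr E mulr0.
Qed.

End GlobalNormal.

(** * Construction of the minimal immersion *)

Lemma gram_col_eq0 (R : realType) m k1 k2 (X : 'M[R]_(m, 5)) (A : 'M[R]_(k1, 5))
    (B : 'M[R]_(k2, 5)) : gram X (col_mx A B) = 0 -> gram X A = 0 /\ gram X B = 0.
Proof. by rewrite gram_col_mxr => /eqP; rewrite row_mx_eq0 => /andP[/eqP -> /eqP ->]. Qed.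

(** * A cross product of four vectors, and time orientation *)

Section Cross.
Variable R : realType.
Implicit Types (B : 'M[R]_(4, 5)) (y : 'rV[R]_5).

Definition extend_row y B : 'M[R]_5 := col_mx y B.

(** The vector representing y |-> det (y; B) for the Lorentzian form; the factor from [mink] raises
    the index. *)
Definition cross B : 'rV[R]_5 := \row_j (mink R j j * \det (extend_row (delta_mx 0 j) B)).

Lemma det_extend_row y B : \det (extend_row y B) =
  \sum_j y 0 j * \det (extend_row (delta_mx 0 j) B).
Proof.
have key z : \det (extend_row z B) = \sum_j z 0 j * cofactor (extend_row 0 B) 0 j.
  rewrite (expand_det_row _ 0); apply: eq_bigr => j _; congr (_ * _).
    have E0 : 0 = lshift 4 (0 : 'I_1) :> 'I_(1 + 4) by exact: val_inj.
    by rewrite /extend_row [X in col_mx z B X]E0 col_mxEu.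
  rewrite /cofactor; congr (_ * \det _); apply/matrixP => a b.
  rewrite [LHS]mxE [LHS]mxE [RHS]mxE [RHS]mxE.
  have -> : lift 0 a = rshift 1 a :> 'I_(1 + 4) by exact: val_inj.
  exact: (etrans (col_mxEd z B a (lift j b)) (esym (col_mxEd 0 B a (lift j b)))).
rewrite key; apply: eq_bigr => j _; congr (_ * _); rewrite key (bigD1 j)//=.
rewrite big1 ?addr0 ?mxE ?eqxx ?mul1r// => l lj.
by rewrite [delta_mx _ _ _ _]mxE (negPf lj) andbF mul0r.
Qed.

Lemma lor_cross B y : lor (cross B) y = \det (extend_row y B).
Proof.
rewrite lor_sum det_extend_row; apply: eq_bigr => j _.
have mm : mink R j j * mink R j j = 1.
  by have /matrixP/(_ j j) := minkK R; rewrite mul_diag_mx !mxE !eqxx !mulr1n.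
by rewrite [cross _ _ _]mxE !mulrA mm mul1r mulrC.
Qed.

Lemma cross_perp B : gram (cross B) B = 0.
Proof.
apply/gram_eq0P => i; rewrite lor_cross; apply/eqP; rewrite -[_ == 0]negbK -unitfE -unitmxE.
apply/negP; rewrite -row_free_unit => fB.
pose r : 'M[R]_(1, 1 + 4) := row_mx 1%:M (- delta_mx 0 i).
have rB : (r : 'rV[R]_5) *m extend_row (row i B) B = 0.
  apply: etrans (mul_row_col (1%:M : 'M[R]_1) _ (row i B) B) _.
  by rewrite mul1mx mulNmx -rowE subrr.
have : r = 0 by apply/eqP; rewrite -(mulmx_free_eq0 _ fB) rB.
move/(congr1 lsubmx); rewrite row_mxKl linear0 => /matrixP/(_ 0 0).
by rewrite !mxE eqxx => /eqP; rewrite oner_eq0.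
Qed.

(** The complement of B lies in that of the timelike w, which is positive definite. The cross
    product is nonzero because pairing it with a nonzero z orthogonal to B gives the determinant of
    an independent family. *)
Lemma cross_neq0 B w : gram B B \in unitmx -> lor w w < 0 ->
  (forall y, gram y B = 0 -> lor y w = 0) -> 0 < lor (cross B) (cross B).
Proof.
move=> uB ww Bw; have perp y : gram y B = 0 -> y != 0 -> 0 < lor y y.
  by move=> /Bw yw; apply: (lor_timelike_perp ww); rewrite lorC.
apply: (perp _ (cross_perp B)).
have [z z0 zB] := exists_perp B isT.
have : extend_row z B \in unitmx.
  rewrite -row_free_unit; apply: gram_unit_free; apply: (@gram_col_unit _ 1 4) => //.
  by apply: gram1_unit; rewrite gt_eqF// perp.
by rewrite unitmxE unitfE -lor_cross; apply: contra_neq => ->; rewrite lor0l.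
Qed.

Lemma cross_mulmx (P : 'M[R]_4) B : cross (P *m B) = \det P *: cross B.
Proof.
apply/rowP => j; rewrite !mxE mulrCA; congr (_ * _).
have -> : extend_row (delta_mx 0 j) (P *m B) =
    (block_mx (1%:M : 'M[R]_1) 0 0 P : 'M[R]_5) *m extend_row (delta_mx 0 j) B.
  apply/esym; apply: etrans (mul_block_col (1%:M : 'M[R]_1) 0 0 P _ B) _.
  by rewrite !mul0mx mul1mx addr0 add0r.
by rewrite det_mulmx (@det_ublock _ 1 4) det1 mul1r.
Qed.

Lemma smooth_cross (V : normedModType R) (U : set V) (B : V -> 'M[R]_(4, 5)) :
  open U -> smooth_on U B -> smooth_on U (fun x => cross (B x)).
Proof.
move=> oU sB k; apply/(Ck_mxP _ _ oU) => i j.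
apply: (@Ck_ext _ _ _ _ _ (fun x => mink R j j * \det (extend_row (delta_mx 0 j) (B x)))) => //.
  by move=> x _; rewrite [RHS]mxE.
apply: CkM => //; first exact: Ck_cst.
apply: Ck_det => //; apply: (@Ck_col_mx _ _ _ _ 1 4 5) => //; exact: Ck_cst.
Qed.

(** If y_0 <= 0, a combination y + a z with a >= 0 has zero time coordinate, hence nonnegative
    square, while every term of that square is nonpositive and <y,y> is negative. *)
Lemma lor_future y z : lor z z < 0 -> 0 < z 0 0 -> lor y y < 0 -> lor y z < 0 -> 0 < y 0 0.
Proof.
move=> zz z0 yy yz; rewrite ltNge; apply/negP => y0.
pose a := - y 0 0 / z 0 0.
have a0 : 0 <= a by rewrite divr_ge0 ?oppr_ge0// ltW.
pose v := y + a *: z.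
have v0 : lor (delta_mx 0 0) v = 0 by rewrite lor_e0 !mxE /a divfK ?gt_eqF// subrr oppr0.
have vv : 0 <= lor v v.
  have [->|vn0] := eqVneq v 0; first by rewrite lor0l.
  by apply/ltW/(lor_timelike_perp _ v0 vn0); rewrite lor_e0e0 ltrN10.
move: vv; rewrite /v lorDl !lorDr !lorZl !lorZr (lorC z y).
have h1 : a * lor y z <= 0 by rewrite mulr_ge0_le0// ltW.
have h2 : a * (a * lor z z) <= 0 by rewrite !mulr_ge0_le0// ltW.
move: h1 h2 yy; lra.
Qed.

Lemma smooth_scale (V : normedModType R) (U : set V) (k : V -> R) m n
    (f : V -> 'M[R]_(m, n)) :
  open U -> smooth_on U k -> smooth_on U f -> smooth_on U (fun x => k x *: f x).
Proof.
move=> oU sk sf l; apply/(Ck_mxP _ _ oU) => i j.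
apply: (@Ck_ext _ _ _ _ _ (fun x => k x * f x i j)) => //.
  by move=> x _; rewrite mxE.
by apply: CkM => //; exact: ((Ck_mxP _ _ oU).1 (sf l)).
Qed.

Lemma smooth_add (V W : normedModType R) (U : set V) (f g : V -> W) :
  open U -> smooth_on U f -> smooth_on U g -> smooth_on U (fun x => f x + g x).
Proof. by move=> oU sf sg l; exact: CkD. Qed.

Lemma smooth_normal_part (V : normedModType R) (U : set V) k (B : V -> 'M[R]_(k, 5)) v :
  open U -> smooth_on U B -> (forall x, U x -> gram (B x) (B x) \in unitmx) ->
  smooth_on U (fun x => normal_part (B x) v).
Proof.
move=> oU sB uB; apply: (@smooth_ext _ _ _ _ (fun x => v +
    (-1) *: (gram v (B x) *m invmx (gram (B x) (B x)) *m B x))) => //.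
  by move=> x _; rewrite scaleN1r.
apply: smooth_add => //; first exact: smooth_cst.
apply: smooth_scale => //; first exact: smooth_cst.
apply: smooth_mulmx => //; apply: smooth_mulmx => //.
  by apply: smooth_gram => //; exact: smooth_cst.
by apply: smooth_invmx => //; exact: smooth_gram.
Qed.

End Cross.

(** * Global normal sections and the three causal cases *)

Section Construction.
Variables (R : realType) (M : orientedSurface R) (g : M -> 'rV[R]_5).
Hypotheses (stat : stationary_immersion g)
  (ntg : no_totally_geodesic_point (@nuS R) g).

Let gS p : lor (g p) (g p) = 1. Proof. by have [[h _ _] _ _] := stat; exact: h. Qed.
Let sg : smooth_map g. Proof. by have [[]] := stat. Qed.
Let gpos (i : chart M) x : chart_image i x -> posdef (induced (g \o param i) x).
Proof. by have [_ h _] := stat; exact: h. Qed.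

Let A (i : chart M) x := tangent_frame (g \o param i) x.

Let Apos (i : chart M) x : chart_image i x -> posdef (gram (A i x) (A i x)).
Proof.
exact: (tangent_frame_posdef (@image_open _ M i) (sg i) (fun _ _ => gS _) (@gpos i)).
Qed.

Let Au (i : chart M) x : chart_image i x -> gram (A i x) (A i x) \in unitmx.
Proof. by move=> Ux; exact/posdef_unit/Apos. Qed.

Let sA (i : chart M) : smooth_on (chart_image i) (A i).
Proof.
move=> n; have oU := @image_open _ M i; apply: Ck_col_mx => //; first exact: sg.
exact: smooth_jacobian.
Qed.

Let A_change (i j : chart M) p : dom i p -> dom j p -> exists P : 'M[R]_(1 + 2),
  0 < \det P /\ A i (coord i p) = P *m A j (coord j p).
Proof.
move=> ip jp; have [T [T0 JT]] := jacobian_chart_change sg ip jp.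
exists (block_mx 1%:M 0 0 T); split; first by rewrite det_ublock det1 mul1r.
rewrite /A /tangent_frame mul_block_col !mul0mx mul1mx addr0 add0r.
apply: (f_equal2 (@col_mx _ 1 2 5)); last exact: JT.
by rewrite /= !coordK.
Qed.

Definition normal_section (h : M -> 'rV[R]_5) := smooth_map h /\
  forall (i : chart M) p, dom i p -> gram (h p) (A i (coord i p)) = 0.

(** A section h normal to g satisfies <dh,g> = -<h,dg> = 0, so (h, g) is a dual pair in every chart.
    The point of H4 on the hyperplane is asked for separately because the surface may be empty. *)
Lemma minimal_of_normal_section w c h : w != 0 -> lor w w + c ^+ 2 = 1 ->
  (exists2 x, H4 x & lor x w = c) ->
  normal_section h -> (forall p, H4 (h p)) -> (forall p, lor (h p) w = c) ->
  (forall p, lor (g p) w = 0) ->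
  exists (Q : umbilicalHypersurface R) (h : M -> 'rV[R]_5),
    [/\ minimal_immersion Q h /\ no_totally_geodesic_point (nuQ Q) h,
        has_sectional_curvature Q (- lor w w) & associate Q h g].
Proof.
move=> w0 wc [x0 Hx0 x0w] [sh hA] hH hw gw.
have tr x : (H4 `&` [set x | lor x w = c]) x -> row_free (col_mx x w).
  move=> [[xx _] xw]; apply: gram_unit_free; apply: gram_pair_unit => //.
  by rewrite xw wc oner_eq0.
have ne : (H4 `&` [set x | lor x w = c]) !=set0 by exists x0.
pose Q := UmbilicalHypersurface w0 ne tr.
exists Q, h.
have hhA (i : chart M) y : chart_image i y -> gram (h (param i y)) (A i y) = 0.
  by move=> /chart_imageP[ip xE]; rewrite -[in A i y]xE; exact: hA.
have perp (i : chart M) y : chart_image i y ->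
    lor (h (param i y)) (g (param i y)) = 0 /\
    forall a, lor (h (param i y)) ('D_(e_ a) (g \o param i) y) = 0.
  by move=> Uy; apply/(tangent_frame_perp (sg i) _ Uy); exact: hhA.
have dhN (i : chart M) y : chart_image i y ->
    gram ('J (h \o param i) y) (g (param i y)) = 0.
  move=> Uy; have oU := @image_open _ M i.
  have hg z : chart_image i z -> lor ((h \o param i) z) ((g \o param i) z) = 0.
    by move=> /perp[].
  apply/gram_rowP => a j; rewrite [j]ord1 row_id.
  rewrite (row_jacobian a (smooth_differentiable (sh i) Uy)).
  apply: etrans (derive_lor_cst (e_ a) oU (sh i) (sg i) hg Uy) _.
  by have [_ ->] := perp _ _ Uy; rewrite oppr0.
have key (i : chart M) y : chart_image i y ->
    [/\ row_free ('J (h \o param i) y), mean_curvature (nuQ Q) (h \o param i) y = 0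
      & ~ (forall v v', sff (nuQ Q) (h \o param i) y v v' = 0)].
  move=> Uy; apply: (@minimal_of_dual _ (chart_image i) (h \o param i) (g \o param i)
    w c _ (sh i) (sg i) _ _ _ _ _ _ _ y Uy (nuQ Q) erefl).
  - exact: image_open.
  - by move=> z _; have [] := hH (param i z).
  - by move=> z _; exact: hw.
  - by move=> z _; exact: gS.
  - by move=> z /perp[].
  - by move=> z _; exact: gw.
  - by move=> z /dhN.
  - by rewrite wc oner_eq0.
  - exact: gpos.
  - by have [_ _ mc] := stat; exact: mc.
  - have [ip yE] := chart_imageP Uy; move=> tg; apply: (ntg (p := param i y)).
    by exists i; [exact: ip|rewrite yE; exact: tg].
split.
- split; last first.
    move=> p [i ip tg]; have Ux : chart_image i (coord i p) by exists p.
    by have [_ _] := key _ _ Ux; apply.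
  split; last by move=> i y /key[].
  split; last by move=> i y /key[].
  + by move=> p; split; [exact: hH|exact: hw].
  + exact: sh.
- exact: (umbilical_curvature (Q := Q) wc).
- split; first exact: sg.
    exact: gS.
  move=> i y Uy; apply/normal_vectorP; split; last by rewrite -tr_gram dhN// trmx0.
  rewrite /nuQ gram_col_mxr !gram_lor gw lorC.
  by have [-> _] := perp _ _ Uy; rewrite !raddf0 row_mx0.
Qed.

Lemma constant_normal_perp w : (forall p, lor (g p) w = 0) ->
  forall (i : chart M) x, chart_image i x -> gram w (A i x) = 0.
Proof.
move=> gw i x Ux; apply/(tangent_frame_perp (sg i) _ Ux); split=> [|a].
  by rewrite lorC; exact: gw.
rewrite lorC; apply: (derive_lor_cstr (c := 0) _ (@image_open _ M i) (sg i) _ Ux).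
by move=> y _; exact: gw.
Qed.

Lemma normal_section_glue (Phi : chart M -> 'rV[R]_2 -> 'rV[R]_5) :
  (forall i, smooth_on (chart_image i) (Phi i)) ->
  (forall i j p, dom i p -> dom j p -> Phi i (coord i p) = Phi j (coord j p)) ->
  (forall i x, chart_image i x -> gram (Phi i x) (A i x) = 0) ->
  exists2 h, normal_section h & forall i p, dom i p -> h p = Phi i (coord i p).
Proof.
move=> sPhi inv PhiA; have [h [sh hE]] := glue_charts sPhi inv.
exists h => //; split=> // i p ip; rewrite (hE i)//.
by apply: PhiA; exists p.
Qed.

Lemma normal_section_comb w s (a b : M -> R) : (forall p, lor (g p) w = 0) ->
  normal_section s ->
  (forall i : chart M, smooth_on (chart_image i) (a \o param i)) ->
  (forall i : chart M, smooth_on (chart_image i) (b \o param i)) ->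
  normal_section (fun p => a p *: w + b p *: s p).
Proof.
move=> gw [ss sA'] sa sb; split=> i.
  have oU := @image_open _ M i.
  have h1 := smooth_scale oU (sa i) (smooth_cst (chart_image i) w).
  have h2 := smooth_scale oU (sb i) (ss i).
  exact: (smooth_add oU h1 h2).
move=> p ip; rewrite gramDl !gramZl sA'// (constant_normal_perp gw) ?scaler0 ?addr0//.
by exists p.
Qed.

(* The normal part of a constant timelike vector is timelike: it orients the normal
   bundle in time. *)
Lemma timelike_normal_section : exists s, [/\ normal_section s,
  forall p, lor (s p) (s p) <= -1,
  forall p, lor (delta_mx 0 0) (s p) = lor (s p) (s p)
  & forall w, (forall p, lor (g p) w = 0) -> forall p, lor (s p) w = - w 0 0].
Proof.
have [s sn sE] : exists2 s, normal_section s & forall i p, dom i p ->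
    s p = normal_part (A i (coord i p)) (delta_mx 0 0).
  apply: (@normal_section_glue (fun i x => normal_part (A i x) (delta_mx 0 0)))
    => [i|i j p ip jp|i x Ux].
  - by apply: smooth_normal_part => //; [exact: image_open|exact: Au].
  - have [P [P0 ->]] := A_change ip jp; apply: normal_part_mulmx.
      by rewrite unitmxE unitfE gt_eqF.
    by apply: Au; exists p.
  - exact/normal_part_perp/Au.
exists s; split=> // [p|p|w gw p]; have [i ip] := dom_cover p;
  have Ux : chart_image i (coord i p) by exists p.
- rewrite (sE i)//; apply: le_trans (timelike_normal_part _ (Apos Ux)) _.
  by rewrite lor_e0e0.
- have [_ sA'] := sn; have sp := sA' i p ip.
  by rewrite {2}(sE i p ip) lor_normal_part.
- rewrite (sE i)// lor_normal_part ?lor_e0//; exact: constant_normal_perp.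
Qed.

(* The oriented cross product of the surface and w; changing charts multiplies it by
   the determinant of the transition map, which is positive, so that the
   normalization is globally defined. *)
Lemma spacelike_normal_section w : lor w w < 0 -> (forall p, lor (g p) w = 0) ->
  exists2 z, normal_section z & forall p, lor (z p) (z p) = 1 /\ lor (z p) w = 0.
Proof.
move=> ww gw; pose B i x : 'M[R]_(4, 5) := col_mx w (A i x).
have wA := constant_normal_perp gw.
have Bu i x : chart_image i x -> gram (B i x) (B i x) \in unitmx.
  move=> Ux; apply: (@gram_col_unit _ 1 3); last exact: wA.
    by apply: gram1_unit; rewrite lt_eqF.
  exact: Au.
have zB i x : gram (cross (B i x)) w = 0 /\ gram (cross (B i x)) (A i x) = 0.
  exact: (@gram_col_eq0 _ 1 1 3 _ _ _ (cross_perp (B i x))).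
have zpos i x : chart_image i x -> 0 < lor (cross (B i x)) (cross (B i x)).
  move=> Ux; apply: (cross_neq0 (Bu _ _ Ux) ww) => y.
  move=> /(@gram_col_eq0 _ 1 1 3)[+ _].
  by rewrite gram_lor => /matrixP/(_ 0 0); rewrite !mxE eqxx mulr1n.
pose Phi i x := (Num.sqrt (lor (cross (B i x)) (cross (B i x))))^-1 *: cross (B i x).
have [|i j p ip jp|i x Ux|z zn zE] := @normal_section_glue Phi.
- move=> i; have oU := @image_open _ M i.
  have sc : smooth_on (chart_image i) (fun x => cross (B i x)).
    apply: smooth_cross => // n.
    apply: (@Ck_col_mx _ _ _ _ 1 3 5) => //; first exact: Ck_cst.
    exact: sA.
  apply: smooth_scale => // n; apply: CkV => //.
    by move=> x Ux; rewrite sqrtr_eq0 -ltNge zpos.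
  by apply: Ck_sqrt => //; [move=> x; exact: zpos|exact: smooth_lor].
- have [P [P0 AE]] := A_change ip jp; rewrite /Phi.
  have -> : B i (coord i p) = (@block_mx R 1 3 1 3 1%:M 0 0 P : 'M[R]_4) *m B j (coord j p).
    rewrite /B AE; apply/esym; apply: etrans (@mul_block_col _ 1 3 1 3 5 1%:M 0 0 P _ _) _.
    by rewrite !mul0mx mul1mx addr0 add0r.
  rewrite cross_mulmx (@det_ublock _ 1 3) det1 mul1r lorZl lorZr mulrA -expr2.
  rewrite sqrtrM ?sqr_ge0// sqrtr_sqr gtr0_norm// scalerA invfM mulrAC mulVf ?mul1r//.
  by rewrite gt_eqF.
- by rewrite /Phi gramZl (zB i x).2 scaler0.
exists z => // p; have [i ip] := dom_cover p; rewrite (zE i)//.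
have Ux : chart_image i (coord i p) by exists p.
split; first exact/normalize_pos/zpos.
rewrite /Phi lorZl; have /matrixP/(_ 0 0) := (zB i (coord i p)).1.
by rewrite gram_lor !mxE eqxx mulr1n => ->; rewrite mulr0.
Qed.

(** In each case h is sought as a combination of w and one more normal field. The equations <h,h> =
    -1 and <h,w> = c give the coefficients, and the time coordinate is then checked to be
    positive. *)
Lemma hyperbolic_section w1 : w1 != 0 -> (forall p, lor (g p) w1 = 0) ->
  exists w c h, [/\ w != 0, lor w w + c ^+ 2 = 1, forall p, lor (g p) w = 0,
    normal_section h & forall p, H4 (h p) /\ lor (h p) w = c].
Proof.
move=> w10 gw1.
have e0_w1 : w1 0 0 = 0 -> 0 < lor w1 w1.
  move=> w00; apply: (@lor_timelike_perp _ (delta_mx 0 0)) => //.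
    by rewrite lor_e0e0 ltrN10.
  by rewrite lor_e0 w00 oppr0.
(* A nonzero causal vector has a nonzero time coordinate; multiplying by its sign [k] makes it
   future-directed and keeps <w,w>. *)
have future : lor w1 w1 <= 0 -> exists k, 0 < (k *: w1) 0 0 /\ k ^+ 2 = 1.
  move=> w1w1; have w00 : w1 0 0 != 0.
    by apply: contraTneq w1w1 => /e0_w1; rewrite -ltNge.
  exists (Num.sg (w1 0 0)); split; last by rewrite sqr_sg w00.
  by rewrite mxE -normrEsg normr_gt0.
have [s [sn ss s0 sw]] := timelike_normal_section.
have ssm (i : chart M) : smooth_on (chart_image i)
    (fun x => lor (s (param i x)) (s (param i x))).
  by apply: smooth_lor => //; [exact: image_open|exact: sn.1..].
have cstR (c : R) (i : chart M) : smooth_on (chart_image i)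
    ((fun=> c) \o param i : _ -> R).
  by move=> n; exact: Ck_cst.
have [w1w1|w1w1|w1w1] := ltgtP (lor w1 w1) 0.
- have [k [k0 k2]] := future (ltW w1w1).
  pose w := (Num.sqrt (- lor w1 w1))^-1 *: (k *: w1).
  have ww : lor w w = -1.
    have kk : lor (k *: w1) (k *: w1) = lor w1 w1.
      by rewrite lorZl lorZr mulrA -expr2 k2 mul1r.
    by rewrite /w -kk; apply: normalize_neg; rewrite kk.
  have w00 : 0 < w 0 0.
    by rewrite /w mxE mulr_gt0// invr_gt0 sqrtr_gt0 oppr_gt0.
  have gw p : lor (g p) w = 0 by rewrite !lorZr gw1 !mulr0.
  clearbody w.
  have wlt0 : lor w w < 0 by rewrite ww ltrN10.
  have [z zn zP] := spacelike_normal_section wlt0 gw.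
  have s2 : Num.sqrt 2 ^+ 2 = 2 :> R by rewrite sqr_sqrtr.
  (* Here <h,h> = -2 + 1 and <h,w> = - sqrt 2, negative so that h lies in the same time cone as the
     future-directed w. *)
  exists w, (- Num.sqrt 2), (fun p => Num.sqrt 2 *: w + 1 *: z p); split=> //.
  + by apply/eqP => e; move: wlt0; rewrite e lor0l ltxx.
  + by rewrite ww sqrrN s2; ring.
  + exact: (normal_section_comb gw zn (cstR _) (cstR 1)).
  move=> p; have [zz zw] := zP p; rewrite scale1r.
  have hh : lor (Num.sqrt 2 *: w + z p) (Num.sqrt 2 *: w + z p) = -1.
    rewrite lorDl !lorDr !lorZl !lorZr (lorC w) zw zz ww mulr0 addr0 add0r mulrA -expr2 s2.
    by ring.
  have hw : lor (Num.sqrt 2 *: w + z p) w = - Num.sqrt 2.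
    by rewrite lorDl lorZl zw ww addr0 mulrN1.
  split=> //; split=> //; apply: (lor_future wlt0 w00); first by rewrite hh ltrN10.
  by rewrite hw oppr_lt0 sqrtr_gt0.
- pose w := (Num.sqrt (lor w1 w1))^-1 *: w1.
  have ww : lor w w = 1 by exact: normalize_pos.
  have gw p : lor (g p) w = 0 by rewrite lorZr gw1 mulr0.
  clearbody w; pose sg0 := - w 0 0.
  (* [q] is minus the square of s - <s,w> w, the component of the time-orienting section orthogonal
     to w; dividing by its root gives h. *)
  pose q p := sg0 ^+ 2 - lor (s p) (s p).
  have q0 p : 0 < q p by have := ss p; have := sqr_ge0 sg0; rewrite /q; lra.
  pose k p := (Num.sqrt (q p))^-1.
  have k2 p : k p ^+ 2 * q p = 1.
    by rewrite /k exprVn sqr_sqrtr ?ltW// mulVf// gt_eqF.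
  have k0 p : 0 < k p by rewrite invr_gt0 sqrtr_gt0.
  have sk (i : chart M) : smooth_on (chart_image i) (k \o param i).
    have oU := @image_open _ M i.
    have sq : smooth_on (chart_image i) (q \o param i).
      move=> n; apply: (@Ck_ext _ _ _ _ _ (fun x => sg0 ^+ 2 + (-1) *
        lor (s (param i x)) (s (param i x)))) => //.
        by move=> x _; rewrite mulN1r.
      by apply: CkD => //; [exact: Ck_cst|apply: CkM => //; [exact: Ck_cst|exact: ssm]].
    move=> n; apply: CkV => //; last by apply: Ck_sqrt.
    by move=> x _; rewrite sqrtr_eq0 -ltNge.
  have swp p : lor (s p) w = sg0 by rewrite sw.
  exists w, 0, (fun p => (- sg0 * k p) *: w + k p *: s p); split=> //.
  + by apply/eqP => e; move: ww; rewrite e lor0l => /esym/eqP; rewrite oner_eq0.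
  + by rewrite ww expr0n addr0.
  + apply: normal_section_comb => // i n; apply: CkM => //; last exact: sk.
      exact: image_open.
    exact: Ck_cst.
  move=> p; split; last first.
    by rewrite lorDl !lorZl swp ww; ring.
  split.
    rewrite lorDl !lorDr !lorZl !lorZr (lorC w) swp ww.
    transitivity (- (k p ^+ 2 * q p)); last by rewrite k2.
    by rewrite /q; move: (lor _ _) (k p) => t kp; ring.
  (* The time coordinate is minus the pairing with e_0, and <e_0,s> = <s,s>, <e_0,w> = <s,w> =
     sg0. *)
  have E : (- sg0 * k p *: w + k p *: s p) 0 0 = k p * q p.
    rewrite -[LHS]opprK -lor_e0 lorDr !lorZr s0 lor_e0 /q -/sg0; move: (lor _ _) => t; ring.
  by rewrite E mulr_gt0.
have [|k [k0 k2]] := future; first by rewrite w1w1.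
pose w := k *: w1.
have ww : lor w w = 0 by rewrite lorZl lorZr w1w1 !mulr0.
have gw p : lor (g p) w = 0 by rewrite lorZr gw1 mulr0.
have w00 : 0 < w 0 0 by exact: k0.
clearbody w; pose b := (w 0 0)^-1.
have b0 : 0 < b by rewrite invr_gt0.
(* [b] makes <h,w> = b <s,w> equal to -1; since w is null, <h,h> = -2 a + b^2 <s,s>, and this is -1
   for the chosen [a]. *)
pose a p := (1 + b ^+ 2 * lor (s p) (s p)) / 2.
have swp p : b * lor (s p) w = -1 by rewrite sw// mulrN mulVf// gt_eqF.
exists w, (-1), (fun p => a p *: w + b *: s p); split=> //.
- by apply/eqP => e; move: w00; rewrite e mxE ltxx.
- by rewrite ww; ring.
- apply: (normal_section_comb gw sn _ (cstR b)) => i n.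
  have oU := @image_open _ M i.
  apply: CkM => //; last exact: Ck_cst.
  apply: CkD => //; first exact: Ck_cst.
  by apply: CkM => //; [exact: Ck_cst|exact: ssm].
move=> p; split; last by rewrite lorDl !lorZl swp ww mulr0 add0r.
split.
  rewrite lorDl !lorDr !lorZl !lorZr (lorC w) ww.
  transitivity (2 * a p * (b * lor (s p) w) + b ^+ 2 * lor (s p) (s p)); first by ring.
  by rewrite swp /a; field.
have E : (a p *: w + b *: s p) 0 0 = a p * w 0 0 - b * lor (s p) (s p).
  by rewrite -[LHS]opprK -lor_e0 lorDr !lorZr s0 lor_e0; ring.
have bw : b * w 0 0 = 1 by rewrite mulVf// gt_eqF.
have -> : (a p *: w + b *: s p) 0 0 = w 0 0 / 2 - b * lor (s p) (s p) / 2.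
  rewrite E /a; set t := lor _ _.
  have -> : (1 + b ^+ 2 * t) / 2 * w 0 0 - b * t =
    w 0 0 / 2 + b * t * (b * w 0 0) / 2 - b * t by field.
  by rewrite bw; field.
rewrite subr_gt0 ltr_pM2r ?invr_gt0//; apply: lt_trans w00.
by rewrite pmulr_rlt0//; apply: le_lt_trans (ss p) _; rewrite ltrN10.
Qed.

End Construction.

Theorem proposition2p4 (R : realType) (M : orientedSurface R)
    (m : riemannianMetric M) :
  (forall (Q : umbilicalHypersurface R) (h hhat : M -> 'rV[R]_5),
     minimal_immersion Q h -> isometric m h ->
     no_totally_geodesic_point (nuQ Q) h ->
     associate Q h hhat ->
     [/\ stationary_immersion hhat, flat_normal_bundle hhat
       & no_totally_geodesic_point (@nuS R) hhat]) /\
  (forall g : M -> 'rV[R]_5,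
     stationary_immersion g -> isometric m g -> flat_normal_bundle g ->
     no_totally_geodesic_point (@nuS R) g ->
     exists (w : 'rV[R]_5) (Q : umbilicalHypersurface R) (h : M -> 'rV[R]_5),
       [/\ w != 0,
           minimal_immersion Q h /\ no_totally_geodesic_point (nuQ Q) h,
           has_sectional_curvature Q (- lor w w),
           forall p : M, lor (g p) w = 0
         & associate Q h g]).
Proof.
split=> [Q h N hmin iso ntg assoc|g stat iso flat ntg].
  exact: (associate_stationary hmin iso ntg assoc).
(* An empty surface gives no point from which to obtain [w]; the spacelike vector e_1 with level 0
   serves, its hyperplane meeting H4 at e_0. *)
have [[p0 _]|nM] := pselect (exists p : M, True); last first.
  have noM (p : M) : False by apply: nM; exists p.
  pose w : 'rV[R]_5 := delta_mx 0 1.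
  have ww : lor w w = 1.
    rewrite lor_sum (bigD1 1)//= big1 ?addr0 => [|i i1].
      by rewrite !mxE !eqxx mulr1 mulr1n mulr1.
    by rewrite [w 0 i]mxE (negPf i1) andbF !mulr0.
  have w0 : w != 0.
    by apply/eqP => e; move: ww; rewrite e lor0l => /esym/eqP; rewrite oner_eq0.
  have wc : lor w w + 0 ^+ 2 = 1 by rewrite ww expr0n addr0.
  have x0 : exists2 x : 'rV[R]_5, H4 x & lor x w = 0.
    exists (delta_mx 0 0); last by rewrite lor_e0 mxE oppr0.
    by split; [exact: lor_e0e0|rewrite mxE !eqxx ltr01].
  have sg : smooth_map g by have [[]] := stat.
  have gn : normal_section g g by split=> // i p; have := noM p.
  have [Q [h [hmin K assoc]]] := minimal_of_normal_section stat ntg w0 wc x0 gn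
    (fun p => False_ind _ (noM p)) (fun p => False_ind _ (noM p))
    (fun p => False_ind _ (noM p)).
  by exists w, Q, h; split=> // p; have := noM p.
have [w1 w10 gw1] := stationary_constant_normal stat flat ntg p0.
have [w [c [h [w0 wc gw hn hP]]]] := hyperbolic_section stat w10 gw1.
have x0 : exists2 x, H4 x & lor x w = c by exists (h p0); have [] := hP p0.
have [Q [k [kmin K assoc]]] := minimal_of_normal_section stat ntg w0 wc x0 hn
  (fun p => (hP p).1) (fun p => (hP p).2) gw.
by exists w, Q, k; split.
Qed.
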